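(* Let $T>0$ and let $\ell=\ell(u,\rho,B)$ be a Lagrangian as described in the context. Suppose that $u,w:[0,T]\to U_h^{\operatorname{grad}}$, $B:[0,T]\to U_h^{\operatorname{div}}$, $\rho,\theta:[0,T]\to F_h$ and $J,H,U,E,\alpha,j:[0,T]\to U_h^{\operatorname{curl}}$ (with $u,\rho,B$ and $\frac{\delta\ell}{\delta u}$ differentiable in time) satisfy, for all $t\in[0,T]$, $$\begin{aligned} \left\langle \partial_t \tfrac{\delta \ell}{\delta u}, v \right\rangle + a(w, u, v) + b_h(\theta,\rho,v) + \langle \alpha, v \rangle &= d(u,v), && \forall v \in U_h^{\operatorname{grad}},\\ \langle \partial_t \rho, \sigma \rangle + b_h(\sigma,\rho,u) &= 0, && \forall \sigma \in F_h,\\ \langle \partial_t B, C \rangle + \langle \operatorname{curl} E, C \rangle &= -\nu \langle \operatorname{curl} j, C \rangle, && \forall C \in U_h^{\operatorname{div}},\\ \langle w, z \rangle &= \left\langle \tfrac{\delta \ell}{\delta u}, z \right\rangle, && \forall z \in U_h^{\operatorname{grad}},\\ \langle \theta, \tau \rangle &= \left\langle \tfrac{\delta \ell}{\delta \rho}, \tau \right\rangle, && \forall \tau \in F_h,\\ \langle J, K \rangle &= -\left\langle \tfrac{\delta \ell}{\delta B}, \operatorname{curl} K \right\rangle, && \forall K \in U_h^{\operatorname{curl}},\\ \langle H, G \rangle &= \langle B, G \rangle, && \forall G \in U_h^{\operatorname{curl}},\\ \langle U, V \rangle &= \langle u, V \rangle, && \forall V \in U_h^{\operatorname{curl}},\\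 \langle E, F \rangle &= -\langle U \times H, F \rangle, && \forall F \in U_h^{\operatorname{curl}},\\ \langle \alpha, \beta \rangle &= -\langle J \times H, \beta \rangle, && \forall \beta \in U_h^{\operatorname{curl}},\\ \langle j, k \rangle &= \langle B, \operatorname{curl} k \rangle, && \forall k \in U_h^{\operatorname{curl}}, \end{aligned}$$ where the functional derivatives of $\ell$ are evaluated at $(u(t),\rho(t),B(t))$. If $B(0)$ is exactly divergence-free, then for all $t\in[0,T]$: $$\begin{aligned} \operatorname{div} B(t) &\equiv 0,\\ \frac{d}{dt}\int_\Omega \rho\,dx &= 0,\\ \frac{d}{dt}\mathcal{E} &= d(u,u) - e_h\left(B,\pi_h^{\operatorname{div}}\tfrac{\delta\ell}{\delta B}\right),\\ \frac{d}{dt}\int_\Omega A\cdot B\,dx &= 2\,e_h(B,\pi_h^{\operatorname{div}}A), \end{aligned}$$ where $\mathcal{E}=\langle\frac{\delta\ell}{\delta u},u\rangle-\ell(u,\rho,B)$ is the total energy and $A$ is any (time-dependent) vector field satisfying $\operatorname{curl}A(t)=B(t)$ and $A(t)\times n|_{\partial\Omega}=0$ for all $t$, i.e. $A(t)\in H_0(\operatorname{curl},\Omega)$ with $\operatorname{curl}A(t)=B(t)$.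
   Context: Let $d\in\{2,3\}$, let $\Omega\subset\mathbb{R}^d$ be a bounded domain with outward unit normal $n$ on $\partial\Omega$, and let $\mathcal{T}_h$ be a (conforming simplicial) triangulation of $\Omega$, belonging to a shape-regular family. $P_r(K)$ denotes polynomials of degree at most $r$ on a simplex $K$. $\langle\cdot,\cdot\rangle$ is the $L^2(\Omega)$ inner product (of scalar or vector fields). Fix integers $r,s\ge0$ and constants $\mu>0$, $\lambda$ with $2\mu+3\lambda\ge0$, and $\nu>0$. Continuous spaces: $H_0^1(\Omega)$ is the usual space; $H_0(\operatorname{div},\Omega)=\{u\in L^2(\Omega)^d: \operatorname{div}u\in L^2,\ u\cdot n=0\text{ on }\partial\Omega\}$; for $d=3$, $H_0(\operatorname{curl},\Omega)=\{u\in L^2(\Omega)^3:\operatorname{curl}u\in L^2(\Omega)^3,\ u\times n=0\text{ on }\partial\Omega\}$. Finite element spaces: - $U_h^{\operatorname{grad}}=\{u\in H_0^1(\Omega)^d: u|_K\in P_{r+1}(K)^d\ \forall K\in\mathcal{T}_h\}$ (continuous Galerkin); - $U_h^{\operatorname{div}}=\{u\in H_0(\operatorname{div},\Omega): u|_K\in P_r(K)^d+xP_r(K)\ \forall K\}$ (Raviart-Thomas); - $F_h=\{f\in L^2(\Omega): f|_K\in P_s(K)\ \forall K\}$ (discontinuous Galerkin); - for $d=3$, $U_h^{\operatorname{curl}}=\{u\in H_0(\operatorname{curl},\Omega): u|_K\in P_r(K)^3+x\times P_r(K)^3\ \forall K\}$ (Nedelec, first kind). Convention for $d=2$: planar fields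 $(f_1,f_2)$ are identified with $(f_1,f_2,0)$ and scalars $g$ with the orthogonal fields $(0,0,g)$, and cross products and curls are the three-dimensional ones for fields independent of $x_3$. Elements of $U_h^{\operatorname{grad}},U_h^{\operatorname{div}}$ are planar. $U_h^{\operatorname{curl}}$ consists of fields whose planar part lies in $\{u\in L^2(\Omega)^2:\partial_{x_1}u_2-\partial_{x_2}u_1\in L^2,\ u_1n_2-u_2n_1=0\text{ on }\partial\Omega,\ u|_K\in P_r(K)^2+(x_2,-x_1)P_r(K)\ \forall K\}$ and whose orthogonal component lies in $\{g\in H_0^1(\Omega): g|_K\in P_{r+1}(K)\ \forall K\}$ (so automatically $H,U,\alpha$ are planar and $J,E,j$ are orthogonal to the plane); $H_0(\operatorname{curl},\Omega)$ likewise consists of fields with planar part in $L^2$ with $L^2$ scalar curl and zero tangential trace, and orthogonal component in $H^1_0(\Omega)$. $\pi_h^{\operatorname{div}}$ is the $L^2$-orthogonal projector onto $U_h^{\operatorname{div}}$. The map $\operatorname{curl}_h:U_h^{\operatorname{div}}\to U_h^{\operatorname{curl}}$ is defined by $\langle\operatorname{curl}_hu,v\rangle=\langle u,\operatorname{curl}v\rangle$ for all $v\in U_h^{\operatorname{curl}}$. Let $\mathcal{E}_h$ be the set of interior $(d-1)$-dimensional faces. On $e=K_1\cap K_2\in\mathcal{E}_h$, for piecewise smooth scalar $f$ with $f_i=f|_{K_i}$, set $\llbracket f\rrbracket=f_1n_1+f_2n_2$ and $\{f\}=\frac{f_1+f_2}{2}$, where $n_1$ is the unit normal to $e$ pointing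 from $K_1$ to $K_2$ and $n_2=-n_1$. Forms: - $a(w,u,v)=-\int_\Omega w\cdot[u,v]\,dx$, with $[u,v]=u\cdot\nabla v-v\cdot\nabla u$; - $b_h(f,g,u)=-\sum_{K\in\mathcal{T}_h}\int_K(u\cdot\nabla f)g\,dx+\sum_{e\in\mathcal{E}_h}\int_e u\cdot\llbracket f\rrbracket\{g\}\,ds$ for $f,g\in F_h$ and $u\in U_h^{\operatorname{div}}$ or $U_h^{\operatorname{grad}}$; - $d(u,v)=-\int_\Omega[\mu\nabla u:\nabla v+(\lambda+\mu)\operatorname{div}u\operatorname{div}v]\,dx$; - $e_h(B,C)=-\nu\langle\operatorname{curl}_hB,\operatorname{curl}_hC\rangle$ for $B,C\in U_h^{\operatorname{div}}$. The Lagrangian $\ell$ is a real-valued, continuously differentiable function of $(u,\rho,B)$ whose functional derivatives $\frac{\delta\ell}{\delta u},\frac{\delta\ell}{\delta\rho},\frac{\delta\ell}{\delta B}$ are $L^2$ fields (vector, scalar, vector) characterized by $\frac{d}{d\varepsilon}\big|_{\varepsilon=0}\ell(u+\varepsilon\,\delta u,\rho,B)=\langle\frac{\delta\ell}{\delta u},\delta u\rangle$ and analogously for $\rho$ and $B$. *)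

(* Defs.v *)
From HB Require Import structures.
From mathcomp Require Import all_boot all_order all_algebra.
From mathcomp Require Import all_classical all_reals all_analysis.

Set Implicit Arguments.
Unset Strict Implicit.
Unset Printing Implicit Defensive.

Import Order.TTheory GRing.Theory Num.Theory numFieldNormedType.Exports.

Local Open Scope classical_set_scope.
Local Open Scope ring_scope.

Definition rV_display : measure_display.
Proof. exact: default_measure_display. Qed.

Section rV_measurable.
Context {R : realType} {n : nat}.

(* The sigma-algebra generated by the coordinates, as for [n.-tuple R] in the
   library; it is the Borel sigma-algebra of R^n. *)
Definition rV_coor (i : 'I_n) (x : 'rV[R]_n) : measurableTypeR R := x 0 i.

Let rV_set0 : g_sigma_preimage rV_coor set0.
Proof. exact: sigma_algebra0. Qed.

Let rV_setC A : g_sigma_preimage rV_coor A -> g_sigma_preimage rV_coor (~` A).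
Proof. exact: sigma_algebraC. Qed.

Let rV_bigcup (F : (set 'rV[R]_n)^nat) :
  (forall i, g_sigma_preimage rV_coor (F i)) ->
  g_sigma_preimage rV_coor (\bigcup_i (F i)).
Proof. exact: sigma_algebra_bigcup. Qed.

HB.instance Definition _ := @isMeasurable.Build rV_display
  'rV[R]_n (g_sigma_preimage rV_coor) rV_set0 rV_setC rV_bigcup.

End rV_measurable.

Definition image_measure {d1 d2 : measure_display} {T1 : measurableType d1}
    {T2 : measurableType d2} {R : realType} (m : {measure set T1 -> \bar R})
    (f : T1 -> T2) (mf : measurable_fun [set: T1] f) :
    {measure set T2 -> \bar R} :=
  measure_function_pushforward__canonical__measure_function_Measure m mf.

Section lebesgue_rV.
Context {R : realType}.

Definition rV_snoc n (x : 'rV[R]_n * measurableTypeR R) : 'rV[R]_n.+1 :=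
  \row_(i < n.+1) if unlift ord_max i is Some j then x.1 0 j else x.2.

Lemma measurable_rV_coor n (i : 'I_n) :
  measurable_fun [set: 'rV[R]_n] (@rV_coor R n i).
Proof.
move=> _ Y mY; rewrite setTI; apply: sub_sigma_algebra => /=.
rewrite -bigcup_seq/=; exists i => /=; first by rewrite mem_index_enum.
by exists Y => //; rewrite setTI.
Qed.

Lemma measurable_rV_snoc n : measurable_fun [set: _] (@rV_snoc n).
Proof.
suff : g_sigma_preimage (fun i => @rV_coor R n.+1 i \o @rV_snoc n) `<=` measurable.
  rewrite g_sigma_preimage_comp => h _ A mA; apply: h.
  by exists A.
apply: smallest_sub; first exact: sigma_algebra_measurable.
rewrite -bigcup_mkord_ord; apply: bigcup_sub => i Ii A [B mB <-].
suff mc : measurable_fun setT (@rV_coor R n.+1 (inord i) \o @rV_snoc n).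
  exact: mc.
rewrite (_ : _ \o _ = fun x => if unlift ord_max (inord i : 'I_n.+1) is Some j
  then rV_coor j x.1 else x.2); last first.
  by apply/funext => x; rewrite /= /rV_coor mxE.
case: unliftP => [j _|_]; last exact: measurable_snd.
by apply: measurableT_comp; [exact: measurable_rV_coor|exact: measurable_fst].
Qed.

Fixpoint leb n : {measure set 'rV[R]_n -> \bar R} :=
  match n with
  | 0 => dirac (0 : 'rV[R]_0)
  | m.+1 => image_measure (product_measure1 (leb m) (@lebesgue_measure R))
      (@measurable_rV_snoc m)
  end.

End lebesgue_rV.

(* Points lie in R^d.  Every vector field takes its values in R^3, also when
   d = 2: a planar field (f1, f2) is the field (f1, f2, 0) and a scalar g stands
   for (0, 0, g). *)
Notation sfield R d := ('rV[R]_d -> R) (only parsing).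
Notation vfield R d := ('rV[R]_d -> 'rV[R]_3) (only parsing).

Definition i0 : 'I_3 := @Ordinal 3 0 isT.
Definition i1 : 'I_3 := @Ordinal 3 1 isT.
Definition i2 : 'I_3 := @Ordinal 3 2 isT.

Section vectors.
Context {R : realType}.

Definition vec3 (a b c : R) : 'rV[R]_3 := \row_(i < 3) nth 0 [:: a; b; c] i.

Definition dot n (x y : 'rV[R]_n) : R := \sum_(i < n) x 0 i * y 0 i.

Definition cross (x y : 'rV[R]_3) : 'rV[R]_3 :=
  vec3 (x 0 i1 * y 0 i2 - x 0 i2 * y 0 i1)
       (x 0 i2 * y 0 i0 - x 0 i0 * y 0 i2)
       (x 0 i0 * y 0 i1 - x 0 i1 * y 0 i0).

Definition emb d (x : 'rV[R]_d) : 'rV[R]_3 :=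
  \row_(i < 3) if insub (i : nat) is Some j then x 0 (j : 'I_d) else 0.

Definition component d (u : vfield R d) (i : 'I_3) : sfield R d := fun x => u x 0 i.

Definition crossf d (u v : vfield R d) : vfield R d :=
  fun x => cross (u x) (v x).

(* Vacuous for d = 3. *)
Definition planar d (u : vfield R d) : Prop :=
  forall (i : 'I_3) x, (d <= i)%N -> u x 0 i = 0.

End vectors.

Section classical_operators.
Context {R : realType} {d : nat}.

(* For i >= d this vector is 0, hence so is the derivative along it: fields on
   the plane do not depend on the third coordinate. *)
Definition dir (i : 'I_3) : 'rV[R]_d := \row_(j < d) (j == i :> nat)%:R.

Definition partial (i : 'I_3) (f : sfield R d) : sfield R d :=
  fun x => 'D_(dir i) f x.

Definition grad (f : sfield R d) : vfield R d :=
  fun x => \row_(i < 3) partial i f x.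

Definition divergence (u : vfield R d) : sfield R d :=
  fun x => \sum_(i < 3) partial i (component u i) x.

Definition curl (u : vfield R d) : vfield R d := fun x =>
  vec3 (partial i1 (component u i2) x - partial i2 (component u i1) x)
       (partial i2 (component u i0) x - partial i0 (component u i2) x)
       (partial i0 (component u i1) x - partial i1 (component u i0) x).

(* C^infinity: all iterated partial derivatives are differentiable. *)
Definition smooth (f : sfield R d) : Prop :=
  forall (l : seq 'I_3) (x : 'rV[R]_d), differentiable (foldr partial f l) x.

Definition test (Omega : set 'rV[R]_d) (f : sfield R d) : Prop :=
  smooth f /\ exists K : set 'rV[R]_d,
    [/\ compact K, K `<=` Omega & forall x, ~ K x -> f x = 0].

Definition vtest (Omega : set 'rV[R]_d) (f : vfield R d) : Prop :=
  forall i, test Omega (component f i).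

End classical_operators.

Section sobolev.
Context {R : realType} {d : nat} (Omega : set 'rV[R]_d).
Implicit Types (f : sfield R d) (u : vfield R d).

Definition L2s f : Prop :=
  measurable_fun Omega (f : 'rV[R]_d -> measurableTypeR R) /\
  (leb d).-integrable Omega (fun x => (f x ^+ 2)%:E).

Definition L2 u : Prop := forall i, L2s (component u i).

Definition integrate f : R := \int[leb d]_(x in Omega) f x.

Definition ips (f g : sfield R d) : R := integrate (fun x => f x * g x).

Definition ip (u v : vfield R d) : R := integrate (fun x => dot (u x) (v x)).

Definition weak_grad f (g : vfield R d) : Prop := forall phi (i : 'I_3),
  test Omega phi -> ips f (partial i phi) = - ips (component g i) phi.

Definition weak_div u (g : sfield R d) : Prop := forall phi,
  test Omega phi -> ip u (grad phi) = - ips g phi.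

Definition weak_curl u (g : vfield R d) : Prop := forall phi,
  vtest Omega phi -> ip u (curl phi) = ip g phi.

(* A choice among representatives that agree almost everywhere. *)
Definition wgrad f : vfield R d :=
  xget (fun=> 0) [set g | L2 g /\ weak_grad f g].

Definition wdiv u : sfield R d :=
  xget (fun=> 0) [set g | L2s g /\ weak_div u g].

Definition wcurl u : vfield R d :=
  xget (fun=> 0) [set g | L2 g /\ weak_curl u g].

(* In the next three spaces the boundary condition (zero trace, zero normal
   trace, zero tangential trace) is expressed, as usual, by approximability in
   the graph norm by smooth fields with compact support in Omega.
   For d = 2, H0curl splits into a condition on the planar part (scalar curl
   and tangential trace) and H10 for the orthogonal component, because [curl]
   maps (f1, f2, g) to (d_2 g, - d_1 g, d_1 f2 - d_2 f1). *)
Definition H10 f : Prop :=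
  L2s f /\ exists g : vfield R d, [/\ L2 g, weak_grad f g &
    forall e, 0 < e -> exists phi, [/\ test Omega phi,
      ips (f - phi) (f - phi) < e & ip (g - grad phi) (g - grad phi) < e]].

Definition H0div u : Prop :=
  L2 u /\ exists g : sfield R d, [/\ L2s g, weak_div u g &
    forall e, 0 < e -> exists phi, [/\ vtest Omega phi,
      ip (u - phi) (u - phi) < e & ips (g - divergence phi) (g - divergence phi) < e]].

Definition H0curl u : Prop :=
  L2 u /\ exists g : vfield R d, [/\ L2 g, weak_curl u g &
    forall e, 0 < e -> exists phi, [/\ vtest Omega phi,
      ip (u - phi) (u - phi) < e & ip (g - curl phi) (g - curl phi) < e]].

End sobolev.

Record mesh (R : realType) (d : nat) := Mesh {
  ncell : nat;
  vertex : 'I_ncell -> 'I_d.+1 -> 'rV[R]_d }.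

Section triangulations.
Context {R : realType} {d : nat} (M : mesh R d).
Implicit Types k l : 'I_(ncell M).

Definition is_vertex k (x : 'rV[R]_d) : bool := [exists i, vertex k i == x].

Definition nondegenerate k : Prop :=
  (\matrix_(j < d) (vertex k (lift ord0 j) - vertex k ord0)) \in unitmx.

Definition cell k : set 'rV[R]_d :=
  [set x | exists c : 'I_d.+1 -> R,
    [/\ forall i, 0 <= c i, \sum_i c i = 1 & x = \sum_i c i *: vertex k i]].

Definition common_face k l : set 'rV[R]_d :=
  [set x | exists c : 'I_d.+1 -> R,
    [/\ forall i, 0 <= c i, \sum_i c i = 1, x = \sum_i c i *: vertex k i &
        forall i, c i != 0 -> is_vertex l (vertex k i)]].

(* The equality with the interior says that Omega lies on one side of its
   boundary (no slits along faces). *)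
Definition triangulation (Omega : set 'rV[R]_d) : Prop :=
  [/\ forall k, nondegenerate k,
      closure Omega = \bigcup_k cell k,
      Omega = interior (\bigcup_k cell k),
      forall k l, k != l -> interior (cell k) `&` interior (cell l) = set0 &
      forall k l, k != l -> cell k `&` cell l = common_face k l].

End triangulations.

Definition bounded_domain {R : realType} {d : nat} (Omega : set 'rV[R]_d) : Prop :=
  [/\ open Omega, connected Omega, Omega !=set0 & bounded_set Omega].

Section finite_elements.
Context {R : realType} {d : nat} (Omega : set 'rV[R]_d) (M : mesh R d).
Implicit Types (f : sfield R d) (u : vfield R d) (k : 'I_(ncell M)).

Definition poly_le (r : nat) f : Prop :=
  exists c : {ffun 'I_d -> 'I_r.+1} -> R, forall x,
    f x = \sum_(a : {ffun 'I_d -> 'I_r.+1} | (\sum_(i < d) a i <= r)%N)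
      c a * \prod_(i < d) x 0 i ^+ a i.

Definition vpoly_le (r : nat) u : Prop := forall i, poly_le r (component u i).

Definition agree (A : set 'rV[R]_d) (T : Type) (f g : 'rV[R]_d -> T) : Prop :=
  {ae leb d, forall x, A x -> f x = g x}.

Definition Ugrad (r : nat) u : Prop :=
  (forall i, H10 Omega (component u i)) /\
  forall k, exists p, [/\ vpoly_le r.+1 p, planar p & agree (cell k) u p].

Definition Udiv (r : nat) u : Prop :=
  H0div Omega u /\
  forall k, exists p q, [/\ vpoly_le r p, planar p, poly_le r q &
    agree (cell k) u (fun x => p x + q x *: emb x)].

Definition Fdg (s : nat) f : Prop :=
  L2s Omega f /\
  forall k, exists2 p, poly_le s p & agree (cell k) f p.

(* For d = 2: P_r^2 + (x2, -x1) P_r in the plane, P_(r+1) orthogonally. *)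
Definition nedelec (r : nat) u : Prop :=
  if d == 2 then
    exists p q g, [/\ vpoly_le r p, planar p, poly_le r q, poly_le r.+1 g &
      forall x, u x = p x + q x *: vec3 (emb x 0 i1) (- emb x 0 i0) 0
                      + g x *: vec3 0 0 1]
  else
    exists p q, [/\ vpoly_le r p, vpoly_le r q &
      forall x, u x = p x + cross (emb x) (q x)].

Definition Ucurl (r : nat) u : Prop :=
  H0curl Omega u /\
  forall k, exists2 p, nedelec r p & agree (cell k) u p.

Definition pi_div (r : nat) u : vfield R d :=
  xget (fun=> 0) [set p | Udiv r p /\
    forall v, Udiv r v -> ip Omega p v = ip Omega u v].

Definition curl_h (r : nat) u : vfield R d :=
  xget (fun=> 0) [set c | Ucurl r c /\
    forall v, Ucurl r v -> ip Omega c v = ip Omega u (wcurl Omega v)].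

(* The polynomial f|_K of a piecewise polynomial f, which also gives the
   trace of f from K on the faces of K. *)
Definition restr f k : sfield R d :=
  xget (fun=> 0) [set p | (exists m, poly_le m p) /\ agree (cell k) f p].

Definition vrestr u k : vfield R d :=
  fun x => \row_(i < 3) restr (component u i) k x.

End finite_elements.

Section faces.
Context {R : realType} {n : nat}.

(* The face with vertices p 0, ..., p n in R^(n+1) is parametrized over the
   reference simplex of R^n; the area factor is the root of the Gram
   determinant. *)
Definition ref_simplex : set 'rV[R]_n :=
  [set s | (forall j, 0 <= s 0 j) /\ \sum_j s 0 j <= 1].

Definition face_edge (p : 'I_n.+1 -> 'rV[R]_n.+1) (j : 'I_n) : 'rV[R]_n.+1 :=
  p (lift ord0 j) - p ord0.

Definition face_param (p : 'I_n.+1 -> 'rV[R]_n.+1) (s : 'rV[R]_n) :=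
  p ord0 + \sum_j s 0 j *: face_edge p j.

Definition face_integral (p : 'I_n.+1 -> 'rV[R]_n.+1) (f : sfield R n.+1) : R :=
  Num.sqrt (\det (\matrix_(i, j) dot (face_edge p i) (face_edge p j))) *
  \int[leb n]_(s in ref_simplex) f (face_param p s).

Definition face_normal (p : 'I_n.+1 -> 'rV[R]_n.+1) (o : 'rV[R]_n.+1) :
    'rV[R]_n.+1 :=
  xget 0 [set nu | [/\ dot nu nu = 1, forall j, dot nu (face_edge p j) = 0 &
                       0 < dot nu (p ord0 - o)]].

Variable M : mesh R n.+1.

Definition facet (k : 'I_(ncell M)) (i : 'I_n.+2) : 'I_n.+1 -> 'rV[R]_n.+1 :=
  fun j => vertex k (lift i j).

Definition shared (k l : 'I_(ncell M)) (i : 'I_n.+2) : bool :=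
  [forall j, is_vertex l (facet k i j)].

End faces.

Section forms.
Context {R : realType} {d : nat} (Omega : set 'rV[R]_d).
Implicit Types u v w : vfield R d.

Definition convect u v : vfield R d :=
  fun x => \row_(i < 3) dot (u x) (wgrad Omega (component v i) x).

Definition bracket u v : vfield R d := convect u v - convect v u.

Definition form_a w u v : R := - ip Omega w (bracket u v).

Definition form_d (mu lambda : R) u v : R :=
  - integrate Omega (fun x =>
      mu * (\sum_(i < 3) dot (wgrad Omega (component u i) x) (wgrad Omega (component v i) x))
      + (lambda + mu) * (wdiv Omega u x * wdiv Omega v x)).

Definition form_e (M : mesh R d) (r : nat) (nu : R) (B C : vfield R d) : R :=
  - nu * ip Omega (curl_h Omega M r B) (curl_h Omega M r C).

End forms.

Section form_b.
Context {R : realType} {n : nat} (M : mesh R n.+1).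

(* Every interior face is K_k \cap K_l for exactly one pair k < l, with
   K_1 = K_k and K_2 = K_l.  As u . n is single-valued on faces, the trace of u
   may be taken from K_1. *)
Definition form_b (f g : sfield R n.+1) (u : vfield R n.+1) : R :=
  - (\sum_(k < ncell M) integrate (cell k)
       (fun x => dot (u x) (grad (restr f k) x) * g x))
  + \sum_(k < ncell M) \sum_(l < ncell M | (k < l)%N)
    \sum_(i < n.+2 | shared k l i)
      let n1 := emb (face_normal (facet k i) (vertex k i)) in
      face_integral (facet k i) (fun x =>
        dot (vrestr u k x) (restr f k x *: n1 + restr f l x *: (- n1))
        * ((restr g k x + restr g l x) / 2)).

End form_b.

Section time.
Context {R : realType} (T : R).

Definition within_time (t : R) : set_system R := within `[0, T] t^'.

(* f has derivative l at t (one-sided at the end points). *)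
Definition tderiv (f : R -> R) (t l : R) : Prop :=
  (fun h => (f h - f t) / (h - t)) @ within_time t --> l.

Context {d : nat} (Omega : set 'rV[R]_d).

Definition L2s_tderiv (f : R -> sfield R d) (t : R) (f' : sfield R d) : Prop :=
  L2s Omega f' /\
  (fun h => let q := (h - t)^-1 *: (f h - f t) - f' in ips Omega q q)
    @ within_time t --> (0 : R).

Definition L2_tderiv (u : R -> vfield R d) (t : R) (u' : vfield R d) : Prop :=
  L2 Omega u' /\
  (fun h => let q := (h - t)^-1 *: (u h - u t) - u' in ip Omega q q)
    @ within_time t --> (0 : R).

End time.

Section lagrangians.
Context {R : realType} {d : nat} (Omega : set 'rV[R]_d) (M : mesh R d).
Variables r s : nat.

Definition state (u : vfield R d) (rho : sfield R d) (B : vfield R d) : Prop :=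
  [/\ Ugrad Omega M r u, Fdg Omega M s rho & Udiv Omega M r B].

Definition state_cont (G : vfield R d -> sfield R d -> vfield R d -> R) : Prop :=
  forall u rho B, state u rho B -> forall e, 0 < e ->
  exists2 eta, 0 < eta & forall u' rho' B', state u' rho' B' ->
    ip Omega (u' - u) (u' - u) + ips Omega (rho' - rho) (rho' - rho)
      + ip Omega (B' - B) (B' - B) < eta ->
    `|G u' rho' B' - G u rho B| < e.

(* l is continuously differentiable on the (finite-dimensional) space of
   states, and the L^2 fields lu, lrho, lB are its functional derivatives. *)
Definition lagrangian (l : vfield R d -> sfield R d -> vfield R d -> R)
    (lu : vfield R d -> sfield R d -> vfield R d -> vfield R d)
    (lrho : vfield R d -> sfield R d -> vfield R d -> sfield R d)
    (lB : vfield R d -> sfield R d -> vfield R d -> vfield R d) : Prop :=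
  [/\ forall u rho B, state u rho B ->
        [/\ L2 Omega (lu u rho B) /\ planar (lu u rho B),
            L2s Omega (lrho u rho B) &
            L2 Omega (lB u rho B) /\ planar (lB u rho B)],
      forall u rho B du, state u rho B -> Ugrad Omega M r du ->
        is_derive (0 : R) (1 : R) (fun e : R => l (u + e *: du) rho B)
          (ip Omega (lu u rho B) du),
      forall u rho B drho, state u rho B -> Fdg Omega M s drho ->
        is_derive (0 : R) (1 : R) (fun e : R => l u (rho + e *: drho) B)
          (ips Omega (lrho u rho B) drho),
      forall u rho B dB, state u rho B -> Udiv Omega M r dB ->
        is_derive (0 : R) (1 : R) (fun e : R => l u rho (B + e *: dB))
          (ip Omega (lB u rho B) dB) &
      [/\ forall du, Ugrad Omega M r du ->
            state_cont (fun u rho B => ip Omega (lu u rho B) du),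
          forall drho, Fdg Omega M s drho ->
            state_cont (fun u rho B => ips Omega (lrho u rho B) drho) &
          forall dB, Udiv Omega M r dB ->
            state_cont (fun u rho B => ip Omega (lB u rho B) dB)]].

End lagrangians.

(* Main.v *)
(* The curl of a field of U_h^curl is divergence free and, up to its planar part
   when d = 2, lies in U_h^div.  Hence the tested induction equation holds
   strongly: dB/dt = - curl E - nu curl j, and div B is conserved.  The mass is
   conserved because sigma = 1 is admissible and b_h(1, ., .) = 0.  In the energy
   balance take v = u and sigma = theta: the two b_h terms cancel, a(w, u, u) = 0,
   and <dl/dB, curl E> = - <J, E> = <U x H, J> = - <J x H, U> = <alpha, u> cancels the
   magnetic force, so that only the terms with mu, lambda and nu survive.  The
   helicity is unaffected by E because <A, curl E> = <B, E> = <H, E>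
   = - <U x H, H> = 0.
   The spaces being finite dimensional modulo null functions, the Lagrangian may
   be differentiated along the L^2-differentiable curves u, rho and B by the mean
   value theorem in each variable. *)
Require Import Defs.
From HB Require Import structures.
From mathcomp Require Import all_boot all_order all_algebra.
From mathcomp Require Import all_classical all_reals all_analysis.
From mathcomp Require Import measurable_realfun ring lra.

Set Implicit Arguments.
Unset Strict Implicit.
Unset Printing Implicit Defensive.

Import Order.TTheory GRing.Theory Num.Theory numFieldNormedType.Exports.

Local Open Scope classical_set_scope.
Local Open Scope ring_scope.

(** * Lebesgue measure on R^n *)

(** Fields are functions, not classes modulo null sets, so identities between them are read through
    products with square-integrable fields, and a time derivative, being only an L^2 limit, is
    exchanged for its projection onto the finite-dimensional space that contains the curve. The main
    obstacle is that the weak curl of a Nedelec field should be a Raviart-Thomas field. On a cell it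
    has to be identified with the classical curl of a polynomial, which takes the fundamental lemma,
    integration by parts against test fields and the negligibility of cell boundaries; the degrees
    come from the formula for the curl of x cross q. Membership in H_0(div) is inherited from the
    approximating test fields. For d = 2 the curl of the planar part points out of the plane. The
    field is therefore replaced by its orthogonal part [orth], whose curl has the same products with
    planar fields. The discrete curls in e_h are found among the fields of the scheme: they are j,
    -J and the orthogonal part of H. *)

Section boxes.
Context {R : realType} {n : nat}.
Implicit Types a b x : 'rV[R]_n.

Definition obox a b : set 'rV[R]_n := [set x | forall i, a 0 i < x 0 i < b 0 i].

Definition cbox a b : set 'rV[R]_n := [set x | forall i, a 0 i <= x 0 i <= b 0 i].

Lemma obox_cbox a b : obox a b `<=` cbox a b.
Proof. by move=> x abx i; have /andP[/ltW -> /ltW ->] := abx i. Qed.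

Lemma measurable_coordinates (B : 'I_n -> set R) : (forall i, measurable (B i)) ->
  measurable [set x : 'rV[R]_n | forall i, B i (x 0 i)].
Proof.
move=> mB; rewrite [X in measurable X](_ : _ = \bigcap_(i in setT)
    (@rV_coor R n i @^-1` B i)); last first.
  by apply/seteqP; split=> x h; [move=> i _; exact: h|move=> i; exact: h].
apply: fin_bigcap_measurable; first exact: finite_finset.
move=> i _; rewrite -[X in measurable X]setTI.
by apply: measurable_rV_coor => //; exact: mB.
Qed.

Lemma measurable_obox a b : measurable (obox a b).
Proof.
apply: (measurable_coordinates (B := fun i => `]a 0 i, b 0 i[%classic)) => i.
exact: measurable_itv.
Qed.

(** Rational corners keep the union countable. The closed box, not only the open one, is asked to
    lie in [O], so that the bump functions of the box have compact support in [O]. *)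
Lemma open_bigcup_obox (O : set 'rV[R]_n) : open O ->
  O = \bigcup_(p in [set p : 'rV[rat]_n * 'rV[rat]_n |
        cbox (map_mx ratr p.1) (map_mx ratr p.2) `<=` O])
      obox (map_mx ratr p.1) (map_mx ratr p.2).
Proof.
move=> oO; apply/seteqP; split=> [x Ox|x [p /= pO]]; last first.
  by move=> /obox_cbox; exact: pO.
move: (oO); rewrite openE => /(_ x Ox); rewrite /interior.
move=> /nbhs_ballP[e /= e0 xeO].
(* Balls of the matrix norm are cubes, so rational corners within [e] of [x], chosen coordinate by
   coordinate, give a box inside the ball. *)
have /choice[p xp] : forall i : 'I_n, exists q : rat, x 0 i - e < ratr q < x 0 i.
  move=> i; have [q] := @rat_in_itvoo R (x 0 i - e) (x 0 i) ltac:(lra).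
  by rewrite in_itv /=; exists q.
have /choice[q xq] : forall i : 'I_n, exists q : rat, x 0 i < ratr q < x 0 i + e.
  move=> i; have [q] := @rat_in_itvoo R (x 0 i) (x 0 i + e) ltac:(lra).
  by rewrite in_itv /=; exists q.
exists (\row_i p i, \row_i q i) => /= [y yb|i].
  apply: xeO; split=> // i j; rewrite (ord1 i) /ball /= ltr_norml.
  have := yb j; rewrite !mxE; have := xp j; have := xq j; lra.
by rewrite !mxE; have := xp i; have := xq i; lra.
Qed.

Lemma open_measurable_rV (O : set 'rV[R]_n) : open O -> measurable O.
Proof.
move=> /open_bigcup_obox ->; rewrite bigcup_mkcond.
apply: countable_bigcupT_measurable => [|p]; first exact: countableP.
by case: ifP => // _; exact: measurable_obox.
Qed.

Lemma closed_measurable_rV (F : set 'rV[R]_n) : closed F -> measurable F.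
Proof.
by move=> cF; rewrite -(setCK F); apply: measurableC; apply: open_measurable_rV;
  exact: closed_openC.
Qed.

Lemma continuous_measurable_rV (D : set 'rV[R]_n) (f : 'rV[R]_n -> R) :
  measurable D -> continuous f ->
  measurable_fun D (f : _ -> measurableTypeR R).
Proof.
move=> mD cf; apply: (measurable_funS (E := setT)) => //.
apply: (measurability _ (RGenOpens.measurableE R)).
move=> _ [_ [a [b ->] <-]]; rewrite setTI.
apply: open_measurable_rV; apply: open_comp; last exact: interval_open.
by move=> x _; exact: cf.
Qed.

Lemma compact_cbox a b : compact (cbox a b).
Proof.
apply: (@rV_compact R n (fun i => `[a 0 i, b 0 i]%classic)) => i.
exact: segment_compact.
Qed.

Lemma bounded_cbox (A : set 'rV[R]_n) : bounded_set A ->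
  exists2 K : R, 0 < K & A `<=` obox (const_mx (- K)) (const_mx K).
Proof.
move=> [K0 [_ K0A]]; pose K := `|K0| + 2; exists K; first by rewrite /K; have := normr_ge0 K0; lra.
move=> x Ax i; rewrite !mxE -ltr_norml.
have KK : K0 < `|K0| + 1 by have := ler_norm K0; lra.
have : mx_norm x <= `|K0| + 1 by exact: K0A KK x Ax.
rewrite mx_normrE => xK.
apply: (@le_lt_trans _ _ (`|K0| + 1)); last by rewrite /K; lra.
apply: le_trans xK.
exact: (le_bigmax_cond _ (fun p => `|x p.1 p.2|) (j := (0, i))).
Qed.

End boxes.

Section lebesgue.
Context {R : realType}.

Lemma leb_obox n (a b : 'rV[R]_n) : (forall i, a 0 i <= b 0 i) ->
  leb n (obox a b) = (\prod_i (b 0 i - a 0 i))%:E.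
Proof.
elim: n a b => [|n IH] a b ab.
  rewrite big_ord0 /= diracE mem_set//.
  by move=> -[].
have snocE : @rV_snoc R n @^-1` obox a b =
    obox (\row_j a 0 (lift ord_max j)) (\row_j b 0 (lift ord_max j)) `*`
    `]a 0 ord_max, b 0 ord_max[%classic.
  apply/seteqP; split=> [[x y] /= h|[x y] /= [h1 h2] i].
    split=> [j|]; rewrite ?in_itv /=.
      by have := h (lift ord_max j); rewrite !mxE liftK.
    by have := h ord_max; rewrite !mxE unlift_none.
  rewrite !mxE; case: unliftP => [j ->|->]; last by move: h2; rewrite in_itv.
  by have := h1 j; rewrite !mxE.
rewrite /= /pushforward snocE product_measure1E; last 2 first.
  exact: measurable_obox.
  exact: measurable_itv.
rewrite IH; last by move=> j; rewrite !mxE.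
rewrite [X in (_ * X)%E](lebesgue_measure_itv `]a 0 ord_max, b 0 ord_max[).
rewrite /= lte_fin big_ord_recr /= EFinM.
congr (_ * _)%E.
  congr EFin; apply: eq_bigr => j _; rewrite !mxE.
  have -> // : lift ord_max j = widen_ord (leqnSn n) j.
  by apply: val_inj; rewrite /= /bump leqNgt ltn_ord.
by case: ltP => // ba; rewrite (_ : _ - _ = 0) //; have := ab ord_max; lra.
Qed.

Lemma leb_obox_lt_pinfty n (a b : 'rV[R]_n) : (leb n (obox a b) < +oo)%E.
Proof.
pose a' := \row_i Num.min (a 0 i) (b 0 i); pose b' := \row_i Num.max (a 0 i) (b 0 i).
apply: (@le_lt_trans _ _ (leb n (obox a' b'))).
  apply: le_measure; rewrite ?inE; [exact: measurable_obox|exact: measurable_obox|].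
  move=> x abx i; have := abx i; rewrite !mxE lt_max gt_min.
  by move=> /andP[-> ->]; rewrite orbT.
rewrite leb_obox ?ltry// => i; rewrite !mxE.
by case: (leP (a 0 i) (b 0 i)) => [//|/ltW].
Qed.

Lemma sigma_finite_leb n : sigma_finite [set: 'rV[R]_n] (leb n).
Proof.
exists (fun N => obox (const_mx (- N%:R)) (const_mx N%:R)).
  apply/seteqP; split=> // x _.
  have [|K K0 xK] := @bounded_cbox R n [set x].
    by apply: compact_bounded; exact: compact_set1.
  exists (Num.truncn K).+1 => // i; have := xK x erefl i; rewrite !mxE.
  have := truncnS_gt K; lra.
by move=> N; split; [exact: measurable_obox|exact: leb_obox_lt_pinfty].
Qed.

(** A name for the bare set function of [leb n], to which the sigma-finite structure needed for
    Fubini's theorem can be attached. *)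
Definition lebf n : set 'rV[R]_n -> \bar R := leb n.
HB.instance Definition _ n := Measure.copy (@lebf n) (leb n).
HB.instance Definition _ n :=
  Measure_isSigmaFinite.Build _ _ _ (@lebf n) (sigma_finite_leb n).

End lebesgue.

Lemma cvg_sumr {R : realType} (T I : Type) (F : set_system T) {FF : Filter F}
    (s : seq I) (P : pred I) (f : I -> T -> R) (a : I -> R) :
  (forall i, P i -> f i x @[x --> F] --> a i) ->
  \sum_(i <- s | P i) f i x @[x --> F] --> \sum_(i <- s | P i) a i.
Proof.
move=> fa; elim: s => [|i s IH].
  by under eq_fun do rewrite big_nil; rewrite big_nil; exact: cvg_cst.
under eq_fun do rewrite big_cons; rewrite big_cons.
by case: ifP => // Pi; apply: cvgD => //; exact: fa.
Qed.

Lemma ae_countable d (T : measurableType d) (R : realType)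
    (mu : {measure set T -> \bar R}) (I : countType) (P : I -> T -> Prop) :
  (forall i, {ae mu, forall x, P i x}) -> {ae mu, forall x, forall i, P i x}.
Proof.
move=> Pae; pose Q n x := if unpickle n is Some i then P i x else True.
have : {ae mu, forall x, forall n, Q n x}.
  apply: ae_foralln => n; rewrite /Q; case: unpickle => [i|]; first exact: Pae.
  exact: aeW.
by apply: filterS => x Qx i; have := Qx (pickle i); rewrite /Q pickleK.
Qed.

(** * Null hyperplanes and nonempty open sets of positive measure *)

Section hyperplanes.
Context {R : realType}.

Lemma dot_snoc n (c : 'rV[R]_n.+1) (x : 'rV[R]_n) (y : R) :
  dot c (rV_snoc (x, y)) =
  dot (\row_j c 0 (lift ord_max j)) x + c 0 ord_max * y.
Proof.
rewrite /dot big_ord_recr /= !mxE unlift_none; congr (_ + _).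
apply: eq_bigr => j _; rewrite !mxE.
have -> : widen_ord (leqnSn n) j = lift ord_max j.
  by apply: val_inj; rewrite /= /bump leqNgt ltn_ord.
by rewrite liftK.
Qed.

Lemma continuous_dot n (c : 'rV[R]_n) : continuous (dot c).
Proof.
move=> x; rewrite /dot; apply: (@cvg_sumr R _ _ (nbhs x)) => i _.
by apply: cvgMl_tmp; exact: coord_continuous.
Qed.

Lemma continuous_affine n (c : 'rV[R]_n) (b : R) :
  continuous (fun x => dot c x - b).
Proof.
by move=> x; apply: (@cvgB _ _ _ (nbhs x)); [exact: continuous_dot|exact: cvg_cst].
Qed.

Lemma measurable_hyperplane n (c : 'rV[R]_n) (b : R) :
  measurable [set x | dot c x = b].
Proof.
apply: closed_measurable_rV.
rewrite (_ : [set _ | _] = dot c @^-1` [set b]) //.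
by apply: closed_comp => [x _|]; [exact: continuous_dot|exact: closed_eq].
Qed.

(** Induction on the dimension: if the last coefficient vanishes, the set is a cylinder over a
    hyperplane of one dimension less; otherwise its sections in the last coordinate are single
    points. *)
Lemma leb_hyperplane n (c : 'rV[R]_n) (b : R) : c != 0 ->
  leb n [set x | dot c x = b] = 0%E.
Proof.
elim: n c b => [|n IH] c b c0; first by case/eqP: c0; apply/rowP => -[].
rewrite /= /pushforward; pose c' : 'rV[R]_n := \row_j c 0 (lift ord_max j).
have -> : @rV_snoc R n @^-1` [set x | dot c x = b] =
    [set p | dot c' p.1 + c 0 ord_max * p.2 = b].
  by apply/seteqP; split=> -[x y] /=; rewrite dot_snoc.
have [cm0|cm0] := eqVneq (c 0 ord_max) 0.
  rewrite (_ : [set _ | _] = [set x | dot c' x = b] `*` setT); last first.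
    by apply/seteqP; split=> -[x y] /=; rewrite cm0 mul0r addr0//; case.
  rewrite product_measure1E//; last exact: measurable_hyperplane.
  rewrite IH ?mul0e//; apply: contra_neq c0 => c'0.
  apply/rowP => i; rewrite mxE; case: (unliftP ord_max i) => [j ->|->//].
  by have /rowP/(_ j) := c'0; rewrite !mxE.
apply: integral0_eq => x _ /=.
rewrite (_ : xsection _ _ = [set (b - dot c' x) / c 0 ord_max]).
  exact: lebesgue_measure_set1.
apply/seteqP; split=> y; rewrite /xsection /= inE /=.
  by move=> <-; field.
by move=> ->; field.
Qed.

Lemma leb_open_gt0 n (O : set 'rV[R]_n) : open O -> O !=set0 -> (0 < leb n O)%E.
Proof.
move=> oO [x Ox]; move: (oO); rewrite openE => /(_ x Ox); rewrite /interior.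
move=> /nbhs_ballP[e /= e0 xeO].
apply: (@lt_le_trans _ _ (leb n (obox (\row_i (x 0 i - e)) (\row_i (x 0 i + e))))).
  rewrite leb_obox => [|i]; last by rewrite !mxE; lra.
  by rewrite lte_fin; apply: prodr_gt0 => i _; rewrite !mxE; lra.
apply: le_measure; rewrite ?inE; [exact: measurable_obox|exact: open_measurable_rV|].
move=> y xy; apply: xeO; split=> // i j; rewrite (ord1 i) /ball /= ltr_norml.
by have := xy j; rewrite !mxE; lra.
Qed.

End hyperplanes.

(** * Simplices and their negligible boundaries *)

Section cells.
Context {R : realType} {d : nat} (M : mesh R d) (k : 'I_(ncell M)).
Hypothesis ndk : Defs.nondegenerate k.

Let V : 'M[R]_d := \matrix_(j < d) (vertex k (lift ord0 j) - vertex k ord0).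

(** The barycentric coordinates with respect to all vertices but [vertex k ord0]; the missing one is
    1 minus their sum. *)
Let bary (x : 'rV[R]_d) : 'rV[R]_d := (x - vertex k ord0) *m invmx V.

Let baryE x j : bary x 0 j =
  dot (\row_i invmx V i j) x - dot (\row_i invmx V i j) (vertex k ord0).
Proof.
rewrite /bary mxE /dot -sumrB; apply: eq_bigr => i _.
by rewrite !mxE; ring.
Qed.

Let bary_sumE x : \sum_j bary x 0 j =
  dot (\row_i \sum_j invmx V i j) x
  - dot (\row_i \sum_j invmx V i j) (vertex k ord0).
Proof.
under eq_bigr do rewrite baryE; rewrite sumrB /dot.
congr (_ - _); rewrite exchange_big; apply: eq_bigr => i _;
by under eq_bigr do rewrite mxE; rewrite mxE mulr_suml.
Qed.

Lemma cellE : cell k =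
  [set x | (forall j, 0 <= bary x 0 j) /\ \sum_j bary x 0 j <= 1].
Proof.
have combE (c : 'I_d.+1 -> R) : \sum_i c i = 1 ->
    \sum_i c i *: vertex k i = vertex k ord0 + (\row_j c (lift ord0 j)) *m V.
  move=> c1; rewrite mulmx_sum_row big_ord_recl.
  under [X in _ = _ + X]eq_bigr do rewrite rowK mxE scalerBr.
  rewrite sumrB -scaler_suml.
  have -> : \sum_(i < d) c (lift ord0 i) = 1 - c ord0.
    by rewrite -c1 big_ord_recl addrC addKr.
  by rewrite scalerBl scale1r opprB [RHS]addrC -!addrA addNr addr0 addrC.
apply/seteqP; split=> [x /= [c [c0 c1 ->]]|x /= [y0 y1]].
  have yE : bary (\sum_i c i *: vertex k i) = \row_j c (lift ord0 j).
    by rewrite /bary combE// addrC addKr mulmxK.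
  rewrite yE; split=> [j|]; first by rewrite mxE.
  under eq_bigr do rewrite mxE.
  by move: c1; rewrite big_ord_recl; have := c0 ord0; lra.
move: y1; set S := \sum_j _ => y1.
exists (fun i => if unlift ord0 i is Some j then bary x 0 j else 1 - S).
have s1 : \sum_i (if unlift ord0 i is Some j then bary x 0 j else 1 - S) = 1.
  rewrite big_ord_recl unlift_none.
  by under eq_bigr do rewrite liftK; rewrite subrK.
split=> //; first by move=> i; case: unliftP => [j _|_]; [exact: y0|lra].
rewrite combE//.
have -> : (\row_j (if unlift ord0 (lift ord0 j) is Some j0 then bary x 0 j0
     else 1 - S)) = bary x.
  by apply/rowP => j; rewrite mxE liftK.
by rewrite /bary mulmxKV// addrC subrK.
Qed.

Let ocell := [set x | (forall j, 0 < bary x 0 j) /\ \sum_j bary x 0 j < 1].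

Let ocell_interior : ocell `<=` interior (cell k).
Proof.
have cb j : continuous (fun x => bary x 0 j).
  under [X in continuous X]eq_fun do rewrite baryE.
  exact: continuous_affine.
have cs : continuous (fun x => \sum_j bary x 0 j).
  under [X in continuous X]eq_fun do rewrite bary_sumE.
  exact: continuous_affine.
move=> x [y0 y1]; rewrite /interior cellE.
near=> z; split=> [j|].
  apply: ltW; move: j; near: z; apply: filter_forall => j.
  exact: (cvgr_gt _ (cb j x)).
apply: ltW; near: z; exact: (cvgr_lt _ (cs x)).
Unshelve. all: by end_near. Qed.

Lemma cell_interior_neq0 : interior (cell k) !=set0.
Proof.
(* The barycentre, all of whose [d.+1] barycentric coordinates are equal. *)
exists (vertex k ord0 + (const_mx d.+1%:R^-1) *m V); apply: ocell_interior.
have yE : bary (vertex k ord0 + const_mx d.+1%:R^-1 *m V) = const_mx d.+1%:R^-1.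
  by rewrite /bary [vertex k ord0 + _]addrC addrK mulmxK.
rewrite /ocell /= yE; split=> [j|]; first by rewrite mxE invr_gt0.
under eq_bigr do rewrite mxE.
rewrite sumr_const card_ord -[X in X < _]mulr_natl ltr_pdivrMr ?mul1r ?ltr0n//.
by rewrite ltr_nat.
Qed.

(** The boundary of a simplex lies in the hyperplanes where a barycentric coordinate vanishes. This
    carries identities proved with test fields in the interior over to the closed cell. *)
Lemma ae_cell_interior :
  {ae leb d, forall x, cell k x -> interior (cell k) x}.
Proof.
have aeP (c : 'rV[R]_d) (b : R) : c != 0 -> {ae leb d, forall x, dot c x <> b}.
  move=> c0; exists [set x | dot c x = b]; split.
  - exact: measurable_hyperplane.
  - exact: leb_hyperplane.
  - by move=> x /= /contrapT.
have VV : V *m invmx V = 1%:M by rewrite mulmxV.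
have ae1 : {ae leb d, forall x, forall j : 'I_d, bary x 0 j <> 0}.
  apply: ae_countable => j.
  have cj : \row_i invmx V i j != 0.
    apply/eqP => /rowP Vj0; move: VV => /matrixP/(_ j j); rewrite !mxE eqxx.
    rewrite big1 => [/eqP|i _]; first by rewrite eq_sym oner_eq0.
    by have := Vj0 i; rewrite !mxE => ->; rewrite mulr0.
  have := aeP _ (dot (\row_i invmx V i j) (vertex k ord0)) cj.
  by apply: filterS => x nx; rewrite baryE => /eqP; rewrite subr_eq0 => /eqP.
have ae2 : {ae leb d, forall x, (0 < d)%N -> \sum_j bary x 0 j <> 1}.
  have [d0|d0] := ltnP 0 d; last by apply: aeW.
  (* The row sums of [invmx V] form the vector that [V] maps to the constant 1, so for positive [d]
     they are not all zero. *)
  have cj : \row_i \sum_j invmx V i j != 0.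
    apply/eqP => /rowP Vj0; pose i0 : 'I_d := Ordinal d0.
    have V1 : V *m (invmx V *m const_mx 1) = const_mx 1 :> 'cV_d.
      by rewrite mulKVmx.
    have VC0 : invmx V *m const_mx 1 = 0 :> 'cV_d.
      apply/matrixP => i j; rewrite [LHS]mxE [RHS]mxE.
      transitivity (\sum_l invmx V i l); last by have := Vj0 i; rewrite !mxE.
      by apply: eq_bigr => l _; rewrite mxE mulr1.
    move: V1; rewrite VC0 mulmx0 => /matrixP/(_ i0 0); rewrite !mxE => /eqP.
    by rewrite eq_sym oner_eq0.
  have := aeP _ (1 + dot (\row_i \sum_j invmx V i j) (vertex k ord0)) cj.
  by apply: filterS => x nx _; rewrite bary_sumE => h; apply: nx; rewrite -h subrK.
apply: filterS2 ae1 ae2 => x y0 y1 xk; apply: ocell_interior.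
move: xk; rewrite cellE => -[z0 z1]; split=> [j|].
  by rewrite lt_neqAle z0 andbT eq_sym; apply/eqP.
rewrite lt_neqAle z1 andbT; apply/eqP => y1'.
have [d0|d0] := ltnP 0 d; first by have := y1 d0.
move: y1'; rewrite big1 => [/eqP|j _]; first by rewrite eq_sym oner_eq0.
by have := leq_trans (ltn_ord j) d0.
Qed.

End cells.

(** * Semi-inner products *)

Section L2_scalar.
Context {R : realType} {d : nat} (Omega : set 'rV[R]_d).
Hypothesis mO : measurable Omega.
Implicit Types f g h : sfield R d.

Lemma L2s_0 : L2s Omega (0 : sfield R d).
Proof.
split; first exact: measurable_cst.
apply: (eq_integrable mO (cst 0%E)); last exact: integrable0.
by move=> x _; rewrite /= expr0n.
Qed.

Lemma L2s_mul f g : L2s Omega f -> L2s Omega g ->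
  (leb d).-integrable Omega (EFin \o (fun x => f x * g x)).
Proof.
move=> [mf f2] [mg g2].
apply: (le_integrable mO (g := fun x => ((f x ^+ 2)%:E + (g x ^+ 2)%:E)%E)).
- by apply/measurable_EFinP; exact: measurable_funM.
- move=> x _ /=; rewrite lee_fin ler_norml !ger0_norm; last first.
    by apply: addr_ge0; exact: sqr_ge0.
  by apply/andP; split; nra.
- exact: integrableD.
Qed.

Lemma L2sZ (a : R) f : L2s Omega f -> L2s Omega (a *: f).
Proof.
move=> [mf f2]; split; first exact: measurable_funM.
apply: (eq_integrable mO (fun x => ((a ^+ 2)%:E * (f x ^+ 2)%:E)%E)).
  by move=> x _; rewrite -EFinM -exprMn.
exact: integrableZl.
Qed.

Lemma L2sD f g : L2s Omega f -> L2s Omega g -> L2s Omega (f + g).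
Proof.
move=> Lf Lg; have [mf f2] := Lf; have [mg g2] := Lg.
split; first exact: measurable_funD.
apply: (eq_integrable mO (fun x => ((f x ^+ 2)%:E + (2%:E * (f x * g x)%:E) + (g x ^+ 2)%:E)%E)).
  move=> x _; rewrite -EFinM -!EFinD; congr EFin.
  by rewrite [(f + g) x]/(f x + g x) sqrrD mulr_natl.
apply: integrableD => //; apply: integrableD => //; apply: integrableZl => //.
exact: L2s_mul.
Qed.

Lemma ipsC f g : ips Omega f g = ips Omega g f.
Proof. by rewrite /ips /integrate; under eq_Rintegral do rewrite mulrC. Qed.

Lemma ipsDl f g h : L2s Omega f -> L2s Omega g -> L2s Omega h ->
  ips Omega (f + g) h = ips Omega f h + ips Omega g h.
Proof.
move=> Lf Lg Lh; rewrite /ips /integrate -RintegralD//; [|exact: L2s_mul..].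
by apply: eq_Rintegral => x _; rewrite -mulrDl.
Qed.

Lemma ipsZl (a : R) f h : L2s Omega f -> L2s Omega h ->
  ips Omega (a *: f) h = a * ips Omega f h.
Proof.
move=> Lf Lh; rewrite /ips /integrate -RintegralZl//; last exact: L2s_mul.
by apply: eq_Rintegral => x _; rewrite mulrA.
Qed.

Lemma ips_ge0 f : 0 <= ips Omega f f.
Proof. by apply: Rintegral_ge0 => x _; rewrite -expr2 sqr_ge0. Qed.

Lemma ips_ae f g h : L2s Omega f -> L2s Omega g -> L2s Omega h ->
  {ae leb d, forall x, Omega x -> f x = g x} -> ips Omega f h = ips Omega g h.
Proof.
move=> Lf Lg Lh fg; rewrite /ips /integrate /Rintegral; congr fine.
apply: ae_eq_integral => //.
- exact: measurable_int (L2s_mul Lf Lh).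
- exact: measurable_int (L2s_mul Lg Lh).
- by apply: filterS fg => x fgx Ox; rewrite fgx.
Qed.

Lemma L2s_cst (c : R) : (leb d Omega < +oo)%E -> L2s Omega (fun=> c).
Proof.
move=> O_fin; split; first exact: measurable_cst.
apply/integrableP; split; first exact: measurable_cst.
by rewrite /= integral_cst// lte_mul_pinfty.
Qed.

Lemma L2s_bounded f (K : R) : (leb d Omega < +oo)%E ->
  measurable_fun Omega (f : _ -> measurableTypeR R) ->
  (forall x, Omega x -> `|f x| <= K) -> L2s Omega f.
Proof.
move=> O_fin mf fK; split=> //.
apply: (le_integrable mO (g := cst (K ^+ 2)%:E)).
- by apply/measurable_EFinP; exact: measurable_funX.
- move=> x Ox /=; rewrite lee_fin normrX [leRHS]ger0_norm ?sqr_ge0//.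
  by apply: lerXn2r; rewrite ?nnegrE ?fK//; exact: le_trans (fK x Ox).
- by have [] := L2s_cst K O_fin.
Qed.

End L2_scalar.

(** Bilinearity is limited to [D], the square-integrable fields, since integrals are additive only
    for integrable functions. There is no definiteness, because fields that agree almost everywhere
    are not identified. *)
Record semi_inner (R : realType) (V : lmodType R) (D : V -> Prop)
    (ip : V -> V -> R) : Prop := SemiInner {
  semi_inner0 : D 0;
  semi_innerD : forall u v, D u -> D v -> D (u + v);
  semi_innerZ : forall a u, D u -> D (a *: u);
  semi_innerC : forall u v, ip u v = ip v u;
  semi_innerDl : forall u v w, D u -> D v -> D w -> ip (u + v) w = ip u w + ip v w;
  semi_innerZl : forall a u w, D u -> D w -> ip (a *: u) w = a * ip u w;
  semi_inner_ge0 : forall u, 0 <= ip u u }.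

Section semi_inner_theory.
Context {R : realType} {V : lmodType R} {D : V -> Prop} {ip : V -> V -> R}.
Hypothesis H : semi_inner D ip.
Implicit Types u v w : V.

Let D0 := semi_inner0 H.
Let DD := semi_innerD H.
Let DZ := semi_innerZ H.
Let C := semi_innerC H.
Let Dl := semi_innerDl H.
Let Zl := semi_innerZl H.
Let ge0 := semi_inner_ge0 H.

Lemma semi_innerN u : D u -> D (- u).
Proof. by rewrite -scaleN1r; exact: DZ. Qed.

Lemma semi_innerB u v : D u -> D v -> D (u - v).
Proof. by move=> Du Dv; apply: DD => //; exact: semi_innerN. Qed.

Lemma semi_innerDr u v w : D u -> D v -> D w -> ip w (u + v) = ip w u + ip w v.
Proof. by move=> *; rewrite C Dl// C [ip v _]C. Qed.

Lemma semi_innerZr a u w : D u -> D w -> ip w (a *: u) = a * ip w u.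
Proof. by move=> *; rewrite C Zl// C. Qed.

Lemma semi_innerNl u w : D u -> D w -> ip (- u) w = - ip u w.
Proof. by move=> *; rewrite -scaleN1r Zl// mulN1r. Qed.

Lemma semi_innerBl u v w : D u -> D v -> D w -> ip (u - v) w = ip u w - ip v w.
Proof. by move=> *; rewrite Dl ?semi_innerNl//; exact: semi_innerN. Qed.

Lemma semi_innerBr u v w : D u -> D v -> D w -> ip w (u - v) = ip w u - ip w v.
Proof. by move=> *; rewrite C semi_innerBl// C [ip v _]C. Qed.

Lemma semi_inner0l w : D w -> ip 0 w = 0.
Proof. by move=> Dw; rewrite -(scale0r (0 : V)) Zl// mul0r. Qed.

Lemma semi_inner0r w : D w -> ip w 0 = 0.
Proof. by move=> Dw; rewrite C semi_inner0l. Qed.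

Lemma semi_inner_sum (I : Type) (s : seq I) (c : I -> R) (v : I -> V) :
  (forall i, D (v i)) -> D (\sum_(i <- s) c i *: v i).
Proof. by move=> Dv; elim/big_ind: _ => // i _; exact: DZ. Qed.

Lemma semi_inner_suml (I : Type) (s : seq I) (c : I -> R) (v : I -> V) w :
  (forall i, D (v i)) -> D w ->
  ip (\sum_(i <- s) c i *: v i) w = \sum_(i <- s) c i * ip (v i) w.
Proof.
move=> Dv Dw; elim: s => [|i s IH]; first by rewrite !big_nil semi_inner0l.
by rewrite !big_cons Dl ?IH ?Zl//; [exact: DZ|exact: semi_inner_sum].
Qed.

Lemma Cauchy_Schwarz u v : D u -> D v -> ip u v ^+ 2 <= ip u u * ip v v.
Proof.
move=> Du Dv.
have q a b : 0 <= a ^+ 2 * ip u u - 2 * (a * b) * ip u v + b ^+ 2 * ip v v.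
  have := ge0 (a *: u - b *: v); have [Da Db] := (DZ a Du, DZ b Dv).
  rewrite semi_innerBl ?semi_innerBr ?Zl ?semi_innerZr//; last exact: semi_innerB.
  by rewrite [ip v u]C => h; apply: le_trans h _; rewrite le_eqVlt; apply/orP; left; apply/eqP; ring.
have [v0|v0] := eqVneq (ip v v) 0.
  have [uv0|uv0] := eqVneq (ip u v) 0; first by rewrite uv0 v0 mulr0 expr0n.
  (* A null [v] makes the quadratic form affine in [b]; this [b] gives it the value -1. *)
  exfalso; have := q 1 ((ip u u + 1) / (2 * ip u v)).
  rewrite v0 mulr0 addr0 expr1n !mul1r.
  have -> : 2 * ((ip u u + 1) / (2 * ip u v)) * ip u v = ip u u + 1 by field.
  lra.
have v1 : 0 < ip v v by rewrite lt_neqAle eq_sym v0 ge0.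
(* The minimising ratio of coefficients, cleared of the division by [ip v v]. *)
have := q (ip v v) (ip u v).
have -> : ip v v ^+ 2 * ip u u - 2 * (ip v v * ip u v) * ip u v
  + ip u v ^+ 2 * ip v v = ip v v * (ip u u * ip v v - ip u v ^+ 2) by ring.
by rewrite pmulr_rge0// subr_ge0.
Qed.

Lemma semi_inner_null u v : D u -> D v -> ip u u = 0 -> ip u v = 0.
Proof.
move=> Du Dv u0; have := Cauchy_Schwarz Du Dv; rewrite u0 mul0r => h.
by apply/eqP; rewrite -sqrf_eq0 eq_le h sqr_ge0.
Qed.

Lemma semi_inner_eqv u v w : D u -> D v -> D w ->
  ip (u - v) (u - v) = 0 -> ip u w = ip v w.
Proof.
move=> Du Dv Dw uv; apply/eqP; rewrite -subr_eq0 -semi_innerBl//.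
by apply/eqP/semi_inner_null => //; exact: semi_innerB.
Qed.

(** The parallelogram law with the square of [u - v] dropped; it serves as a triangle inequality for
    squared norms. *)
Lemma semi_inner_triangle u v : D u -> D v -> ip (u + v) (u + v) <= 2 * ip u u + 2 * ip v v.
Proof.
move=> Du Dv; have := ge0 (u - v).
have Duv := DD Du Dv; have Buv := semi_innerB Du Dv.
rewrite semi_innerBl// semi_innerBr// semi_innerBr// Dl// !semi_innerDr//.
by rewrite [ip v u]C; lra.
Qed.

Section convergence.
Context {T : Type} {F : set_system T} {FF : Filter F}.

Definition ip_cvg (x : T -> V) (a : V) : Prop :=
  ip (x h - a) (x h - a) @[h --> F] --> (0 : R).

Lemma ip_cvgl (x : T -> V) a w : D a -> D w -> (\forall h \near F, D (x h)) ->
  ip_cvg x a -> ip (x h) w @[h --> F] --> ip a w.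
Proof.
move=> Da Dw Dx xa; apply/cvgrPdistC_lt => e e0.
have w1 : 0 < ip w w + 1 by have := ge0 w; lra.
have d0 : 0 < e ^+ 2 / (ip w w + 1) by rewrite divr_gt0// exprn_gt0.
near=> h; have Dh : D (x h) by near: h.
rewrite -semi_innerBl//; have Bh := semi_innerB Dh Da.
rewrite -(@ltr_pXn2r _ 2)// ?nnegrE ?(ltW e0)// real_normK ?num_real//.
apply: le_lt_trans (Cauchy_Schwarz Bh Dw) _.
have : ip (x h - a) (x h - a) < e ^+ 2 / (ip w w + 1).
  by near: h; apply: (cvgr_lt (0:R) xa).
rewrite ltr_pdivlMr//; apply: le_lt_trans; apply: ler_wpM2l; first exact: ge0.
lra.
Unshelve. all: by end_near. Qed.

Lemma ip_cvg2 (x y : T -> V) a b : D a -> D b ->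
  (\forall h \near F, D (x h)) -> (\forall h \near F, D (y h)) ->
  ip_cvg x a -> ip_cvg y b -> ip (x h) (y h) @[h --> F] --> ip a b.
Proof.
move=> Da Db Dx Dy xa yb.
(* One term is small in both factors; each of the others has a fixed factor. *)
suff : ip (x h - a) (y h - b) + (ip (x h) b - ip a b) + ip (y h) a @[h --> F]
    --> 0 + (ip a b - ip a b) + ip b a.
  rewrite add0r subrr add0r [ip b a]C; apply: cvg_trans; apply: near_eq_cvg.
  near=> h; have Dh : D (x h) by near: h.
  have Dyh : D (y h) by near: h.
  have Bx := semi_innerB Dh Da; have By := semi_innerB Dyh Db.
  rewrite semi_innerBl// !semi_innerBr// [ip (y h) a]C; ring.
apply: cvgD; last exact: ip_cvgl.
apply: cvgD; last by apply: cvgB; [exact: ip_cvgl|exact: cvg_cst].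
apply/cvgr0Pnorm_lt => e e0; near=> h; have Dh : D (x h) by near: h.
have Dyh : D (y h) by near: h.
have Bx := semi_innerB Dh Da; have By := semi_innerB Dyh Db.
rewrite -(@ltr_pXn2r _ 2)// ?nnegrE ?(ltW e0)// real_normK ?num_real//.
apply: le_lt_trans (Cauchy_Schwarz Bx By) _.
rewrite expr2; apply: ltr_pM => //; near: h.
  exact: (cvgr_lt (0 : R) xa).
exact: (cvgr_lt (0 : R) yb).
Unshelve. all: by end_near. Qed.

End convergence.

End semi_inner_theory.

(** * Finite-dimensional subspaces, orthonormal bases and projections *)

Section finite_dimension.
Context {R : realType} {V : lmodType R} {D : V -> Prop} {ip : V -> V -> R}.
Hypothesis H : semi_inner D ip.
Variable S : V -> Prop.

Record subspace : Prop := Subspace {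
  subspace_sub : forall u, S u -> D u;
  subspace0 : S 0;
  subspaceD : forall u v, S u -> S v -> S (u + v);
  subspaceZ : forall a u, S u -> S (a *: u) }.

(* The fields are not quotiented by null functions, hence dependence up to a
   vector of norm zero. *)
Definition dim_le (N : nat) : Prop := forall v : 'I_N.+1 -> V,
  (forall i, S (v i)) -> exists c : 'I_N.+1 -> R,
    (exists i, c i != 0) /\
    let w := \sum_i c i *: v i in ip w w = 0.

Definition orthonormal m (e : 'I_m -> V) : Prop :=
  (forall i, S (e i)) /\ forall i j, ip (e i) (e j) = (i == j)%:R.

Definition proj m (e : 'I_m -> V) (v : V) : V := \sum_i ip v (e i) *: e i.

Hypothesis sS : subspace.

Lemma subspaceN u : S u -> S (- u).
Proof. by rewrite -scaleN1r; exact: subspaceZ. Qed.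

Lemma subspaceB u v : S u -> S v -> S (u - v).
Proof. by move=> Su Sv; apply: subspaceD => //; exact: subspaceN. Qed.

Lemma subspace_sum (I : Type) (s : seq I) (c : I -> R) (v : I -> V) :
  (forall i, S (v i)) -> S (\sum_(i <- s) c i *: v i).
Proof.
move=> Sv; elim/big_ind: _ => //; [exact: subspace0|exact: subspaceD|].
by move=> i _; exact: subspaceZ.
Qed.

Section projection.
Variables (m : nat) (e : 'I_m -> V).
Hypothesis oe : orthonormal e.

Let De i : D (e i). Proof. by apply: subspace_sub => //; exact: oe.1. Qed.

Lemma proj_sub v : S (proj e v).
Proof. by apply: subspace_sum; exact: oe.1. Qed.

Lemma proj_in v : D (proj e v).
Proof. by apply: subspace_sub => //; exact: proj_sub. Qed.

Lemma proj_coord v i : ip (proj e v) (e i) = ip v (e i).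
Proof.
rewrite (semi_inner_suml H)// (bigD1 i)//= oe.2 eqxx mulr1 big1 ?addr0//.
by move=> j ji; rewrite oe.2 (negbTE ji) mulr0.
Qed.

Lemma proj_ip v w : D w -> ip (proj e v) w = \sum_i ip v (e i) * ip w (e i).
Proof.
move=> Dw; rewrite (semi_inner_suml H)//; apply: eq_bigr => i _.
by rewrite (semi_innerC H w).
Qed.

End projection.

Definition orthobasis m (e : 'I_m -> V) : Prop :=
  orthonormal e /\ forall v, S v -> ip (v - proj e v) (v - proj e v) = 0.

Lemma orthonormal_dim_le N m (e : 'I_m -> V) : dim_le N -> orthonormal e ->
  (m <= N)%N.
Proof.
move=> dN [Se oe]; rewrite leqNgt; apply/negP => Nm.
have [c [[i ci] /= c0]] := dN (fun i => e (widen_ord Nm i)) (fun i => Se _).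
have De j : D (e j) by exact: subspace_sub.
have Dw : D (\sum_i c i *: e (widen_ord Nm i)).
  by apply: (semi_inner_sum H).
have := semi_inner_null H Dw (De (widen_ord Nm i)) c0.
rewrite (semi_inner_suml H)// (bigD1 i)//= oe eqxx mulr1 big1 ?addr0.
  by move/eqP; rewrite (negbTE ci).
move=> j ji; rewrite oe (inj_eq (f := widen_ord Nm)) ?(negbTE ji) ?mulr0//.
by move=> a b /(congr1 val) /= ab; exact: val_inj.
Qed.

(** Gram-Schmidt by maximality: orthonormal families have at most [N] members, and a longest one
    spans, because a residual of positive norm could be normalised and adjoined. *)
Lemma orthobasis_exists N : dim_le N ->
  exists m (e : 'I_m -> V), orthobasis e.
Proof.
move=> dN; pose P m := `[< exists e : 'I_m -> V, orthonormal e >].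
have exP : exists m, P m.
  by exists 0%N; apply/asboolP; exists (fun=> 0); split=> -[].
have bP m : P m -> (m <= N)%N.
  by move/asboolP => [e]; exact: orthonormal_dim_le.
case: (ex_maxnP exP bP) => m /asboolP[e oe] maxm.
exists m, e; split=> // v Sv; apply: contrapT => /eqP v0.
set w := v - proj e v in v0.
have Sw : S w by apply: subspaceB => //; exact: proj_sub.
have Dw : D w by exact: subspace_sub.
have De i : D (e i) by apply: subspace_sub => //; exact: oe.1.
have we i : ip w (e i) = 0.
  rewrite (semi_innerBl H)//; [|exact: subspace_sub|exact: proj_in].
  by rewrite proj_coord// subrr.
have w0 : 0 < ip w w by rewrite lt_neqAle eq_sym v0 (semi_inner_ge0 H).
pose f := (Num.sqrt (ip w w))^-1 *: w.
have Df : D f by exact: (semi_innerZ H).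
have ff : ip f f = 1.
  rewrite (semi_innerZl H)// (semi_innerZr H)// mulrA -expr2 exprVn sqr_sqrtr ?ltW//.
  by rewrite mulVf.
have fe i : ip f (e i) = 0 by rewrite (semi_innerZl H)// we mulr0.
suff : P m.+1 by move/maxm; rewrite ltnn.
apply/asboolP; exists (fun i => if unlift ord_max i is Some j then e j else f).
split=> [i|i j].
  by case: unliftP => [j _|_]; [exact: oe.1|exact: subspaceZ].
case: (unliftP ord_max i) => [i' ->|->]; case: (unliftP ord_max j) => [j' ->|->].
- by rewrite oe.2 (inj_eq lift_inj).
- by rewrite (semi_innerC H) fe eq_sym (negbTE (neq_lift _ _)).
- by rewrite fe (negbTE (neq_lift _ _)).
- by rewrite ff eqxx.
Qed.

Section orthobasis.
Variables (m : nat) (e : 'I_m -> V).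
Hypothesis be : orthobasis e.

Let De i : D (e i). Proof. by apply: subspace_sub => //; exact: be.1.1. Qed.

Lemma proj_id u w : S u -> D w -> ip (proj e u) w = ip u w.
Proof.
move=> Su Dw; have Du : D u by exact: subspace_sub.
apply/esym/(semi_inner_eqv H) => //; first exact: proj_in be.1 _.
exact: be.2.
Qed.

Lemma proj_orthogonal v s : D v -> S s -> ip (proj e v) s = ip v s.
Proof.
move=> Dv Ss; have Ds : D s by exact: subspace_sub.
rewrite (proj_ip be.1)// (semi_innerC H v) -(proj_id Ss Dv) (proj_ip be.1)//.
by apply: eq_bigr => i _; rewrite mulrC.
Qed.

Let Pythagoras a b : D a -> D b -> ip b a = 0 ->
  ip (a - b) (a - b) = ip a a + ip b b.
Proof.
move=> Da Db ba; have Dab := semi_innerB H Da Db.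
by rewrite (semi_innerBl H)// !(semi_innerBr H)// ba (semi_innerC H a) ba; ring.
Qed.

(** Finite-dimensional subspaces are closed: by Pythagoras no element of [S] is nearer to [v] than
    the projection, so arbitrarily good approximations force that distance to be 0. *)
Lemma proj_closed v : D v ->
  (forall eps, 0 < eps -> exists2 s, S s & ip (s - v) (s - v) < eps) ->
  ip (v - proj e v) (v - proj e v) = 0.
Proof.
move=> Dv cl; have ge0 := semi_inner_ge0 H.
have Sp := proj_sub be.1 v; have Dp := proj_in be.1 v.
have D1 : D (v - proj e v) by exact: semi_innerB H _ _ Dv Dp.
apply/eqP; rewrite eq_le ge0 andbT leNgt; apply/negP => /cl[s Ss].
have Sq : S (s - proj e v) by exact: subspaceB.
have Dq : D (s - proj e v) by exact: subspace_sub.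
have o : ip (v - proj e v) (s - proj e v) = 0.
  by rewrite (semi_innerBl H)// proj_orthogonal// subrr.
have -> : s - v = (s - proj e v) - (v - proj e v) by rewrite opprB addrA subrK.
rewrite (Pythagoras Dq D1 o).
by have := ge0 (s - proj e v); lra.
Qed.

End orthobasis.

End finite_dimension.
Arguments subspace {R V} D S.
Arguments dim_le {R V} ip S N.
Arguments proj {R V} ip {m} e v.
Arguments orthonormal {R V} ip S {m} e.
Arguments orthobasis {R V} ip S {m} e.

(** * Derivatives in time *)

Lemma is_derive_cvg {R : realType} {V : normedModType R} (f : V -> R) (a v : V)
    (l : R) :
  is_derive a v f l <->
  h^-1 * (f (h *: v + a) - f a) @[h --> (0 : R)^'] --> l.
Proof.
split=> [[df <-]|fl]; first exact: df.
by apply: DeriveDef; [exact: cvgP fl|exact: cvg_lim fl].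
Qed.

Lemma is_derive_line {R : realType} {V : normedModType R} (f : V -> R)
    (a v : V) (s l : R) :
  is_derive (s *: v + a) v f l <-> is_derive s 1 (fun t : R => f (t *: v + a)) l.
Proof.
rewrite !is_derive_cvg; split; apply: cvg_trans; apply: near_eq_cvg;
  by near=> h; rewrite /= [h *: 1]mulr1 scalerDl addrA.
Unshelve. all: by end_near. Qed.

Lemma is_derive_shift0 {R : realType} (f : R -> R) (s l : R) :
  is_derive (0 : R) 1 (fun t => f (s + t)) l -> is_derive s 1 f l.
Proof.
rewrite !is_derive_cvg; apply: cvg_trans; apply: near_eq_cvg.
by near=> h; rewrite /= !addr0 [s + _]addrC.
Unshelve. all: by end_near. Qed.

Section time.
Context {R : realType} (T : R).
Hypothesis T0 : 0 < T.
Implicit Types (t l : R) (f g : R -> R).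

#[global] Instance within_time_filter t : Filter (within_time T t).
Proof. exact: within_filter. Qed.

Lemma near_within_time t :
  \forall h \near within_time T t, 0 <= h <= T /\ h - t != 0.
Proof.
rewrite /within_time near_withinE; near=> h; rewrite /= in_itv /= => hT.
by split=> //; rewrite subr_eq0; near: h; exact: nbhs_dnbhs_neq.
Unshelve. all: by end_near. Qed.

Lemma within_timeP t (P : R -> Prop) :
  (\forall h \near within_time T t, P h) <->
  exists2 e : R, 0 < e & forall h : R, 0 <= h <= T -> h != t -> `|h - t| < e -> P h.
Proof.
rewrite /within_time near_withinE; split.
  move=> /nbhs_ballP[e /= e0 eP]; exists e => // h hT ht he.
  by apply: eP => //; rewrite /ball /= distrC.
move=> [e e0 eP]; apply/nbhs_ballP; exists e => //= h he ht hT.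
by apply: eP => //; rewrite distrC.
Qed.

(** Since [0 < T], punctured neighbourhoods of [t] within [[0, T]] are not empty, even at the end
    points, so a limit in time carries information. *)
Lemma within_time_ex t (P : R -> Prop) : 0 <= t <= T ->
  (\forall h \near within_time T t, P h) -> exists2 h, 0 <= h <= T & P h.
Proof.
move=> /andP[t0 tT] /within_timeP[e e0 eP].
(* A step of at most [T / 2] stays in [[0, T]] when taken to the right from the left half and to the
   left from the right half. *)
pose m := Num.min (e / 2) (T / 2).
have [m0 me mT] : [/\ 0 < m, m < e & m <= T / 2].
  by have := T0; rewrite /m; case: (leP (e / 2) (T / 2)) => ?; split; lra.
have [tlt|tge] := ltP t (T / 2).
  exists (t + m); first lra.
  by apply: eP; [lra|rewrite gt_eqF//; lra|rewrite [t + m]addrC addrK gtr0_norm].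
exists (t - m); first lra.
apply: eP; [lra|rewrite lt_eqF//; lra|].
by rewrite [t - m]addrC addrK normrN gtr0_norm.
Qed.

Lemma tderivP f t l : tderiv T f t l <-> forall e : R, 0 < e ->
  exists2 delta : R, 0 < delta & forall h : R, 0 <= h <= T -> h != t -> `|h - t| < delta ->
    `|(f h - f t) / (h - t) - l| < e.
Proof.
split=> [/cvgrPdistC_lt fl e e0|fl]; first exact/within_timeP/fl.
by apply/cvgrPdistC_lt => e e0; apply/within_timeP/fl.
Qed.

(** The mean value theorem on [[0, t]]: inside this interval the derivative within [[0, T]] is an
    ordinary one. *)
Lemma tderiv0_cst f : (forall t, 0 <= t <= T -> tderiv T f t 0) ->
  forall t, 0 <= t <= T -> f t = f 0.
Proof.
move=> f0 t /andP[]; rewrite le_eqVlt => /predU1P[<-//|t0] tT.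
have fd x : x \in `]0, t[ -> is_derive x 1 f ((fun=> 0) x).
  rewrite in_itv /= => /andP[x0 xt]; apply/is_derive_cvg/cvgrPdistC_lt => e e0.
  have /tderivP/(_ e e0)[del del0 fdel] : tderiv T f x 0 by apply: f0; lra.
  near=> h; rewrite [h *: 1]mulr1.
  have h0 : h != 0 by near: h; exact: nbhs_dnbhs_neq.
  have hs : `|h| < Num.min del (Num.min x (t - x)).
    near: h; apply: dnbhs0_lt; rewrite !lt_min del0 x0; lra.
  move: hs; rewrite !lt_min => /and3P[hdel]; rewrite !ltr_norml => h1 h2.
  have := fdel (h + x); rewrite addrK [_ / h]mulrC -ltr_norml.
  apply=> //; first by move: h1 h2; lra.
  by rewrite -subr_eq0 addrK.
have fc : {within `[0, t], continuous f}.
  apply/subspace_continuousP => x; rewrite /= in_itv /= => /andP[x0 xt].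
  (* With derivative 0 and tolerance 1, increments of [f] are smaller than those of its argument,
     which gives continuity, also at the end points. *)
  have /tderivP/(_ 1 ltr01)[del del0 fdel] : tderiv T f x 0 by apply: f0; lra.
  apply/cvgrPdistC_lt => e e0; rewrite near_withinE; near=> h.
  rewrite /= in_itv /= => hT.
  have [->|hx] := eqVneq h x; first by rewrite subrr normr0.
  have hs : `|x - h| < Num.min del e by near: h; apply: cvgr_dist_lt; [exact: cvg_id|rewrite lt_min del0].
  move: hs; rewrite lt_min distrC => /andP[hd he].
  have := fdel h ltac:(lra) hx hd; rewrite subr0 normrM normfV.
  have hx0 : 0 < `|h - x| by rewrite normr_gt0 subr_eq0.
  by rewrite ltr_pdivrMr// mul1r => /lt_trans; apply.
have [c _] := MVT t0 fd fc.
by rewrite mul0r => /eqP; rewrite subr_eq0 => /eqP.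
Unshelve. all: by end_near. Qed.

Section inner.
Context {V : lmodType R} {D : V -> Prop} {ip : V -> V -> R}.
Hypothesis H : semi_inner D ip.
Implicit Types (x y : R -> V) (a b : V).

(** [L2_tderiv] and [L2s_tderiv] are its two instances, up to conversion. *)
Definition ip_tderiv x t a : Prop :=
  D a /\ ip_cvg (ip := ip) (F := within_time T t)
    (fun h => (h - t)^-1 *: (x h - x t)) a.

Section near.
Variables (x : R -> V) (t : R).
Hypotheses (tT : 0 <= t <= T) (Dx : forall h, 0 <= h <= T -> D (x h)).

Lemma near_path : \forall h \near within_time T t, D (x h).
Proof.
near=> h; have [hT _] : 0 <= h <= T /\ h - t != 0 by near: h; exact: near_within_time.
exact: Dx.
Unshelve. all: by end_near. Qed.

Lemma near_quotient : \forall h \near within_time T t,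
  D ((h - t)^-1 *: (x h - x t)).
Proof.
near=> h; have [hT _] : 0 <= h <= T /\ h - t != 0 by near: h; exact: near_within_time.
by apply: (semi_innerZ H); apply: (semi_innerB H); exact: Dx.
Unshelve. all: by end_near. Qed.

Lemma within_time_sqr : (h - t) ^+ 2 @[h --> within_time T t] --> (0 : R).
Proof.
apply/cvgrPdistC_lt => e e0; apply/within_timeP.
exists (Num.min 1 e) => [|h _ _]; first by rewrite lt_min ltr01.
rewrite lt_min subr0 normrX => /andP[h1 he].
by apply: le_lt_trans he; rewrite expr2 ler_piMl// ltW.
Qed.

(** The increment is [h - t] times the difference quotient, whose norm stays bounded near [t]. *)
Lemma ip_tderiv_cvg a : ip_tderiv x t a ->
  ip_cvg (ip := ip) (F := within_time T t) x (x t).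
Proof.
move=> [Da xa]; rewrite /ip_cvg.
pose q h := (h - t)^-1 *: (x h - x t).
apply: (@squeeze_cvgr _ _ _ _ (fun=> 0)
  (fun h => (h - t) ^+ 2 * (2 * ip (q h - a) (q h - a) + 2 * ip a a))).
- near=> h; rewrite (semi_inner_ge0 H)/=.
  have [hT ht] : 0 <= h <= T /\ h - t != 0 by near: h; exact: near_within_time.
  have Dq : D (q h) by near: h; exact: near_quotient.
  have -> : x h - x t = (h - t) *: ((q h - a) + a).
    by rewrite subrK scalerA divff// scale1r.
  have Dqa := semi_innerB H Dq Da; have Ds := semi_innerD H Dqa Da.
  rewrite (semi_innerZl H)//; last exact: semi_innerZ H _ _ Ds.
  rewrite (semi_innerZr H)// mulrA -expr2 ler_wpM2l ?sqr_ge0//.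
  exact: (semi_inner_triangle H).
- exact: cvg_cst.
- rewrite -(mul0r (2 * 0 + 2 * ip a a)).
  apply: cvgM; first exact: within_time_sqr.
  by apply: cvgD; [apply: cvgM; [exact: cvg_cst|exact: xa]|exact: cvg_cst].
Unshelve. all: by end_near. Qed.

End near.

Lemma tderiv_ip x y t a b : 0 <= t <= T ->
  (forall h, 0 <= h <= T -> D (x h)) -> (forall h, 0 <= h <= T -> D (y h)) ->
  ip_tderiv x t a -> ip_tderiv y t b ->
  tderiv T (fun h => ip (x h) (y h)) t (ip a (y t) + ip (x t) b).
Proof.
move=> tT Dx Dy xa yb; have [Da xa'] := xa; have [Db yb'] := yb.
have yc := ip_tderiv_cvg tT Dy yb.
rewrite /tderiv; suff : ip ((h - t)^-1 *: (x h - x t)) (y h)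
    + ip (x t) ((h - t)^-1 *: (y h - y t)) @[h --> within_time T t]
    --> ip a (y t) + ip (x t) b.
  apply: cvg_trans; apply: near_eq_cvg; near=> h.
  have [hT ht] : 0 <= h <= T /\ h - t != 0 by near: h; exact: near_within_time.
  have [Dxh Dxt Dyh Dyt] := And4 (Dx _ hT) (Dx _ tT) (Dy _ hT) (Dy _ tT).
  have [Bx By] := (semi_innerB H Dxh Dxt, semi_innerB H Dyh Dyt).
  rewrite (semi_innerZl H)// (semi_innerZr H)// (semi_innerBl H)// (semi_innerBr H)//.
  by field.
apply: cvgD.
  by apply: (ip_cvg2 H) => //; [exact: Dy|exact: near_quotient|exact: near_path].
rewrite (semi_innerC H _ b); under eq_fun do rewrite (semi_innerC H (x t)).
by apply: (ip_cvgl H) => //; [exact: Dx|exact: near_quotient].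
Unshelve. all: by end_near. Qed.

Lemma tderiv_ip_cst x t a w : 0 <= t <= T ->
  (forall h, 0 <= h <= T -> D (x h)) -> D w -> ip_tderiv x t a ->
  tderiv T (fun h => ip (x h) w) t (ip a w).
Proof.
move=> tT Dx Dw xa; rewrite -[ip a w]addr0 -(semi_inner0r H (Dx _ tT)).
apply: (@tderiv_ip x (fun=> w)) => //; split; first exact: semi_inner0 H.
rewrite /ip_cvg; under eq_fun do rewrite !subrr scaler0 subr0.
rewrite (semi_inner0r H); last exact: semi_inner0 H.
exact: cvg_cst.
Qed.

End inner.
Arguments ip_tderiv {V} D ip x t a.

End time.
Arguments ip_tderiv {R} T {V} D ip x t a.

(** * Chain rule along a curve in a finite-dimensional space *)

Section chain_rule.
Context {R : realType} {V : lmodType R} {D : V -> Prop} {ip : V -> V -> R}.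
Hypothesis H : semi_inner D ip.
Context {S : V -> Prop} (sS : subspace D S) {m : nat} {e : 'I_m -> V}.
Hypothesis be : orthobasis ip S e.
Variables (T t : R) (x : R -> V) (a : V).
Hypotheses (T0 : 0 < T) (tT : 0 <= t <= T).
Hypothesis Sx : forall h : R, 0 <= h <= T -> S (x h).
Hypothesis xa : ip_tderiv T D ip x t a.

Let De i : D (e i). Proof. by apply: (subspace_sub sS); exact: be.1.1. Qed.

Let Sq (h : R) : 0 <= h <= T -> S ((h - t)^-1 *: (x h - x t)).
Proof. by move=> hT; apply: (subspaceZ sS); apply: (subspaceB sS); exact: Sx. Qed.

(** The difference quotients lie in [S], which is closed, so their limit differs from its projection
    by a null vector only. *)
Lemma derivative_in_closure : ip (a - proj ip e a) (a - proj ip e a) = 0.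
Proof.
have [Da qa] := xa; apply: (proj_closed H sS be Da) => eps eps0.
have [h hT qh] : exists2 h, 0 <= h <= T &
    ip ((h - t)^-1 *: (x h - x t) - a) ((h - t)^-1 *: (x h - x t) - a) < eps.
  by apply: (within_time_ex T0 tT); apply: cvgr_lt qa _ _.
by exists ((h - t)^-1 *: (x h - x t)) => //; exact: Sq.
Qed.

Lemma derivative_ip w : D w -> ip (proj ip e a) w = ip a w.
Proof.
move=> Dw; have [Da _] := xa; apply/esym/(semi_inner_eqv H) => //.
  exact: (proj_in sS be.1).
exact: derivative_in_closure.
Qed.

Variables (L : R -> V -> R) (g : R -> V -> V) (g0 : V).
Hypothesis Dg : forall (h : R) (v : V), 0 <= h <= T -> S v -> D (g h v).
Hypothesis Dg0 : D g0.
Hypothesis dL : forall (h : R) (v dv : V), 0 <= h <= T -> S v -> S dv ->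
  is_derive (0 : R) (1 : R) (fun s : R => L h (v + s *: dv)) (ip (g h v) dv).
Hypothesis cg : forall (xi : R -> R) (dv : V), (forall h : R, 0 <= xi h <= 1) -> S dv ->
  ip (g h (x t + xi h *: (x h - x t))) dv @[h --> within_time T t] --> ip g0 dv.

Let mean_value (h : R) : 0 <= h <= T -> exists xi : R, 0 <= xi <= 1 /\
  L h (x h) - L h (x t) = ip (g h (x t + xi *: (x h - x t))) (x h - x t).
Proof.
move=> hT; have Sd : S (x h - x t) by apply: (subspaceB sS); exact: Sx.
pose f (s : R) := L h (x t + s *: (x h - x t)).
have df (s : R) : is_derive s (1 : R) f (ip (g h (x t + s *: (x h - x t))) (x h - x t)).
  apply: is_derive_shift0; rewrite /f.
  under eq_fun do rewrite scalerDl addrA.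
  apply: dL => //; apply: (subspaceD sS); [exact: Sx|exact: (subspaceZ sS)].
have cf : {within `[0, 1], continuous f}.
  by apply: derivable_within_continuous => s _; have [] := df s.
have [c] := MVT ltr01 (fun s _ => df s) cf.
rewrite in_itv /= => /andP[c0 c1] fE; exists c; split; first by rewrite !ltW.
by move: fE; rewrite /f scale1r scale0r addr0 subr0 mulr1 [x t + (x h - _)]addrC subrK.
Qed.

(** [L] keeps [h] as a parameter because, while one argument of the Lagrangian moves, others are
    frozen at time [h]. The gradients at the intermediate points converge only when tested against
    fixed vectors of [S]; expanding their product with the difference quotient in the orthonormal
    basis leaves a finite sum of products of scalar limits. *)
Lemma chain_rule_increment :
  (L h (x h) - L h (x t)) / (h - t) @[h --> within_time T t] --> ip g0 a.
Proof.
have [Da qa] := xa.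
(* Outside [[0, T]] the intermediate parameter is set to 0, so that [xi] is a total function with
   values in [[0, 1]], as [cg] asks. *)
have /choice[xi xiP] : forall h : R, exists xi : R, 0 <= xi <= 1 /\ (0 <= h <= T ->
    L h (x h) - L h (x t) = ip (g h (x t + xi *: (x h - x t))) (x h - x t)).
  move=> h; have [/mean_value[xi [xi1 xiE]]|hT] := pselect (0 <= h <= T).
    by exists xi.
  by exists 0; rewrite lexx ler01.
have xi1 h : 0 <= xi h <= 1 by case: (xiP h).
rewrite (semi_innerC H g0) -(derivative_ip Dg0) (proj_ip H sS be.1)//.
suff : \sum_i ip ((h - t)^-1 *: (x h - x t)) (e i)
      * ip (g h (x t + xi h *: (x h - x t))) (e i) @[h --> within_time T t]
    --> \sum_i ip a (e i) * ip g0 (e i).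
  apply: cvg_trans; apply: near_eq_cvg; near=> h.
  have [hT ht] : 0 <= h <= T /\ h - t != 0 by near: h; exact: near_within_time.
  have Sd : S (x h - x t) by apply: (subspaceB sS); exact: Sx.
  have Dd : D (x h - x t) by exact: (subspace_sub sS).
  have Sv : S (x t + xi h *: (x h - x t)).
    by apply: (subspaceD sS); [exact: Sx|exact: (subspaceZ sS)].
  rewrite (xiP h).2//.
  have Dgv := Dg hT Sv.
  rewrite -(proj_ip H sS be.1 _ Dgv) (proj_id H sS be (Sq hT) Dgv).
  by rewrite (semi_innerZl H)// (semi_innerC H (x h - x t)) mulrC.
apply: cvg_sumr => i _; apply: cvgM.
  apply: (ip_cvgl H) => //.
  near=> h; have [hT _] : 0 <= h <= T /\ h - t != 0 by near: h; exact: near_within_time.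
  by apply: (subspace_sub sS); exact: Sq.
by apply: cg => //; exact: be.1.1.
Unshelve. all: by end_near. Qed.

End chain_rule.

(** * Smooth functions and test functions *)

Lemma is_derive_affine {R : realType} (a b t : R) :
  is_derive t (1 : R) (fun h => a * h + b) a.
Proof.
have -> : (fun h => a * h + b) = horner (a%:P * 'X + b%:P).
  by apply/funext => h; rewrite !hornerE.
apply: is_derive_eq.
by rewrite derivD derivM !derivC derivX mul0r add0r mulr1 addr0 hornerC.
Qed.

Section partial_derivatives.
Context {R : realType} {d : nat}.
Implicit Types (f g : sfield R d) (i j : 'I_3).

Definition diff_everywhere f : Prop := forall x, differentiable f x.

Lemma is_derive_partial f x i : differentiable f x ->
  is_derive x (dir i) f (partial i f x).
Proof. by move=> df; apply: DeriveDef => //; exact: diff_derivable. Qed.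

Lemma partialD f g i : diff_everywhere f -> diff_everywhere g ->
  partial i (f + g) = partial i f + partial i g.
Proof.
by move=> df dg; apply/funext => x; rewrite /partial deriveD//; exact: diff_derivable.
Qed.

Lemma partialZ (a : R) f i : diff_everywhere f ->
  partial i (a *: f) = a *: partial i f.
Proof.
by move=> df; apply/funext => x; rewrite /partial deriveZ//; exact: diff_derivable.
Qed.

Lemma partialN f i : diff_everywhere f -> partial i (- f) = - partial i f.
Proof.
by move=> df; apply/funext => x; rewrite /partial deriveN//; exact: diff_derivable.
Qed.

Lemma partialM f g i : diff_everywhere f -> diff_everywhere g ->
  partial i (f * g) = f * partial i g + g * partial i f.
Proof.
by move=> df dg; apply/funext => x; rewrite /partial deriveM//; exact: diff_derivable.
Qed.

Lemma partial_cst (c : R) i : partial i (fun _ : 'rV[R]_d => c) = 0.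
Proof. by apply/funext => x; rewrite /partial derive_cst. Qed.

Lemma diff_continuous f : diff_everywhere f -> continuous f.
Proof. by move=> df x; exact: differentiable_continuous. Qed.

(** Smoothness by invariance: a class of differentiable functions that is stable under partial
    derivatives contains all iterated derivatives of its members. *)
Lemma smooth_closed (P : sfield R d -> Prop) :
  (forall f, P f -> diff_everywhere f) ->
  (forall f i, P f -> P (partial i f)) -> forall f, P f -> smooth f.
Proof.
move=> Pd Pp f Pf l; suff : P (foldr partial f l) by move/Pd.
by elim: l => //= i l; exact: Pp.
Qed.

Lemma smooth_diff f : smooth f -> diff_everywhere f.
Proof. by move=> sf x; exact: (sf [::]). Qed.

Lemma smooth_partial f i : smooth f -> smooth (partial i f).
Proof. by move=> sf l; have := sf (rcons l i); rewrite foldr_rcons. Qed.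

Lemma smooth_cst (c : R) : smooth (fun _ : 'rV[R]_d => c).
Proof.
apply: (@smooth_closed (fun f => exists c, f = fun=> c)); last by exists c.
  by move=> _ [c' ->] x; exact: differentiable_cst.
by move=> _ i [c' ->]; exists 0; exact: partial_cst.
Qed.

(* The algebra generated by the smooth functions is closed under partial
   derivatives by Leibniz' rule, so it consists of smooth functions. *)
Inductive smooth_algebra : sfield R d -> Prop :=
| smooth_base f : smooth f -> smooth_algebra f
| smooth_add f g : smooth_algebra f -> smooth_algebra g -> smooth_algebra (f + g)
| smooth_mul f g : smooth_algebra f -> smooth_algebra g -> smooth_algebra (f * g).

Lemma smooth_algebra_diff f : smooth_algebra f -> diff_everywhere f.
Proof.
elim=> [{}f /smooth_diff//|{}f g _ df _ dg x|{}f g _ df _ dg x].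
  exact: differentiableD.
exact: differentiableM.
Qed.

Lemma smooth_algebra_partial f i : smooth_algebra f -> smooth_algebra (partial i f).
Proof.
elim=> [{}f /smooth_partial sf|{}f g sf pf sg pg|{}f g sf pf sg pg].
- exact: smooth_base.
- by rewrite partialD; [exact: smooth_add|exact: smooth_algebra_diff..].
- rewrite partialM; [|exact: smooth_algebra_diff..].
  by apply: smooth_add; exact: smooth_mul.
Qed.

Lemma smooth_algebra_smooth f : smooth_algebra f -> smooth f.
Proof.
exact: smooth_closed smooth_algebra_diff smooth_algebra_partial _.
Qed.

Lemma smoothD f g : smooth f -> smooth g -> smooth (f + g).
Proof.
by move=> sf sg; apply: smooth_algebra_smooth; apply: smooth_add; exact: smooth_base.
Qed.

Lemma smoothM f g : smooth f -> smooth g -> smooth (f * g).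
Proof.
by move=> sf sg; apply: smooth_algebra_smooth; apply: smooth_mul; exact: smooth_base.
Qed.

Lemma smoothN f : smooth f -> smooth (- f).
Proof.
move=> sf; rewrite (_ : - f = (fun=> - 1) * f).
  by apply: smoothM => //; exact: smooth_cst.
by apply/funext => x; exact: esym (mulN1r (f x)).
Qed.

Lemma smooth_prod (I : Type) (s : seq I) (F : I -> sfield R d) :
  (forall k, smooth (F k)) -> smooth (fun x => \prod_(k <- s) F k x).
Proof.
move=> sF; elim: s => [|k s IH].
  by under eq_fun do rewrite big_nil; exact: smooth_cst.
by under eq_fun do rewrite big_cons; apply: (@smoothM (F k)).
Qed.

(** Here [D] stands for a class of one-variable functions stable under derivation: the functions
    [bump P] in one use, the polynomials in the other. *)
Lemma smooth_coord_comp (D : (R -> R) -> Prop) (D' : forall g : R -> R, D g ->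
    exists g' : R -> R, D g' /\ forall t : R, is_derive t 1 g (g' t)) (g : R -> R)
    (j : 'I_d) (a b : R) : D g -> smooth (fun x : 'rV[R]_d => g (a * x 0 j + b)).
Proof.
move=> Dg.
(* The factor [c] absorbs the constant, [a] or 0, that each partial derivative brings out. *)
pose P (f : sfield R d) := exists (c : R) (g : R -> R), D g /\
  f = fun x : 'rV[R]_d => c * g (a * x 0 j + b).
have affd (x : 'rV[R]_d) : differentiable (fun y : 'rV[R]_d => a * y 0 j + b) x.
  apply: (@differentiableD _ _ _ (fun y : 'rV[R]_d => a * y 0 j) (fun=> b)) => //.
  apply: (@differentiableZ _ _ _ (fun y : 'rV[R]_d => y 0 j)).
  exact: differentiable_coord.
have dP (c : R) (g1 : R -> R) : D g1 ->
    diff_everywhere (fun x : 'rV[R]_d => c * g1 (a * x 0 j + b)).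
  move=> /D'[g' [_ dg]] x.
  apply: (@differentiableZ _ _ _ (fun y : 'rV[R]_d => g1 (a * y 0 j + b))).
  apply: (@differentiable_comp _ _ _ _ (fun y : 'rV[R]_d => a * y 0 j + b) g1) => //.
  by apply/derivable1_diffP; have [] := dg (a * x 0 j + b).
suff : smooth (fun x : 'rV[R]_d => 1 * g (a * x 0 j + b)).
  by under eq_fun do rewrite mul1r.
apply: (@smooth_closed P); last by exists 1, g.
  by move=> _ [c [g1 [Dg1 ->]]]; exact: dP.
move=> _ i [c [g1 [Dg1 ->]]]; have [g' [Dg' dg]] := D' _ Dg1.
exists (c * (a * (j == i :> nat)%:R)), g'; split=> //; apply/funext => x.
rewrite /partial; apply: derive_val.
have := @is_derive_line R _ (fun x : 'rV[R]_d => c * g1 (a * x 0 j + b)) x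
  (dir i) 0 (c * (a * (j == i :> nat)%:R) * g' (a * x 0 j + b)).
rewrite scale0r add0r => -[_]; apply.
rewrite (_ : (fun _ => _) = c \*: (g1 \o (fun h : R =>
    (a * (j == i :> nat)%:R) * h + (a * x 0 j + b)))); last first.
  apply/funext => h /=; rewrite !mxE /=.
  by congr (c * g1 _); ring.
rewrite -mulrA; apply: is_deriveZ; rewrite [X in is_derive _ _ _ X]mulrC.
apply: is_derive1_comp; last exact: is_derive_affine.
by rewrite mulr0 add0r.
Qed.

End partial_derivatives.

(** * Bump functions *)

Section bump.
Context {R : realType}.
Implicit Types (P : {poly R}) (t : R).

(* The family [P(1/t) exp(-1/t)], extended by 0, is closed under derivation. *)
Definition bump P t : R := if 0 < t then P.[t^-1] * expR (- t^-1) else 0.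

Lemma poly_expN_bound P : exists C : R, forall y : R, 0 < y ->
  `|P.[y] * expR (- y)| <= C / y.
Proof.
(* Since exp(y) dominates y^(i+1)/(i+1)!, the monomial y^i times exp(-y) is at most (i+1)!/y. *)
exists (\sum_(i < size P) `|P`_i| * (i.+1)`!%:R) => y y0.
rewrite horner_coef mulr_suml mulr_suml; apply: le_trans (ler_norm_sum _ _ _) _.
apply: ler_sum => i _; rewrite !normrM -!mulrA ler_wpM2l//.
rewrite normrX !gtr0_norm ?expR_gt0// expRN ler_pdivrMr ?expR_gt0//.
rewrite mulrAC ler_pdivlMr// -exprSr.
have := expR_ge1Dxn i (ltW y0); rewrite -ler_pdivrMl ?ltr0n ?fact_gt0//.
by apply: le_trans; rewrite mulrC lerDr.
Qed.

Lemma bump_bound P : exists C : R, forall t, `|bump P t| <= C * `|t|.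
Proof.
have [C CP] := poly_expN_bound P; exists C => t; rewrite /bump.
case: ifPn => [t0|_].
  have := CP t^-1; rewrite invr_gt0 invrK => /(_ t0) /le_trans; apply.
  by rewrite gtr0_norm.
rewrite normr0; have := CP 1 ltr01; rewrite divr1 => C0.
by apply: mulr_ge0 => //; exact: le_trans C0.
Qed.

(** For positive [t] this is the chain rule through 1/t. At 0 the difference quotient of [bump P] is
    the bump function of [P] multiplied by ['X], and [bump_bound] makes it tend to 0. *)
Lemma is_derive_bump P t : is_derive t 1 (bump P) (bump ('X^2 * (P - P^`())) t).
Proof.
have [t0|t0|->] := ltgtP t 0.
- rewrite [bump _ t]/bump ltNge (ltW t0) /=.
  apply: (@near_eq_is_derive _ _ _ (cst 0)) => //; near=> s.
  rewrite /bump ltNge /= (_ : s <= 0)//.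
  by apply: ltW; near: s; exact: lt_nbhsl.
- rewrite [bump _ t]/bump t0; pose f s : R := P.[s^-1] * expR (- s^-1).
  apply: (@near_eq_is_derive _ _ _ f) => //.
    near=> s; rewrite /bump (_ : 0 < s)//.
    by near: s; exact: lt_nbhsr.
  have dV : is_derive t 1 (fun s : R => s^-1) (- t ^- 2).
    have t1 : (id t : R) != 0 by rewrite gt_eqF.
    have did : derivable (id : R -> R) t 1 by exact: derivable_id.
    apply: DeriveDef; first exact: (@derivableV R R id t 1 t1 did).
    by rewrite (@deriveV R R id t 1 t1 did) derive_id [_ *: _]mulr1.
  have dP := is_derive1_comp (is_derive_poly P t^-1) dV.
  have dE := @is_derive1_comp _ expR (fun s => - s^-1) t _ _ (is_derive_expR _) (is_deriveN dV).
  apply: (is_derive_eq (is_deriveM dP dE)) => /=.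
  rewrite /GRing.scale /= hornerM hornerXn hornerD hornerN -exprVn; ring.
- rewrite {2}/bump ltxx; apply/is_derive_cvg.
  rewrite {2}/bump ltxx.
  have [C CP] := bump_bound ('X * P); apply/cvgr0Pnorm_lt => eps eps0.
  have C1 : 0 < `|C| + 1 by have := normr_ge0 C; lra.
  near=> h; rewrite subr0 addr0 [h *: 1]mulr1.
  have -> : h^-1 * bump P h = bump ('X * P) h.
    by rewrite /bump; case: ifP => _; rewrite ?mulr0// hornerM hornerX mulrA.
  apply: le_lt_trans (CP h) _.
  apply: (@le_lt_trans _ _ ((`|C| + 1) * `|h|)).
    by rewrite ler_wpM2r//; have := ler_norm C; lra.
  rewrite mulrC -ltr_pdivlMr//; near: h.
  by apply: dnbhs0_lt; rewrite divr_gt0.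
Unshelve. all: by end_near. Qed.

End bump.

Lemma cvg_prodr {R : realType} (T I : Type) (F : set_system T) {FF : Filter F}
    (s : seq I) (f : I -> T -> R) (a : I -> R) :
  (forall i, f i x @[x --> F] --> a i) ->
  \prod_(i <- s) f i x @[x --> F] --> \prod_(i <- s) a i.
Proof.
move=> fa; elim: s => [|i s IH].
  by under eq_fun do rewrite big_nil; rewrite big_nil; exact: cvg_cst.
by under eq_fun do rewrite big_cons; rewrite big_cons; exact: cvgM.
Qed.

Section box_bump.
Context {R : realType} {d : nat}.
Implicit Types a b x : 'rV[R]_d.

Lemma bump1E (t : R) : bump 1 t = if 0 < t then expR (- t^-1) else 0.
Proof. by rewrite /bump hornerC mul1r. Qed.

Lemma bump1_itv (t : R) : 0 <= bump 1 t <= 1.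
Proof.
rewrite bump1E; case: ifP => [t0|_]; last by rewrite lexx ler01.
by rewrite expR_ge0 -(@expR0 R) ler_expR oppr_le0 invr_ge0 ltW.
Qed.

Lemma bump1_le0 (t : R) : t <= 0 -> bump 1 t = 0.
Proof. by move=> t0; rewrite bump1E ltNge t0. Qed.

(** As [N] grows, the arguments of the bumps tend to infinity inside the box. Smooth functions with
    values in [0, 1] and support in the closed box thus approach the indicator of the open one. *)
Definition boxbump (N : nat) a b x : R :=
  \prod_(j < d) (bump 1 (N%:R * x 0 j + - (N%:R * a 0 j)) *
                 bump 1 (- N%:R * x 0 j + N%:R * b 0 j)).

Lemma smooth_boxbump N a b : smooth (boxbump N a b).
Proof.
pose D (g : R -> R) := exists P, g = bump P.
have D' (g : R -> R) : D g -> exists g' : R -> R,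
    D g' /\ forall t : R, is_derive t 1 g (g' t).
  move=> [P ->]; exists (bump ('X^2 * (P - P^`()))); split; first by eexists.
  by move=> t; exact: is_derive_bump.
by apply: smooth_prod => j; apply: smoothM; apply: (smooth_coord_comp D'); exists 1.
Qed.

Lemma boxbump_itv N a b x : 0 <= boxbump N a b x <= 1.
Proof.
apply/andP; split.
  apply: prodr_ge0 => j _; apply: mulr_ge0; first by have /andP[] := bump1_itv (N%:R * x 0 j + - (N%:R * a 0 j)).
  by have /andP[] := bump1_itv (- N%:R * x 0 j + N%:R * b 0 j).
apply: prodr_ile1 => j _.
have /andP[? ?] := bump1_itv (N%:R * x 0 j + - (N%:R * a 0 j)).
have /andP[? ?] := bump1_itv (- N%:R * x 0 j + N%:R * b 0 j).
by rewrite mulr_ge0//= mulr_ile1.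
Qed.

Lemma boxbump_out N a b x : ~ obox a b x -> boxbump N a b x = 0.
Proof.
move=> /existsNP[j /negP]; rewrite negb_and -!leNgt => jab.
rewrite /boxbump (bigD1 j)//=.
have [xa|xa] := leP (x 0 j) (a 0 j).
  by rewrite bump1_le0 ?mul0r// -mulrBr mulr_ge0_le0// subr_le0.
rewrite [X in _ * X * _]bump1_le0 ?mulr0 ?mul0r//.
rewrite mulNr addrC -mulrBr mulr_ge0_le0// subr_le0.
by move: jab; rewrite leNgt xa.
Qed.

Lemma boxbump_cvg a b x :
  boxbump N a b x @[N --> \oo] --> (\1_(obox a b) x : R).
Proof.
have bumpcvg (c : R) : 0 < c -> bump 1 (N%:R * c) @[N --> \oo] --> (1 : R).
  move=> c0; suff : bump 1 (N%:R * c) @[N --> \oo] --> expR (0 : R) by rewrite expR0.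
  have : expR (- (N%:R * c)^-1) @[N --> \oo] --> expR (- 0 : R).
    apply: continuous_cvg; first exact: continuous_expR.
    apply: cvgN; under eq_fun do rewrite invfM.
    rewrite -(mul0r c^-1); apply: cvgM; last exact: cvg_cst.
    apply/gtr0_cvgV0; first by near=> N; rewrite ltr0n; near: N; exact: nbhs_infty_gt.
    exact: cvgr_idn.
  rewrite oppr0; apply: cvg_trans; apply: near_eq_cvg; near=> N.
  have N0 : (0 < N)%N by near: N; exact: nbhs_infty_gt.
  by rewrite bump1E (_ : 0 < N%:R * c)// mulr_gt0// ltr0n.
rewrite indicE; case: (boolP (x \in obox a b)); rewrite ?(inE, notin_setE) => xab.
  rewrite /boxbump (_ : true%:R = \prod_(j < d) (1 * 1 : R)); last first.
    by rewrite big1// => j _; rewrite mulr1.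
  apply: cvg_prodr => j; have := xab j => /andP[ax xb].
  apply: cvgM.
    under eq_fun do rewrite -mulrBr.
    by apply: bumpcvg; rewrite subr_gt0.
  under eq_fun do rewrite mulNr addrC -mulrBr.
  by apply: bumpcvg; rewrite subr_gt0.
by under eq_fun do rewrite boxbump_out//; exact: cvg_cst.
Unshelve. all: by end_near. Qed.

Lemma test_boxbump N a b (O : set 'rV[R]_d) : cbox a b `<=` O ->
  test O (boxbump N a b).
Proof.
move=> abO; split; first exact: smooth_boxbump.
exists (cbox a b); split=> //; first exact: compact_cbox.
by move=> x nx; apply: boxbump_out => /obox_cbox.
Qed.

End box_bump.

(** * Boxes as a generating pi-system *)

Section borel_boxes.
Context {R : realType} {d : nat}.

Definition oboxes : set (set 'rV[R]_d) := [set A | exists a b, A = obox a b].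

Lemma oboxI (a b a' b' : 'rV[R]_d) : obox a b `&` obox a' b' =
  obox (\row_i Num.max (a 0 i) (a' 0 i)) (\row_i Num.min (b 0 i) (b' 0 i)).
Proof.
apply/seteqP; split=> [x [h h'] i|x h].
  by have := h i; have := h' i; rewrite !mxE gt_max lt_min => /andP[-> ->] /andP[-> ->].
by split=> i; have := h i; rewrite !mxE gt_max lt_min => /andP[/andP[? ?] /andP[? ?]];
  apply/andP.
Qed.

Lemma oboxes_setI : setI_closed oboxes.
Proof.
by move=> _ _ [a [b ->]] [a' [b' ->]]; rewrite oboxI; do 2 eexists; reflexivity.
Qed.

Lemma open_oboxes (O : set 'rV[R]_d) : open O -> <<s oboxes >> O.
Proof.
move=> /open_bigcup_obox ->; have := smallest_sigma_algebra setT oboxes.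
move=> [s0 sC sU]; pose F (p : 'rV[rat]_d * 'rV[rat]_d) : set 'rV[R]_d :=
  if p \in [set p | cbox (map_mx ratr p.1) (map_mx ratr p.2) `<=` O]
  then obox (map_mx ratr p.1) (map_mx ratr p.2) else set0.
have -> : \bigcup_(p in [set p | cbox (map_mx ratr p.1) (map_mx ratr p.2) `<=` O])
    obox (map_mx ratr p.1) (map_mx ratr p.2) =
    \bigcup_n (if unpickle n is Some p then F p else set0).
  rewrite bigcup_mkcond; apply/seteqP; split=> [x [p _ Fp]|x [n _]].
    by exists (pickle p) => //; rewrite pickleK.
  by case: unpickle => // p Fp; exists p.
apply: sU => n; case: unpickle => [p|//]; rewrite /F; case: ifP => // _.
by apply: sub_sigma_algebra; do 2 eexists; reflexivity.
Qed.

Lemma measurable_oboxes (A : set 'rV[R]_d) : measurable A -> <<s oboxes >> A.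
Proof.
move: A; apply: smallest_sub; first exact: smallest_sigma_algebra.
rewrite -bigcup_seq; apply: bigcup_sub => i _ A [B mB <-].
set f := rV_coor _ in mB *.
have sB : measurable `<=` image_set_system setT f <<s oboxes >>.
  rewrite RGenOpens.measurableE; apply: smallest_sub.
    exact/sigma_algebra_image/smallest_sigma_algebra.
  move=> _ [a [b ->]]; rewrite /image_set_system /= setTI.
  apply: open_oboxes; apply: open_comp; last exact: interval_open.
  by move=> x _; exact: coord_continuous.
exact: (sB B mB).
Qed.

End borel_boxes.

Lemma cvg_cst_unique {R : realType} (a b : R) : (fun=> a) @ \oo --> b -> b = a.
Proof. by move=> /cvg_lim <-//; rewrite lim_cst. Qed.

(** * The fundamental lemma of the calculus of variations *)

Section fundamental_lemma.
Context {R : realType} {d : nat} (Omega : set 'rV[R]_d).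
Hypothesis mO : measurable Omega.
Implicit Types f : sfield R d.

Lemma ips_dominated f (k chi : sfield R d) (chi_ : nat -> sfield R d) :
  L2s Omega f -> L2s Omega k ->
  (forall n, measurable_fun Omega (chi_ n : _ -> measurableTypeR R)) ->
  measurable_fun Omega (chi : _ -> measurableTypeR R) ->
  (forall n x, Omega x -> `|chi_ n x| <= k x) ->
  (forall x, Omega x -> chi_ n x @[n --> \oo] --> chi x) ->
  ips Omega f (chi_ n) @[n --> \oo] --> ips Omega f chi.
Proof.
move=> Lf Lk mchi_ mchi chik chicvg; have [mf _] := Lf.
have ik := L2s_mul mO Lf Lk.
have [|||||ic _ c] := @dominated_convergence _ _ R (leb d) Omega mO
  (fun n x => (f x * chi_ n x)%:E) (fun x => (f x * chi x)%:E)
  (fun x => `|(f x * k x)%:E|%E).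
- by move=> n; apply/measurable_EFinP; exact: measurable_funM mf (mchi_ n).
- by apply/measurable_EFinP; exact: measurable_funM mf mchi.
- apply: aeW => x Ox; apply: cvg_EFin; first exact: nearW.
  by apply: cvgM; [exact: cvg_cst|exact: chicvg].
- exact: integrable_abse.
- apply: aeW => x n Ox; rewrite /= lee_fin !normrM ler_wpM2l//.
  by apply: le_trans (chik n x Ox) _; exact: ler_norm.
apply: fine_cvg; rewrite fineK//.
exact: integrable_fin_num.
Qed.

Lemma L2s_indic (A : set 'rV[R]_d) : measurable A -> (leb d A < +oo)%E ->
  L2s Omega (\1_A : _ -> R).
Proof.
move=> mA Afin; split; first exact: measurable_indic.
have -> : (fun x => (\1_A x ^+ 2)%:E) = EFin \o (\1_A : _ -> R).
  by apply/funext => x; rewrite /= indicE; case: (_ \in _); rewrite ?expr1n ?expr0n.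
apply/integrableP; split; first by apply/measurable_EFinP; exact: measurable_indic.
rewrite (eq_integral (fun x => (\1_A x)%:E)) => [|x _]; last first.
  by rewrite /= ger0_norm// indicE.
rewrite integral_indic//; apply: le_lt_trans Afin.
by apply: le_measure; rewrite ?inE//; exact: measurableI.
Qed.

Variables (O : set 'rV[R]_d) (f : sfield R d).
Hypotheses (OO : O `<=` Omega) (Lf : L2s Omega f).
Hypothesis f0 : forall phi, test O phi -> ips Omega f phi = 0.

Lemma ips_obox0 a b : cbox a b `<=` O -> ips Omega f (\1_(obox a b) : _ -> R) = 0.
Proof.
move=> abO; have mab := measurable_obox a b.
have : ips Omega f (boxbump n a b) @[n --> \oo] -->
    ips Omega f (\1_(obox a b) : _ -> R).
  apply: (@ips_dominated f (\1_(obox a b) : _ -> R)) => //.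
  - by apply: L2s_indic => //; exact: leb_obox_lt_pinfty.
  - move=> n; apply: continuous_measurable_rV => //.
    by apply: diff_continuous; apply: smooth_diff; exact: smooth_boxbump.
  - move=> n x _; rewrite indicE.
    case: (boolP (x \in obox a b)); rewrite ?(inE, notin_setE) => xab.
      by have /andP[? ?] := boxbump_itv n a b x; rewrite ger0_norm.
    by rewrite boxbump_out// normr0.
  - by move=> x _; exact: boxbump_cvg.
rewrite (_ : (fun n => _) = fun=> 0); last first.
  by apply/funext => n; rewrite f0//; exact: test_boxbump.
by move=> /(@cvg_cst_unique _ _) ->.
Qed.

(** The pi-lambda theorem: the sets [A] with this property form a lambda-system that contains the
    boxes. Intersecting with the fixed box keeps all indicators square-integrable. *)
Lemma ips_measurable0 a b A : cbox a b `<=` O -> measurable A ->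
  ips Omega f (\1_(A `&` obox a b) : _ -> R) = 0.
Proof.
move=> abO mA; have mab := measurable_obox a b.
have L2A B : measurable B -> L2s Omega (\1_(B `&` obox a b) : _ -> R).
  move=> mB; apply: L2s_indic; first exact: measurableI.
  apply: le_lt_trans (leb_obox_lt_pinfty a b).
  by apply: le_measure; rewrite ?inE//; exact: measurableI.
suff : <<s @oboxes R d >> `<=`
    [set A | measurable A /\ ips Omega f (\1_(A `&` obox a b) : _ -> R) = 0].
  by move=> /(_ _ (measurable_oboxes mA))[].
apply: lambda_system_subset => //; first exact: oboxes_setI.
- split=> //.
  + by split; [exact: measurableT|rewrite setTI; exact: ips_obox0].
  + move=> B C CB [mB B0] [mC C0]; split; first exact: measurableD.
    have -> : (\1_((B `\` C) `&` obox a b) : _ -> R) =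
        (\1_(B `&` obox a b) : _ -> R) + (- 1) *: (\1_(C `&` obox a b) : _ -> R).
      apply/funext => x.
      rewrite -[RHS]/((\1_(B `&` obox a b) x : R) + (- 1) * (\1_(C `&` obox a b) x : R)).
      rewrite [LHS]indicE in_setI in_setD !indicE !in_setI.
      have : x \in C -> x \in B by rewrite !inE; exact: CB.
      by case: (x \in C) => [->//|_]; case: (x \in B); case: (x \in obox a b);
        rewrite /= ?mulr0 ?mulr1 ?addr0 ?subrr.
    rewrite ipsC ipsDl//; [|exact: L2A|by apply: L2sZ => //; exact: L2A].
    by rewrite ipsZl// ?[ips _ _ f]ipsC ?B0 ?C0 ?mulr0 ?addr0//; exact: L2A.
  + move=> F ndF HF; have mF n : measurable (F n) by case: (HF n).
    split; first exact: bigcupT_measurable.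
    have : ips Omega f (\1_(F n `&` obox a b) : _ -> R) @[n --> \oo] -->
        ips Omega f (\1_((\bigcup_n F n) `&` obox a b) : _ -> R).
      apply: (@ips_dominated f (\1_(obox a b) : _ -> R)) => //.
      * by apply: L2s_indic => //; exact: leb_obox_lt_pinfty.
      * by move=> n; apply: measurable_indic; exact: measurableI.
      * by apply: measurable_indic; apply: measurableI => //; exact: bigcupT_measurable.
      * move=> n x _; rewrite !indicE in_setI.
        by case: (x \in F n); case: (x \in obox a b); rewrite ?normr0 ?normr1.
      * move=> x _; have [[n _ Fn]|nF] := pselect ((\bigcup_n F n) x).
          apply: cvg_near_cst; exists n => // m /= nm.
          have Fm : F m x by move: (ndF _ _ nm) => /subsetPset; apply.
          have UF : (\bigcup_n F n) x by exists n.
          by rewrite !indicE !in_setI (mem_set Fm) (mem_set UF).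
        apply: cvg_near_cst; apply: nearW => m.
        have nFm : ~ F m x by move=> Fm; apply: nF; exists m.
        by rewrite !indicE !in_setI (memNset nFm) (memNset nF).
    under eq_fun do rewrite (HF _).2.
    by move=> /(@cvg_cst_unique _ _) ->.
- move=> _ [a' [b' ->]]; split; first exact: measurable_obox.
  rewrite oboxI; apply: ips_obox0 => x h; apply: abO => i; have := h i.
  by rewrite !mxE ge_max le_min => /andP[/andP[_ ->] /andP[_ ->]].
Qed.

(** The integrals of [f] over all measurable subsets of the box vanish, which determines [f] there
    up to a null set. *)
Lemma ae_eq0_obox a b : cbox a b `<=` O ->
  {ae leb d, forall x, obox a b x -> f x = 0}.
Proof.
move=> abO; have mab := measurable_obox a b.
have abOm : obox a b `<=` Omega by move=> x /obox_cbox /abO /OO.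
have L2A A : measurable A -> A `<=` obox a b -> L2s Omega (\1_A : _ -> R).
  move=> mA Aab; apply: L2s_indic => //.
  apply: le_lt_trans (leb_obox_lt_pinfty a b).
  by apply: le_measure; rewrite ?inE.
have iE A : measurable A -> A `<=` obox a b ->
    (\int[leb d]_(x in A) (f x)%:E = \int[leb d]_(x in Omega) (f x * \1_A x)%:E)%E.
  move=> mA Aab; rewrite -[in LHS](setIidr (subset_trans Aab abOm)) integral_mkcondr.
  apply: eq_integral => x _; rewrite patchE indicE.
  by case: (x \in A); rewrite ?mulr1 ?mulr0.
have fi : (leb d).-integrable (obox a b) (EFin \o f).
  apply: (@eq_integrable _ _ _ _ _ mab (fun x => (f x * \1_(obox a b) x)%:E)).
    by move=> x xab; rewrite indicE xab mulr1.
  apply: integrableS (L2s_mul mO Lf (L2A _ mab _)) => //.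
have := integral_ae_eq mab fi (measurable_cst 0%E) _.
move=> H; have {}H := H _; apply: filterS (H _) => [x fx0 xab|].
  by have [] := fx0 xab.
move=> E Eab mE; rewrite iE// integral0.
have i1 := L2s_mul mO Lf (L2A _ mE Eab).
have := ips_measurable0 abO mE.
rewrite /ips /integrate /Rintegral (setIidl Eab) => /eqP.
by rewrite fine_eq0; [move/eqP|exact: integrable_fin_num].
Qed.

Lemma fundamental_lemma : open O -> {ae leb d, forall x, O x -> f x = 0}.
Proof.
move=> oO; pose Q (p : 'rV[rat]_d * 'rV[rat]_d) :=
  obox (map_mx ratr p.1 : 'rV[R]_d) (map_mx ratr p.2).
have : {ae leb d, forall x, forall p : 'rV[rat]_d * 'rV[rat]_d,
    cbox (map_mx ratr p.1) (map_mx ratr p.2) `<=` O -> Q p x -> f x = 0}.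
  apply: ae_countable => p.
  have [pO|npO] := pselect (cbox (map_mx ratr p.1) (map_mx ratr p.2) `<=` O).
    by have := ae_eq0_obox pO; apply: filterS => x h _; exact: h.
  exact: aeW.
apply: filterS => x h; rewrite (open_bigcup_obox oO) => -[p pO px].
exact: h p pO px.
Qed.

End fundamental_lemma.

(** * Integrals of derivatives of functions supported in a cube *)

Section integral_derivative.
Context {R : realType}.

Lemma continuous_rV (S : topologicalType) n (f : S -> 'rV[R]_n) :
  (forall j, continuous (fun s => f s 0 j)) -> continuous f.
Proof.
move=> cf s A [P Pf PA].
have : \forall z \near s, forall j, P 0 j (f z 0 j).
  by apply: filter_forall => j; exact: (cf j s _ (Pf 0 j)).
by apply: filterS => z Pz; apply: PA => i j; rewrite (ord1 i).
Qed.

Lemma rV_snocE n (x : 'rV[R]_n) (y : R) (j : 'I_n) :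
  rV_snoc (x, y) 0 (lift ord_max j) = x 0 j.
Proof. by rewrite mxE liftK. Qed.

Lemma rV_snoc_max n (x : 'rV[R]_n) (y : R) : rV_snoc (x, y) 0 ord_max = y.
Proof. by rewrite mxE unlift_none. Qed.

Lemma continuous_snocl n (y : R) : continuous (fun x : 'rV[R]_n => rV_snoc (x, y)).
Proof.
apply: continuous_rV => i; case: (unliftP ord_max i) => [j ->|->].
  by under [X in continuous X]eq_fun do rewrite rV_snocE; exact: coord_continuous.
by under [X in continuous X]eq_fun do rewrite rV_snoc_max; exact: cst_continuous.
Qed.

Lemma continuous_snocr n (x : 'rV[R]_n) : continuous (fun y : R => rV_snoc (x, y)).
Proof.
apply: continuous_rV => i; case: (unliftP ord_max i) => [j ->|->].
  by under [X in continuous X]eq_fun do rewrite rV_snocE; exact: cst_continuous.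
by under [X in continuous X]eq_fun do rewrite rV_snoc_max; move=> y; exact: cvg_id.
Qed.

Lemma snoc_shiftl n (x : 'rV[R]_n) (y h : R) (j : 'I_n) :
  rV_snoc (h *: delta_mx 0 j + x, y) =
  h *: delta_mx 0 (lift ord_max j) + rV_snoc (x, y).
Proof.
apply/rowP => i; rewrite [RHS]mxE [in RHS]mxE.
case: (unliftP ord_max i) => [k ->|->].
  by rewrite !rV_snocE !mxE eqxx (inj_eq lift_inj).
by rewrite !rV_snoc_max mxE eqxx (negbTE (neq_lift _ _)) mulr0 add0r.
Qed.

Lemma snoc_shiftr n (x : 'rV[R]_n) (y h : R) :
  rV_snoc (x, h + y) = h *: delta_mx 0 ord_max + rV_snoc (x, y).
Proof.
apply/rowP => i; rewrite [RHS]mxE [in RHS]mxE.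
case: (unliftP ord_max i) => [k ->|->].
  by rewrite !rV_snocE !mxE eqxx eq_sym (negbTE (neq_lift _ _)) mulr0 add0r.
by rewrite !rV_snoc_max mxE !eqxx mulr1.
Qed.

Lemma integral_derivative1 (F G : R -> R) (K : R) : 0 < K -> continuous G ->
  (forall y : R, is_derive y (1 : R) F (G y)) ->
  (forall y : R, ~ (- K < y < K) -> F y = 0 /\ G y = 0) ->
  (\int[lebesgue_measure]_y (G y)%:E = 0)%E.
Proof.
move=> K0 cG dF F0.
have -> : (\int[lebesgue_measure]_y (G y)%:E =
    \int[lebesgue_measure]_(y in `[(- K)%R, K]) (G y)%:E)%E.
  rewrite [RHS]integral_mkcond; apply: eq_integral => y _; rewrite patchE.
  case: ifPn => //; rewrite notin_setE /= in_itv /= => nK.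
  by rewrite (F0 y _).2// => /andP[a b]; apply: nK; rewrite !ltW.
have cF : continuous F.
  move=> y; apply: differentiable_continuous; apply/derivable1_diffP.
  by have [] := dF y.
rewrite (@continuous_FTC2 _ _ F); [|lra| | |].
- by rewrite (F0 K _).1 ?(F0 (- K) _).1 ?subee// => /andP[]; rewrite ltxx.
- by apply: continuous_subspaceT.
- split; first by move=> y _; have [] := dF y.
    exact: cvg_at_right_filter (cF _).
  exact: cvg_at_left_filter (cF _).
- by move=> y _; rewrite derive1E; have [] := dF y.
Qed.

(** Induction on the dimension with Fubini's theorem. The inner integral runs over the first [n]
    coordinates when the derivative is along one of them, and over the last coordinate otherwise.
    Continuity, boundedness and vanishing outside a cube make [G] integrable. *)
Lemma integral_derivative n (i : 'I_n) (F G : 'rV[R]_n -> R) (K C : R) :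
  0 < K -> continuous G -> (forall x, `|G x| <= C) ->
  (forall x, is_derive x (delta_mx 0 i) F (G x)) ->
  (forall x, ~ obox (const_mx (- K)) (const_mx K) x -> F x = 0 /\ G x = 0) ->
  (\int[leb n]_x (G x)%:E = 0)%E.
Proof.
move=> K0; elim: n i F G => [|n IH] i F G cG GC dF F0; first by move: i dF => [].
pose m := (@lebf R n \x @lebesgue_measure R)%E.
have mG : measurable_fun setT (EFin \o G).
  by apply/measurable_EFinP; exact: continuous_measurable_rV.
have msnoc := @measurable_rV_snoc R n.
pose Q := @obox R n.+1 (const_mx (- K)) (const_mx K).
have mQ : measurable (@rV_snoc R n @^-1` Q).
  rewrite -[X in measurable X]setTI; apply: msnoc => //; exact: measurable_obox.
have iG : m.-integrable setT (EFin \o G \o @rV_snoc R n).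
  apply: (@le_integrable _ _ _ _ _ measurableT _
      (fun p => (C * \1_(@rV_snoc R n @^-1` Q) p)%:E)).
  - by apply: measurableT_comp.
  - move=> p _ /=; rewrite lee_fin.
    have [Qp|Qp] := pselect (Q (rV_snoc p)).
      by rewrite indicE mem_set// mulr1 (le_trans (GC _))// ler_norm.
    by rewrite (F0 _ Qp).2 normr0.
  - rewrite (_ : (fun p => _) = (fun p => C%:E * (\1_(@rV_snoc R n @^-1` Q) p)%:E)%E)//.
    apply: integrableZl => //; apply/integrableP; split.
      by apply/measurable_EFinP; exact: measurable_indic.
    rewrite (eq_integral (fun p => (\1_(@rV_snoc R n @^-1` Q) p)%:E)) => [|p _]; last first.
      by rewrite /= ger0_norm// indicE.
    rewrite integral_indic// setIT.
    exact: (@leb_obox_lt_pinfty R n.+1 (const_mx (- K)) (const_mx K)).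
(* [leb n.+1] is by definition the push-forward of the product measure. *)
transitivity (\int[pushforward m (@rV_snoc R n)]_x (G x)%:E)%E; first by [].
have iG' : m.-integrable (@rV_snoc R n @^-1` setT) ((EFin \o G) \o @rV_snoc R n).
  by rewrite preimage_setT.
rewrite (integral_pushforward msnoc mG iG' measurableT).
rewrite preimage_setT.
case: (unliftP ord_max i) => [j ij|iM].
  rewrite -(integral21_prod_meas1 iG); apply: integral0_eq => y _.
  apply: (IH j (fun x => F (rV_snoc (x, y))) (fun x => G (rV_snoc (x, y)))).
  - move=> x; apply: continuous_comp; [exact: continuous_snocl|exact: cG].
  - by move=> x; exact: GC.
  - move=> x; apply/is_derive_cvg; under eq_fun do rewrite snoc_shiftl -ij.
    by apply/is_derive_cvg; exact: dF.
  - move=> x nx; apply: F0 => h; apply: nx => k.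
    by have := h (lift ord_max k); rewrite rV_snocE !mxE.
rewrite -(integral12_prod_meas1 iG); apply: integral0_eq => x _.
apply: (@integral_derivative1 (fun y => F (rV_snoc (x, y)))
  (fun y => G (rV_snoc (x, y))) K) => //.
- move=> y; apply: continuous_comp; [exact: continuous_snocr|exact: cG].
- move=> y; apply/is_derive_cvg.
  under eq_fun do rewrite [_ *: 1]mulr1 snoc_shiftr -iM.
  by apply/is_derive_cvg; exact: dF.
- move=> y ny; apply: F0 => h; apply: ny.
  by have := h ord_max; rewrite rV_snoc_max !mxE.
Qed.

End integral_derivative.

(** * Symmetry of second derivatives *)

Section schwarz.
Context {R : realType} {d : nat}.
Implicit Types (f : sfield R d) (i j : 'I_3) (x : 'rV[R]_d).

Lemma is_derive_partial_line f x i (s : R) : diff_everywhere f ->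
  is_derive s 1 (fun t : R => f (t *: dir i + x)) (partial i f (s *: dir i + x)).
Proof.
move=> df; have := @is_derive_line R _ f x (dir i) s (partial i f (s *: dir i + x)).
by move=> [+ _]; apply; exact: is_derive_partial.
Qed.

Lemma MVT_partial f x i (h : R) : diff_everywhere f -> 0 < h ->
  exists2 c : R, 0 < c < h & f (h *: dir i + x) - f x =
    partial i f (c *: dir i + x) * h.
Proof.
move=> df h0; pose g (t : R) := f (t *: dir i + x).
have dg (s : R) : is_derive s (1 : R) g (partial i f (s *: dir i + x)).
  exact: is_derive_partial_line.
have cg : {within `[0, h], continuous g}.
  by apply: derivable_within_continuous => s _; have [] := dg s.
have [c] := MVT h0 (fun s _ => dg s) cg.
by rewrite in_itv /= /g scale0r add0r subr0 => c0 fE; exists c.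
Qed.

(** The mean value theorem twice: in direction [i] for the difference of two translates, then in
    direction [j]. *)
Lemma second_difference f x i j (h : R) : smooth f -> 0 < h ->
  exists a b : R, [/\ 0 < a < h, 0 < b < h &
  f (h *: dir i + (h *: dir j + x)) - f (h *: dir j + x) - (f (h *: dir i + x) - f x)
  = partial j (partial i f) (a *: dir i + (b *: dir j + x)) * h ^+ 2].
Proof.
move=> sf h0; have df := smooth_diff sf.
pose g (t : R) := f (t *: dir i + (h *: dir j + x)) - f (t *: dir i + x).
have dg (s : R) : is_derive s (1 : R) g
    (partial i f (s *: dir i + (h *: dir j + x)) - partial i f (s *: dir i + x)).
  by apply: is_deriveB; exact: is_derive_partial_line.
have cg : {within `[0, h], continuous g}.
  by apply: derivable_within_continuous => s _; have [] := dg s.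
have [a] := MVT h0 (fun s _ => dg s) cg.
rewrite in_itv /= /g !scale0r !add0r subr0 => a0 gE.
have [b b0 pE] := MVT_partial (a *: dir i + x) j (smooth_diff (smooth_partial i sf)) h0.
exists a, b; split=> //.
have swap (p q u v : R) : p - q - (u - v) = p - u - (q - v) by ring.
rewrite swap gE.
by rewrite addrCA pE [b *: dir j + (_ + _)]addrCA -mulrA -expr2.
Qed.

Lemma near_second f x i j e : continuous f -> 0 < e ->
  exists2 del : R, 0 < del & forall a b : R, 0 < a < del -> 0 < b < del ->
  `|f (a *: dir i + (b *: dir j + x)) - f x| < e.
Proof.
move=> cf e0; have /cvgrPdistC_lt/(_ e e0) := cf x.
move=> /nbhs_ballP[r /= r0 rP]; exists (r / 2); first lra.
move=> a b ha hb; apply: rP; split=> // k l; rewrite (ord1 k) /ball /= !mxE.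
have [A0 A1] : 0 <= (l == i :> nat)%:R :> R /\ (l == i :> nat)%:R <= 1 :> R.
  by case: eqP.
have [B0 B1] : 0 <= (l == j :> nat)%:R :> R /\ (l == j :> nat)%:R <= 1 :> R.
  by case: eqP.
rewrite distrC addrA addrK ltr_norml; nra.
Qed.

(** The second difference does not depend on the order of the directions, so the two mixed
    derivatives take equal values at points arbitrarily near [x]; continuity then excludes a
    positive distance [e] at [x]. *)
Lemma partialC f i j : smooth f -> partial i (partial j f) = partial j (partial i f).
Proof.
move=> sf; apply/funext => x; apply/eqP; rewrite -subr_eq0; apply/eqP.
apply/eqP; rewrite -normr_le0 leNgt; apply/negP => e0.
set e := `|_| in e0.
have sp k l : continuous (partial k (partial l f)).
  by apply: diff_continuous; apply: smooth_diff; do 2 apply: smooth_partial.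
have e20 : 0 < e / 2 by lra.
have [d1 d10 P1] := near_second x i j (sp j i) e20.
have [d2 d20 P2] := near_second x j i (sp i j) e20.
have [h [h0 hd1 hd2]] : exists h : R, [/\ 0 < h, h <= d1 & h <= d2].
  by exists (Num.min d1 d2); rewrite lt_min d10 !ge_min !lexx orbT.
have [a [b [ha hb E1]]] := second_difference x i j sf h0.
have [a' [b' [ha' hb' E2]]] := second_difference x j i sf h0.
have : partial j (partial i f) (a *: dir i + (b *: dir j + x)) =
    partial i (partial j f) (a' *: dir j + (b' *: dir i + x)).
  have h2 : h ^+ 2 != 0 by rewrite expf_neq0// gt_eqF.
  have swap (p q u v : R) : p - q - (u - v) = p - u - (q - v) by ring.
  move: E1; rewrite (addrCA (h *: dir i) (h *: dir j) x) swap E2.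
  by move=> /(mulIf h2) ->.
move=> E; have p1 : `|partial j (partial i f) (a *: dir i + (b *: dir j + x))
    - partial j (partial i f) x| < e / 2.
  by move: ha hb => /andP[a0 ah] /andP[b0 bh]; apply: P1; rewrite ?a0 ?b0 /= (lt_le_trans _ hd1).
have p2 : `|partial i (partial j f) (a' *: dir j + (b' *: dir i + x))
    - partial i (partial j f) x| < e / 2.
  by move: ha' hb' => /andP[a0 ah] /andP[b0 bh]; apply: P2; rewrite ?a0 ?b0 /= (lt_le_trans _ hd2).
rewrite -E distrC in p2.
have : e < e / 2 + e / 2.
  rewrite {1}/e; apply: le_lt_trans (ltrD p2 p1).
  by apply: le_trans (ler_normD _ _); rewrite addrA subrK.
by rewrite -splitr ltxx.
Qed.

End schwarz.

Section tests.
Context {R : realType} {d : nat}.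
Implicit Types (f g phi : sfield R d) (O : set 'rV[R]_d) (i : 'I_3).

Lemma test_partial O phi i : test O phi -> test O (partial i phi).
Proof.
move=> [sphi [K [cK KO phi0]]]; split; first exact: smooth_partial.
exists K; split=> // x nKx; have := @near_eq_derive R _ _ (cst 0) phi x (dir i).
rewrite derive_cst /partial => -> //.
have : open (~` K) by apply: closed_openC; apply: compact_closed => //; exact: norm_hausdorff.
rewrite openE => /(_ x nKx); rewrite /interior; apply: filterS => y nKy.
by rewrite phi0.
Qed.

Lemma test0 O : test O (0 : sfield R d).
Proof. by split; [exact: smooth_cst|exists set0; split=> //; exact: compact0]. Qed.

Lemma testD O f g : test O f -> test O g -> test O (f + g).
Proof.
move=> [sf [K [cK KO f0]]] [sg [L [cL LO g0]]]; split; first exact: smoothD.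
exists (K `|` L); split; [exact: compactU|by move=> x []; [exact: KO|exact: LO]|].
by move=> x /not_orP[nK nL]; rewrite -[LHS]/(f x + g x) f0// g0// addr0.
Qed.

Lemma testN O f : test O f -> test O (- f).
Proof.
move=> [sf [K [cK KO f0]]]; split; first exact: smoothN.
by exists K; split=> // x nK; rewrite -[LHS]/(- f x) f0// oppr0.
Qed.

Lemma testB O f g : test O f -> test O g -> test O (f - g).
Proof. by move=> tf tg; apply: testD => //; exact: testN. Qed.

Lemma test_sub O O' f : O `<=` O' -> test O f -> test O' f.
Proof.
move=> OO' [sf [K [cK KO f0]]]; split=> //; exists K; split=> //.
exact: subset_trans KO OO'.
Qed.

Lemma test_continuous O f : test O f -> continuous f.
Proof. by move=> [sf _]; apply: diff_continuous; exact: smooth_diff. Qed.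

Lemma test_out O f x : test O f -> ~ O x -> f x = 0.
Proof. by move=> [_ [K [_ KO f0]]] nO; apply: f0 => /KO. Qed.

End tests.

(** * Integration by parts against test functions *)

Section integration_by_parts.
Context {R : realType} {d : nat} (Omega : set 'rV[R]_d).
Hypotheses (mO : measurable Omega) (bO : bounded_set Omega).
Implicit Types f p phi : sfield R d.

Lemma leb_bounded_lt_pinfty : (leb d Omega < +oo)%E.
Proof.
have [K K0 OK] := bounded_cbox bO.
apply: le_lt_trans (leb_obox_lt_pinfty (const_mx (- K)) (const_mx K)).
by apply: le_measure; rewrite ?inE//; exact: measurable_obox.
Qed.

Lemma continuous_cbox_bounded f (a b : 'rV[R]_d) : continuous f ->
  exists C, forall x, cbox a b x -> `|f x| <= C.
Proof.
move=> cf; have cab := @compact_cbox R d a b.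
have := continuous_compact (continuous_subspaceT cf) cab.
move=> /compact_bounded[C [_ CP]]; exists (C + 1) => x abx.
by apply: (CP (C + 1)); [lra|exists x].
Qed.

Lemma continuous_L2s f : continuous f -> L2s Omega f.
Proof.
move=> cf; have [K K0 OK] := bounded_cbox bO.
have [C CP] := continuous_cbox_bounded (const_mx (- K)) (const_mx K) cf.
apply: (@L2s_bounded _ _ _ mO _ C) => //; first exact: leb_bounded_lt_pinfty.
  exact: continuous_measurable_rV.
by move=> x /OK/obox_cbox; exact: CP.
Qed.

Lemma test_L2s phi (O : set 'rV[R]_d) : test O phi -> L2s Omega phi.
Proof. by move=> /test_continuous; exact: continuous_L2s. Qed.

(** The derivative of [p * phi] vanishes outside [Omega], so its integral over [Omega] is one over
    the whole space and equals 0; the support of [phi] removes any boundary term. *)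
Lemma ips_partial p phi (i : 'I_3) : diff_everywhere p -> continuous (partial i p) ->
  test Omega phi -> ips Omega p (partial i phi) = - ips Omega (partial i p) phi.
Proof.
move=> dp cp tphi; have tp := test_partial i tphi.
have [sphi [K [cK KO phi0]]] := tphi; have dphi := smooth_diff sphi.
have Lp := continuous_L2s (diff_continuous dp); have Ldp := continuous_L2s cp.
have Lphi := test_L2s tphi; have Ldphi := test_L2s tp.
apply/eqP; rewrite -addr_eq0 [X in _ + X]ipsC; apply/eqP.
rewrite /ips /integrate -RintegralD//; [|exact: L2s_mul|exact: L2s_mul].
pose G := p * partial i phi + phi * partial i p.
rewrite -[LHS]/(\int[leb d]_(x in Omega) G x).
have cG : continuous G.
  move=> x; apply: (@cvgD _ _ _ (nbhs x)); apply: (@cvgM _ _ (nbhs x)).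
  - exact: diff_continuous.
  - exact: (test_continuous tp).
  - exact: (test_continuous tphi).
  - exact: cp.
have G0 x : ~ Omega x -> G x = 0.
  move=> nO; rewrite -[G x]/(p x * partial i phi x + phi x * partial i p x).
  by rewrite (test_out tphi nO) (test_out tp nO) mulr0 mul0r addr0.
rewrite /Rintegral integral_mkcond (_ : _ \_ _ = EFin \o G); last first.
  apply/funext => x; rewrite patchE; case: ifPn => //.
  by rewrite notin_setE => /G0 /= ->.
have dF x : is_derive x (dir i) (p * phi) (G x).
  rewrite -[G x]/((p * partial i phi + phi * partial i p) x) -partialM//.
  by apply: is_derive_partial; exact: differentiableM.
(* A direction beyond the dimension is the zero vector, and derivatives along it vanish. *)
have [id|di] := ltnP i d; last first.
  have di0 : dir i = 0 :> 'rV[R]_d.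
    by apply/rowP => j; rewrite !mxE ltn_eqF// (leq_trans (ltn_ord j)).
  rewrite integral0_eq// => x _ /=; congr EFin.
  by have := dF x; rewrite di0 => -[_ <-]; rewrite derive0.
have diE : dir i = delta_mx 0 (Ordinal id) :> 'rV[R]_d.
  by apply/rowP => j; rewrite !mxE eqxx.
have [L L0 OL] := bounded_cbox bO.
have [C CP] := continuous_cbox_bounded (const_mx (- L)) (const_mx L) cG.
suff -> : (\int[leb d]_x (G x)%:E = 0)%E by [].
apply: (@integral_derivative _ d (Ordinal id) (p * phi) G L `|C|) => //.
- move=> x; have [xL|nxL] := pselect (obox (const_mx (- L)) (const_mx L) x).
    by apply: le_trans (ler_norm C); apply: CP; exact: obox_cbox.
  by rewrite G0 ?normr0//; apply: contra_not nxL; exact: OL.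
- by move=> x; rewrite -diE; exact: dF.
- move=> x nxL; have nO : ~ Omega x by apply: contra_not nxL; exact: OL.
  by split; [rewrite -[LHS]/(p x * phi x) (test_out tphi nO) mulr0|exact: G0].
Qed.

End integration_by_parts.

(** * Polynomials *)

Section polynomials.
Context {R : realType} {d : nat}.
Implicit Types (f g : sfield R d) (m : 'I_d -> nat) (r : nat) (i : 'I_3).

Definition mono m : sfield R d := fun x => \prod_(l < d) x 0 l ^+ m l.

Lemma poly_leP r f : poly_le r f <-> exists c : {ffun 'I_d -> 'I_r.+1} -> R,
  f = \sum_(a : {ffun 'I_d -> 'I_r.+1} | (\sum_(l < d) a l <= r)%N)
        c a *: mono (fun l => a l).
Proof.
split=> [[c fE]|[c fE]]; exists c.
  by apply/funext => x; rewrite fE fct_sumE.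
by move=> x; rewrite fE fct_sumE.
Qed.

Lemma poly_le_ind r (P : sfield R d -> Prop) : P 0 ->
  (forall f g, P f -> P g -> P (f + g)) -> (forall (c : R) f, P f -> P (c *: f)) ->
  (forall m, (\sum_(l < d) m l <= r)%N -> P (mono m)) ->
  forall f, poly_le r f -> P f.
Proof.
move=> P0 PD PZ Pm f /poly_leP[c ->]; apply: (big_ind P) => // a ar.
by apply: PZ; exact: Pm.
Qed.

Lemma poly_le0 r : poly_le r (0 : sfield R d).
Proof. by exists (fun=> 0) => x; rewrite big1// => a _; rewrite mul0r. Qed.

Lemma poly_leD r f g : poly_le r f -> poly_le r g -> poly_le r (f + g).
Proof.
move=> [c fE] [c' gE]; exists (fun a => c a + c' a) => x.
rewrite -[LHS]/(f x + g x) fE gE -big_split; apply: eq_bigr => a _.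
by rewrite mulrDl.
Qed.

Lemma poly_leZ r (b : R) f : poly_le r f -> poly_le r (b *: f).
Proof.
move=> [c fE]; exists (fun a => b * c a) => x.
rewrite -[LHS]/(b * f x) fE mulr_sumr; apply: eq_bigr => a _.
by rewrite mulrA.
Qed.

Lemma poly_leN r f : poly_le r f -> poly_le r (- f).
Proof. by rewrite -scaleN1r; exact: poly_leZ. Qed.

Lemma poly_leB r f g : poly_le r f -> poly_le r g -> poly_le r (f - g).
Proof. by move=> pf pg; apply: poly_leD => //; exact: poly_leN. Qed.

Lemma poly_le_mono r m : (\sum_(l < d) m l <= r)%N -> poly_le r (mono m).
Proof.
move=> mr; have ml l : (m l < r.+1)%N.
  by rewrite ltnS (leq_trans _ mr)// (bigD1 l)//= leq_addr.
pose a : {ffun 'I_d -> 'I_r.+1} := [ffun l => Ordinal (ml l)].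
have aE l : a l = m l :> nat by rewrite ffunE.
exists (fun a' => (a' == a)%:R) => x; rewrite (bigD1 a)/=; last first.
  by rewrite (eq_bigr _ (fun l _ => aE l)).
rewrite eqxx mul1r [X in _ + X]big1 => [|a' /andP[_ /negbTE ->]]; last by rewrite mul0r.
by rewrite addr0; apply: eq_bigr => l _; rewrite aE.
Qed.

Lemma poly_le_trans r r' f : (r <= r')%N -> poly_le r f -> poly_le r' f.
Proof.
move=> rr'; apply: poly_le_ind; [exact: poly_le0|exact: poly_leD|exact: poly_leZ|].
by move=> m mr; apply: poly_le_mono; exact: leq_trans rr'.
Qed.

Lemma poly_le_cst r (c : R) : poly_le r (fun _ : 'rV[R]_d => c).
Proof.
rewrite (_ : (fun=> c) = c *: mono (fun=> 0%N)).
  by apply/poly_leZ/poly_le_mono; rewrite big1.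
by apply/funext => x; rewrite -[RHS]/(c * mono _ x) /mono big1 ?mulr1// => l _; rewrite expr0.
Qed.

Lemma smooth_mono m : smooth (mono m).
Proof.
pose D (g : R -> R) := exists p : {poly R}, g = horner p.
have D' (g : R -> R) : D g -> exists g' : R -> R,
    D g' /\ forall t : R, is_derive t 1 g (g' t).
  move=> [p ->]; exists (horner p^`()); split; first by eexists.
  by move=> t; exact: is_derive_poly.
apply: smooth_prod => l.
have := @smooth_coord_comp R d D D' (horner 'X^(m l)) l 1 0 _.
under eq_fun do rewrite mul1r addr0 hornerXn.
by apply; eexists.
Qed.

Lemma smoothZ (c : R) f : smooth f -> smooth (c *: f).
Proof. by move=> sf; apply: (@smoothM _ _ (fun=> c)) => //; exact: smooth_cst. Qed.

Lemma poly_le_smooth r f : poly_le r f -> smooth f.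
Proof.
apply: poly_le_ind; [exact: smooth_cst|exact: smoothD|exact: smoothZ|].
by move=> m _; exact: smooth_mono.
Qed.

Lemma poly_le_diff r f : poly_le r f -> diff_everywhere f.
Proof. by move=> /poly_le_smooth; exact: smooth_diff. Qed.

Lemma partial_high f i : (d <= i)%N -> partial i f = 0.
Proof.
move=> di; have di0 : dir i = 0 :> 'rV[R]_d.
  by apply/rowP => l; rewrite !mxE ltn_eqF// (leq_trans (ltn_ord l)).
by apply/funext => x; rewrite /partial di0 derive0.
Qed.

(** The truncated subtraction is harmless: when [m j] is 0, the factor [(m j)%:R] in [partial_mono]
    vanishes. *)
Let dec m (j : 'I_d) := fun l => (m l - (l == j))%N.

Lemma partial_mono m (j : 'I_d) i : j = i :> nat ->
  partial i (mono m) = (m j)%:R *: mono (dec m j).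
Proof.
move=> ji; apply/funext => x; apply: derive_val.
pose C := \prod_(l < d | l != j) x 0 l ^+ m l.
have := @is_derive_line R _ (mono m) x (dir i) 0 ((m j)%:R * mono (dec m j) x).
rewrite scale0r add0r => -[_]; apply.
pose P := C%:P * ('X + (x 0 j)%:P) ^+ m j.
rewrite (_ : (fun _ => _) = horner P); last first.
  apply/funext => t; rewrite /mono (bigD1 j)//= !mxE ji eqxx mulr1 /P !hornerE mulrC.
  congr (_ * _); apply: eq_bigr => l lj; rewrite !mxE.
  by rewrite -ji (_ : (l == j :> nat) = false) ?mulr0 ?add0r//; apply: negbTE.
apply: is_derive_eq; rewrite /P derivM derivC mul0r add0r deriv_exp derivD derivX.
rewrite derivC addr0 mul1r hornerM hornerC hornerMn horner_exp hornerD hornerX.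
rewrite hornerC add0r /mono [in RHS](bigD1 j)//= /dec eqxx subn1 mulr_natl mulrnAr.
congr (_ *+ _); rewrite mulrC; congr (_ * _); apply: eq_bigr => l /negbTE lj.
by rewrite lj subn0.
Qed.

Lemma poly_le_partial r f i : poly_le r f -> poly_le r.-1 (partial i f).
Proof.
move=> pf; have [id|di] := ltnP i d; last by rewrite partial_high//; exact: poly_le0.
suff [] : poly_le r f /\ poly_le r.-1 (partial i f) by [].
apply: (@poly_le_ind r (fun f => poly_le r f /\ poly_le r.-1 (partial i f))) pf.
- by split; [exact: poly_le0|rewrite partial_cst; exact: poly_le0].
- move=> g h [pg pg'] [ph ph']; split; first exact: poly_leD.
  by rewrite partialD; [exact: poly_leD|exact: poly_le_diff pg|exact: poly_le_diff ph].
- move=> c g [pg pg']; split; first exact: poly_leZ.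
  by rewrite partialZ; [exact: poly_leZ|exact: poly_le_diff pg].
- move=> m mr; split; first exact: poly_le_mono.
  rewrite (@partial_mono _ (Ordinal id))//.
  have [m0|m0] := posnP (m (Ordinal id)); first by rewrite m0 scale0r; exact: poly_le0.
  apply/poly_leZ/poly_le_mono; rewrite -ltnS prednK; last first.
    by apply: leq_trans mr; rewrite (bigD1 (Ordinal id))//= addn_gt0 m0.
  apply: leq_trans mr; rewrite [X in (_ < X)%N](bigD1 (Ordinal id))//=.
  rewrite (bigD1 (Ordinal id))//= /dec eqxx subn1 -addSn prednK// leq_add2l.
  by apply: leq_sum => l _; exact: leq_subr.
Qed.

(** Multiplication by a coordinate makes up for the degree lost by derivation. This bounds the
    degree of (x . grad) q in the curl of x cross q. *)
Lemma poly_le_coord_partial r f i (k : 'I_d) : poly_le r f ->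
  poly_le r (fun x : 'rV[R]_d => x 0 k * partial i f x).
Proof.
move=> pf; have [id|di] := ltnP i d; last first.
  by rewrite partial_high// (_ : (fun x => _) = 0); [exact: poly_le0|apply/funext => x; rewrite mulr0].
suff [] : poly_le r f /\ poly_le r (fun x : 'rV[R]_d => x 0 k * partial i f x) by [].
apply: (@poly_le_ind r (fun f => poly_le r f /\ poly_le r (fun x : 'rV[R]_d => x 0 k * partial i f x))) pf.
- split; first exact: poly_le0.
  by rewrite partial_cst (_ : (fun x => _) = 0); [exact: poly_le0|apply/funext => x; rewrite mulr0].
- move=> g h [pg pg'] [ph ph']; split; first exact: poly_leD.
  rewrite partialD; [|exact: poly_le_diff pg|exact: poly_le_diff ph].
  rewrite (_ : (fun x => _) = (fun x : 'rV[R]_d => x 0 k * partial i g x) + (fun x : 'rV[R]_d => x 0 k * partial i h x)).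
    exact: poly_leD.
  by apply/funext => x; exact: mulrDr.
- move=> c g [pg pg']; split; first exact: poly_leZ.
  rewrite partialZ; last exact: poly_le_diff pg.
  rewrite (_ : (fun x => _) = c *: (fun x : 'rV[R]_d => x 0 k * partial i g x)).
    exact: poly_leZ.
  by apply/funext => x; exact: mulrCA.
- move=> m mr; split; first exact: poly_le_mono.
  rewrite (@partial_mono _ (Ordinal id))//; set j := Ordinal id.
  have [m0|m0] := posnP (m j).
    rewrite m0 scale0r (_ : (fun x => _) = 0); first exact: poly_le0.
    by apply/funext => x; rewrite mulr0.
  pose m' l := (dec m j l + (l == k))%N.
  have S1 : (\sum_(l < d) (l == k) = 1)%N.
    by rewrite (bigD1 k)//= eqxx big1 ?addn0// => l /negbTE ->.
  rewrite (_ : (fun x => _) = (m j)%:R *: mono m').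
    apply/poly_leZ/poly_le_mono; rewrite big_split /= S1 addn1.
    apply: leq_trans mr; rewrite [X in (_ < X)%N](bigD1 j)//=.
    rewrite (bigD1 j)//= /dec eqxx subn1 -addSn prednK// leq_add2l.
    by apply: leq_sum => l _; exact: leq_subr.
  apply/funext => x; rewrite -[LHS]/(x 0 k * ((m j)%:R * mono (dec m j) x)).
  rewrite mulrCA -[RHS]/((m j)%:R * mono m' x); congr (_ * _).
  rewrite /mono [RHS](bigD1 k)//= [in LHS](bigD1 k)//= mulrA /m' eqxx addn1 exprS.
  by congr (_ * _); apply: eq_bigr => l /negbTE lk; rewrite lk addn0.
Qed.

End polynomials.

(** * Polynomials determined almost everywhere on an open set *)

Section polynomial_uniqueness.
Context {R : realType} {d : nat}.
Implicit Types (f g : sfield R d) (r : nat).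

Lemma poly_le_line r f (x v : 'rV[R]_d) : poly_le r f ->
  exists Q : {poly R}, forall t : R, f (t *: v + x) = Q.[t].
Proof.
apply: (@poly_le_ind _ _ r (fun f => exists Q : {poly R},
  forall t : R, f (t *: v + x) = Q.[t])) => {f}.
- by exists 0 => t; rewrite horner0.
- by move=> f g [P fP] [Q gQ]; exists (P + Q) => t; rewrite hornerD -fP -gQ.
- by move=> c f [P fP]; exists (c *: P) => t; rewrite hornerZ -fP.
- move=> m _; exists (\prod_(l < d) ((v 0 l)%:P * 'X + (x 0 l)%:P) ^+ m l) => t.
  rewrite /mono horner_prod; apply: eq_bigr => l _.
  by rewrite horner_exp !hornerE !mxE mulrC.
Qed.

Lemma poly_eq0_near (Q : {poly R}) : (\forall t \near (0 : R), Q.[t] = 0) -> Q = 0.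
Proof.
move=> /nbhs_ballP[e /= e0 eQ]; apply/eqP/negPn/negP => Q0.
(* [size Q] distinct roots are too many for a nonzero [Q]; the denominators start at 2 to stay
   strictly inside the ball of radius [e]. *)
pose rs := [seq e / (k.+2)%:R | k <- iota 0 (size Q)].
have rsQ : all (root Q) rs.
  apply/allP => _ /mapP[k _ ->]; apply/eqP/eQ.
  rewrite /ball /= sub0r normrN gtr0_norm ?divr_gt0//.
  by rewrite ltr_pdivrMr// ltr_pMr// ltr1n.
have urs : uniq rs.
  rewrite map_inj_uniq ?iota_uniq// => k l /(mulfI (lt0r_neq0 e0)) /invr_inj /eqP.
  by rewrite eqr_nat => /eqP[].
by have := max_poly_roots Q0 rsQ urs; rewrite size_map size_iota ltnn.
Qed.

(** On the line through [x] and [y] the function is a one-variable polynomial that vanishes near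
    [x], hence also at [y]. *)
Lemma poly_le_eq0_open r f (O : set 'rV[R]_d) : poly_le r f -> open O ->
  O !=set0 -> (forall x, O x -> f x = 0) -> f = 0.
Proof.
move=> pf oO [x Ox] fO; apply/funext => y.
have [Q fQ] := poly_le_line x (y - x) pf.
suff Q0 : Q = 0 by rewrite -[y](subrK x) -[y - x]scale1r fQ Q0 horner0.
apply: poly_eq0_near.
set v := y - x in fQ *.
have cl : continuous (fun t : R => t *: v + x).
  apply: continuous_rV => j.
  rewrite (_ : (fun _ => _) = (fun h : R => v 0 j * h + x 0 j)); last first.
    by apply/funext => h; rewrite !mxE mulrC.
  have daff (t : R) : {for t, continuous (fun h : R => v 0 j * h + x 0 j)}.
    apply: differentiable_continuous; apply/derivable1_diffP.
    by have [] := is_derive_affine (v 0 j) (x 0 j) t.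
  exact: daff.
have O0 : O (0 *: v + x) by rewrite scale0r add0r.
have N : \forall t \near (0 : R), O (t *: v + x) := cl 0 O (open_nbhs_nbhs (conj oO O0)).
by apply: filterS N => t Ot; rewrite -fQ; exact: fO.
Qed.

Lemma continuous_ae_open f (O : set 'rV[R]_d) : continuous f -> open O ->
  {ae leb d, forall x, O x -> f x = 0} -> forall x, O x -> f x = 0.
Proof.
move=> cf oO [N [mN N0 ON]] x Ox; apply: contrapT => fx.
pose U := O `&` f @^-1` [set~ 0].
have oU : open U.
  apply: openI => //; apply: open_comp; first by move=> z _; exact: cf.
  by apply: closed_openC; exact: closed_eq.
have := leb_open_gt0 oU (ex_intro _ x (conj Ox fx)).
rewrite lt0e => /andP[/eqP + _]; apply.
apply: (subset_measure0 _ mN _ N0); first exact: open_measurable_rV.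
by move=> z [Oz fz]; apply: ON => /(_ Oz).
Qed.

Lemma poly_le_ae_unique r f g (O : set 'rV[R]_d) : poly_le r f -> poly_le r g ->
  open O -> O !=set0 -> {ae leb d, forall x, O x -> f x = g x} -> f = g.
Proof.
move=> pf pg oO O0 fg; apply/eqP; rewrite -subr_eq0; apply/eqP.
have pfg := poly_leB pf pg; apply: (poly_le_eq0_open pfg oO O0).
apply: continuous_ae_open => //.
  by apply: diff_continuous; exact: poly_le_diff pfg.
by apply: filterS fg => x fg Ox; rewrite -[LHS]/(f x - g x) fg// subrr.
Qed.

(** The choice made by [restr] is unambiguous: two polynomials that agree almost everywhere on a
    nondegenerate simplex agree on its nonempty interior, hence everywhere. *)
Lemma restrE (M : mesh R d) (k : 'I_(ncell M)) r f p : Defs.nondegenerate k ->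
  poly_le r p -> agree (cell k) f p -> restr f k = p.
Proof.
move=> ndk pp fp; rewrite /restr.
case: xgetP => [q _ [[m pq] fq]|/(_ p)]; last by case; split=> //; exists r.
apply: (@poly_le_ae_unique (maxn r m)) (interior (cell k)) _ _ _ _ _.
- exact: poly_le_trans (leq_maxr _ _) pq.
- exact: poly_le_trans (leq_maxl _ _) pp.
- exact: open_interior.
- exact: cell_interior_neq0.
- by apply: filterS2 fp fq => x fpx fqx /interior_subset kx; rewrite -fpx// -fqx.
Qed.

End polynomial_uniqueness.

Lemma form_b_cst (R : realType) (n : nat) (M : mesh R n.+1) (c : R)
    (g : sfield R n.+1) (u : vfield R n.+1) :
  (forall k : 'I_(ncell M), Defs.nondegenerate k) -> form_b M (fun=> c) g u = 0.
Proof.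
move=> ndM; have rE (k : 'I_(ncell M)) : restr (fun=> c) k = (fun=> c).
  by apply: (@restrE _ _ _ _ 0) => //; [exact: poly_le_cst|exact: aeW].
rewrite /form_b big1 => [|k _]; last first.
  rewrite rE /integrate /Rintegral integral0_eq// => x _ /=; congr EFin.
  rewrite /dot big1 ?mul0r// => i _.
  by rewrite mxE partial_cst mulr0.
rewrite oppr0 add0r big1// => k _; rewrite big1// => l _; rewrite big1// => i _.
(* The two normals of a face are opposite, so a constant has no jump. *)
rewrite !rE /face_integral (_ : Rintegral _ _ _ = 0) ?mulr0//.
rewrite /Rintegral integral0_eq// => x _ /=; congr EFin.
rewrite /dot big1 ?mul0r// => j _.
by rewrite !mxE mulrN subrr mulr0.
Qed.

Lemma I3_ind (P : 'I_3 -> Prop) : P i0 -> P i1 -> P i2 -> forall i, P i.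
Proof.
move=> P0 P1 P2 [[|[|[|//]]] h].
- by rewrite (_ : Ordinal h = i0)//; exact: val_inj.
- by rewrite (_ : Ordinal h = i1)//; exact: val_inj.
- by rewrite (_ : Ordinal h = i2)//; exact: val_inj.
Qed.

Lemma sum_I3 (V : nmodType) (F : 'I_3 -> V) : \sum_i F i = F i0 + F i1 + F i2.
Proof.
rewrite !big_ord_recl big_ord0 addr0 addrA; congr (F _ + F _ + F _);
  exact: val_inj.
Qed.

Section vec3.
Context {R : realType}.
Implicit Types a b c : R.

Lemma rV3P (x y : 'rV[R]_3) : x 0 i0 = y 0 i0 -> x 0 i1 = y 0 i1 ->
  x 0 i2 = y 0 i2 -> x = y.
Proof. by move=> e0 e1 e2; apply/rowP; exact: I3_ind. Qed.

End vec3.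

(** * Curls of Nedelec polynomials *)

Section curl_polynomials.
Context {R : realType}.

Lemma partial_coord d (k : 'I_d) (i : 'I_3) (x : 'rV[R]_d) :
  partial i (fun y : 'rV[R]_d => y 0 k) x = (k == i :> nat)%:R.
Proof.
apply: derive_val.
have := @is_derive_line R _ (fun y : 'rV[R]_d => y 0 k) x (dir i) 0 (k == i :> nat)%:R.
rewrite scale0r add0r => -[_]; apply.
rewrite (_ : (fun _ => _) = (fun h : R => (k == i :> nat)%:R * h + x 0 k)).
  exact: is_derive_affine.
by apply/funext => h; rewrite !mxE mulrC.
Qed.

Lemma diff_coord d (k : 'I_d) : diff_everywhere (fun y : 'rV[R]_d => y 0 k).
Proof. by move=> x; exact: differentiable_coord. Qed.

Lemma emb3 (x : 'rV[R]_3) : emb x = x.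
Proof.
apply/rowP => i; rewrite mxE; case: insubP => [j _ ji|]; last by rewrite ltn_ord.
by congr (x 0 _); exact: val_inj.
Qed.

Lemma partial_coordM (k : 'I_3) (i : 'I_3) (f : sfield R 3) (x : 'rV[R]_3) :
  diff_everywhere f ->
  partial i (fun y : 'rV[R]_3 => y 0 k * f y) x =
  x 0 k * partial i f x + f x * (k == i)%:R.
Proof.
move=> df; have := partialM i (@diff_coord 3 k) df => /(congr1 (fun g => g x)).
rewrite -[X in _ = X]/(x 0 k * partial i f x + f x * partial i (fun y : 'rV[R]_3 => y 0 k) x).
by rewrite partial_coord.
Qed.

Lemma partial_cross_coord (k l i : 'I_3) (f g : sfield R 3) (x : 'rV[R]_3) :
  diff_everywhere f -> diff_everywhere g ->
  partial i (fun y : 'rV[R]_3 => y 0 k * f y - y 0 l * g y) x =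
  x 0 k * partial i f x + f x * (k == i)%:R
  - (x 0 l * partial i g x + g x * (l == i)%:R).
Proof.
move=> df dg; have dkf : diff_everywhere (fun y : 'rV[R]_3 => y 0 k * f y).
  by move=> y; apply: (@differentiableM _ _ (fun y : 'rV[R]_3 => y 0 k) f) => //; exact: diff_coord.
have dlg : diff_everywhere (fun y : 'rV[R]_3 => y 0 l * g y).
  by move=> y; apply: (@differentiableM _ _ (fun y : 'rV[R]_3 => y 0 l) g) => //; exact: diff_coord.
have dN : diff_everywhere (- (fun y : 'rV[R]_3 => y 0 l * g y)).
  by move=> y; rewrite -scaleN1r; exact: differentiableZ.
have := partialD i dkf dN => /(congr1 (fun g => g x)).
rewrite partialN// -[X in _ = X]/(_ + - _) !partial_coordM//.
Qed.

(** The identity curl (x cross q) = (div q) x - (div x) q + (q . grad) x - (x . grad) q, with div x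
    = 3 and (q . grad) x = q. *)
Lemma curl_cross (q : vfield R 3) (x : 'rV[R]_3) :
  (forall i, diff_everywhere (component q i)) ->
  curl (fun y => cross y (q y)) x = divergence q x *: x
   - (2 *: q x + \row_i \sum_(l < 3) x 0 l * partial l (component q i) x).
Proof.
move=> dq.
have c0 : component (fun y => cross y (q y)) i0 =
    (fun y => y 0 i1 * component q i2 y - y 0 i2 * component q i1 y).
  by apply/funext => y; rewrite /component /cross mxE.
have c1 : component (fun y => cross y (q y)) i1 =
    (fun y => y 0 i2 * component q i0 y - y 0 i0 * component q i2 y).
  by apply/funext => y; rewrite /component /cross mxE.
have c2 : component (fun y => cross y (q y)) i2 =
    (fun y => y 0 i0 * component q i1 y - y 0 i1 * component q i0 y).
  by apply/funext => y; rewrite /component /cross mxE.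
apply: rV3P; rewrite /curl c0 c1 c2 !partial_cross_coord// !mxE /= /divergence;
  rewrite !sum_I3; repeat (match goal with |- context [partial ?i ?f ?y] =>
    generalize (partial i f y) => ? end); rewrite /component; ring.
Qed.

Lemma vpoly_leP (d r : nat) (f g h : sfield R d) : poly_le r f -> poly_le r g ->
  poly_le r h -> vpoly_le r (fun x => vec3 (f x) (g x) (h x)).
Proof.
move=> pf pg ph; apply: I3_ind; rewrite /component.
- by rewrite (_ : (fun _ => _) = f)//; apply/funext => x; rewrite mxE.
- by rewrite (_ : (fun _ => _) = g)//; apply/funext => x; rewrite mxE.
- by rewrite (_ : (fun _ => _) = h)//; apply/funext => x; rewrite mxE.
Qed.

Lemma poly_le_sum (d r : nat) (I : Type) (s : seq I) (f : I -> sfield R d) :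
  (forall i, poly_le r (f i)) -> poly_le r (fun x => \sum_(i <- s) f i x).
Proof.
move=> pf; rewrite (_ : (fun x => _) = \sum_(i <- s) f i).
  by apply: big_ind => //; [exact: poly_le0|exact: poly_leD].
by apply/funext => x; rewrite fct_sumE.
Qed.

Lemma poly_le_partial_same (d r : nat) (f : sfield R d) i :
  poly_le r f -> poly_le r (partial i f).
Proof. by move=> /(poly_le_partial i); apply: poly_le_trans; exact: leq_pred. Qed.

Lemma vpoly_le_curl (d r : nat) (p : vfield R d) : vpoly_le r p -> vpoly_le r (curl p).
Proof.
move=> pp; have pd i j := poly_le_partial_same i (pp j).
apply: (@vpoly_leP d r
  (partial i1 (component p i2) - partial i2 (component p i1))
  (partial i2 (component p i0) - partial i0 (component p i2))
  (partial i0 (component p i1) - partial i1 (component p i0)));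
  by apply: poly_leB; exact: pd.
Qed.

Lemma poly_le_coordM (d r : nat) (k : 'I_d) (f : sfield R d) : poly_le r f ->
  poly_le r.+1 (fun x : 'rV[R]_d => x 0 k * f x).
Proof.
apply: (@poly_le_ind R d r (fun f => poly_le r.+1 (fun x : 'rV[R]_d => x 0 k * f x))) => {f}.
- by rewrite (_ : (fun x => _) = 0); [exact: poly_le0|apply/funext => x; exact: mulr0].
- move=> f g pf pg; rewrite (_ : (fun x => _) =
    (fun x : 'rV[R]_d => x 0 k * f x) + (fun x : 'rV[R]_d => x 0 k * g x)).
    exact: poly_leD.
  by apply/funext => x; exact: mulrDr.
- move=> c f pf; rewrite (_ : (fun x => _) = c *: (fun x : 'rV[R]_d => x 0 k * f x)).
    exact: poly_leZ.
  by apply/funext => x; exact: mulrCA.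
- move=> m mr; rewrite (_ : (fun x => _) = mono (fun l => m l + (l == k))%N).
    apply: poly_le_mono; rewrite big_split /=.
    have -> : (\sum_(l < d) (l == k) = 1)%N.
      by rewrite (bigD1 k)//= eqxx big1 ?addn0// => l /negbTE ->.
    by rewrite addn1.
  apply/funext => x; rewrite /mono [RHS](bigD1 k)//= [in LHS](bigD1 k)//= mulrA.
  rewrite eqxx addn1 exprS; congr (_ * _); apply: eq_bigr => l /negbTE lk.
  by rewrite lk addn0.
Qed.

Lemma vpoly_leD (d r : nat) (p q : vfield R d) : vpoly_le r p -> vpoly_le r q ->
  vpoly_le r (fun x => p x + q x).
Proof.
move=> pp pq i; rewrite (_ : component _ i = component p i + component q i).
  exact: poly_leD.
by apply/funext => x; rewrite /component mxE.
Qed.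

Lemma vpoly_le_cross (r : nat) (q : vfield R 3) : vpoly_le r q ->
  vpoly_le r.+1 (fun x => cross x (q x)).
Proof.
move=> pq; have pxq k l := poly_le_coordM k (pq l).
pose X k l := (fun x : 'rV[R]_3 => x 0 k * component q l x).
apply: (@vpoly_leP 3 r.+1 (X i1 i2 - X i2 i1) (X i2 i0 - X i0 i2) (X i0 i1 - X i1 i0));
  by apply: poly_leB; exact: pxq.
Qed.

(** In [curl_cross] the operator x . grad keeps the degree of [q], and the term (div q) x has the
    form of the Raviart-Thomas enrichment. *)
Lemma curl_nedelec3 (r : nat) (p q : vfield R 3) : vpoly_le r p -> vpoly_le r q ->
  exists P Q, [/\ vpoly_le r P, poly_le r Q &
    forall x, curl (fun y => p y + cross y (q y)) x = P x + Q x *: x].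
Proof.
move=> pp pq; have pc := vpoly_le_cross pq.
have dq i : diff_everywhere (component q i) by exact: poly_le_diff (pq i).
pose E : vfield R 3 := fun x => \row_i \sum_(l < 3) x 0 l * partial l (component q i) x.
exists (fun x => curl p x + - (2 *: q x + E x)), (divergence q); split.
- apply: vpoly_leD; first exact: vpoly_le_curl.
  move=> i; rewrite (_ : component _ i = - (2 *: component q i + component E i)).
    apply/poly_leN/poly_leD; first exact/poly_leZ/pq.
    rewrite (_ : component E i = fun x => \sum_(l < 3) x 0 l * partial l (component q i) x).
      by apply: poly_le_sum => l; apply: poly_le_coord_partial; exact: pq.
    by apply/funext => x; rewrite /component mxE.
  apply/funext => x; rewrite -[RHS]/(- (2 * q x 0 i + E x 0 i)).
  by rewrite /component [LHS]mxE; congr (- _); rewrite mxE; congr (_ + _); rewrite mxE.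
- by apply: poly_le_sum => i; apply: poly_le_partial_same; exact: pq.
move=> x; transitivity (curl p x + curl (fun y => cross y (q y)) x).
  have cD i : component (fun y => p y + cross y (q y)) i =
      component p i + component (fun y => cross y (q y)) i.
    by apply/funext => y; rewrite /component mxE.
  have dp i : diff_everywhere (component p i) by exact: poly_le_diff (pp i).
  have dc i : diff_everywhere (component (fun y => cross y (q y)) i).
    exact: poly_le_diff (pc i).
  have pD i l : partial i (component (fun y => p y + cross y (q y)) l) x =
      partial i (component p l) x + partial i (component (fun y => cross y (q y)) l) x.
    by rewrite cD partialD.
  apply: rV3P; rewrite /curl !pD !mxE /=;
    repeat (match goal with |- context [partial ?i ?f ?y] =>
      generalize (partial i f y) => ? end); ring.
rewrite curl_cross// -addrA; congr (_ + _); exact: addrC.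
Qed.

End curl_polynomials.

(** * Weak curls *)

Lemma semi_inner_eqv_dist {R : realType} {V : lmodType R} {D : V -> Prop}
    {ip : V -> V -> R} (H : semi_inner D ip) u v w : D u -> D v -> D w ->
  ip (u - v) (u - v) = 0 -> ip (u - w) (u - w) = ip (v - w) (v - w).
Proof.
move=> Du Dv Dw uv; have Duv := semi_innerB H Du Dv; have Dvw := semi_innerB H Dv Dw.
have -> : u - w = (u - v) + (v - w) by rewrite addrA subrK.
rewrite (semi_innerDl H)//; last exact: (semi_innerD H).
rewrite (semi_inner_null H)//; last exact: (semi_innerD H).
rewrite (semi_innerDr H)// (semi_innerC H (v - w) (u - v)) (semi_inner_null H)//.
by rewrite !add0r.
Qed.

Section L2_vector.
Context {R : realType} {d : nat} (Omega : set 'rV[R]_d).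
Hypothesis mO : measurable Omega.
Implicit Types (f g : sfield R d) (u v w : vfield R d).

Lemma semi_inner_L2s : semi_inner (L2s Omega) (ips Omega).
Proof.
split; [exact: L2s_0|exact: L2sD|exact: L2sZ|exact: ipsC|exact: ipsDl|exact: ipsZl|exact: ips_ge0].
Qed.

Lemma componentD u v i : component (u + v) i = component u i + component v i.
Proof. by apply/funext => x; rewrite /component mxE. Qed.

Lemma componentZ (a : R) u i : component (a *: u) i = a *: component u i.
Proof. by apply/funext => x; rewrite /component mxE. Qed.

Lemma componentN u i : component (- u) i = - component u i.
Proof. by apply/funext => x; rewrite /component mxE. Qed.

Lemma componentB u v i : component (u - v) i = component u i - component v i.
Proof. by rewrite componentD componentN. Qed.

Lemma component0 i : component (0 : vfield R d) i = 0.
Proof. by apply/funext => x; rewrite /component mxE. Qed.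

Lemma ip_sum u v : L2 Omega u -> L2 Omega v ->
  ip Omega u v = \sum_i ips Omega (component u i) (component v i).
Proof.
move=> Lu Lv; have iuv i := L2s_mul mO (Lu i) (Lv i).
rewrite sum_I3 /ips /integrate -!RintegralD//.
  by rewrite /ip /integrate; apply: eq_Rintegral => x _; rewrite /dot sum_I3.
by have := integrableD mO (iuv i0) (iuv i1).
Qed.

Lemma L2_0 : L2 Omega (0 : vfield R d).
Proof. by move=> i; rewrite component0; exact: L2s_0. Qed.

Lemma L2D u v : L2 Omega u -> L2 Omega v -> L2 Omega (u + v).
Proof. by move=> Lu Lv i; rewrite componentD; exact: L2sD. Qed.

Lemma L2Z (a : R) u : L2 Omega u -> L2 Omega (a *: u).
Proof. by move=> Lu i; rewrite componentZ; exact: L2sZ. Qed.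

Lemma ipC u v : ip Omega u v = ip Omega v u.
Proof.
rewrite /ip /integrate; apply: eq_Rintegral => x _.
by apply: eq_bigr => i _; rewrite mulrC.
Qed.

Lemma semi_inner_L2 : semi_inner (L2 Omega) (ip Omega).
Proof.
split; [exact: L2_0|exact: L2D|exact: L2Z|exact: ipC| | |].
- move=> u v w Lu Lv Lw; rewrite !ip_sum//; last exact: L2D.
  by rewrite -big_split; apply: eq_bigr => i _; rewrite componentD ipsDl.
- move=> a u w Lu Lw; rewrite !ip_sum//; last exact: L2Z.
  by rewrite mulr_sumr; apply: eq_bigr => i _; rewrite componentZ ipsZl.
- move=> u; apply: Rintegral_ge0 => x _; apply: sumr_ge0 => i _.
  by rewrite -expr2 sqr_ge0.
Qed.

Lemma ip_ae0 u : L2 Omega u -> {ae leb d, forall x, Omega x -> u x = 0} ->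
  ip Omega u u = 0.
Proof.
move=> Lu u0; rewrite ip_sum// big1// => i _.
rewrite (@ips_ae _ _ _ mO _ 0)//; [|exact: L2s_0|].
  exact: (semi_inner0l semi_inner_L2s).
by apply: filterS u0 => x u0 Ox; rewrite /component u0// mxE.
Qed.

Lemma ip_ae u v : L2 Omega u -> L2 Omega v ->
  {ae leb d, forall x, Omega x -> u x = v x} -> ip Omega (u - v) (u - v) = 0.
Proof.
move=> Lu Lv uv; apply: ip_ae0; first exact: (semi_innerB semi_inner_L2).
by apply: filterS uv => x uv Ox; rewrite -[LHS]/(u x - v x) uv// subrr.
Qed.

End L2_vector.

Section weak_curl.
Context {R : realType} {d : nat} (Omega : set 'rV[R]_d).
Hypotheses (oO : open Omega) (bO : bounded_set Omega).
Implicit Types (f phi : sfield R d) (u v w g h psi : vfield R d).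

Let mO : measurable Omega. Proof. exact: open_measurable_rV. Qed.
Let SI := semi_inner_L2 mO.

Lemma vtest_L2 psi : vtest Omega psi -> L2 Omega psi.
Proof. by move=> tpsi i; exact: test_L2s (tpsi i). Qed.

Lemma vtest_vec3 (f g h : sfield R d) : test Omega f -> test Omega g -> test Omega h ->
  vtest Omega (fun x => vec3 (f x) (g x) (h x)).
Proof.
move=> tf tg th; apply: I3_ind; rewrite /component.
- by rewrite (_ : (fun _ => _) = f)//; apply/funext => x; rewrite mxE.
- by rewrite (_ : (fun _ => _) = g)//; apply/funext => x; rewrite mxE.
- by rewrite (_ : (fun _ => _) = h)//; apply/funext => x; rewrite mxE.
Qed.

Lemma vtest_curl psi : vtest Omega psi -> vtest Omega (curl psi).
Proof.
move=> tpsi; have pd i j := test_partial i (tpsi j).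
apply: (@vtest_vec3
  (partial i1 (component psi i2) - partial i2 (component psi i1))
  (partial i2 (component psi i0) - partial i0 (component psi i2))
  (partial i0 (component psi i1) - partial i1 (component psi i0)));
  by apply: testB; exact: pd.
Qed.

Lemma vtest_grad phi : test Omega phi -> vtest Omega (grad phi).
Proof.
move=> tphi i; rewrite (_ : component _ i = partial i phi).
  exact: test_partial.
by apply/funext => x; rewrite /component mxE.
Qed.

Lemma component_grad phi i : component (grad phi) i = partial i phi.
Proof. by apply/funext => x; rewrite /component mxE. Qed.

Lemma component_curl psi : [/\
  component (curl psi) i0 = partial i1 (component psi i2) - partial i2 (component psi i1),
  component (curl psi) i1 = partial i2 (component psi i0) - partial i0 (component psi i2) &
  component (curl psi) i2 = partial i0 (component psi i1) - partial i1 (component psi i0)].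
Proof. by split; apply/funext => x; rewrite /component mxE. Qed.

Lemma curl_grad phi : smooth phi -> curl (grad phi) = 0.
Proof.
move=> sphi; apply/funext => x; apply: rV3P; rewrite !mxE /= !component_grad.
- by rewrite (partialC i1 i2 sphi) subrr.
- by rewrite (partialC i2 i0 sphi) subrr.
- by rewrite (partialC i0 i1 sphi) subrr.
Qed.

Lemma divergence_curl psi : (forall i, smooth (component psi i)) ->
  divergence (curl psi) = 0.
Proof.
move=> spsi; have dp i j : diff_everywhere (partial i (component psi j)).
  by apply: smooth_diff; exact: smooth_partial.
have dN i j : diff_everywhere (- partial i (component psi j)).
  by move=> x; rewrite -scaleN1r; apply: differentiableZ; exact: dp.
apply/funext => x; rewrite /divergence sum_I3.
have [-> -> ->] := component_curl psi.
have pB i j k l m : partial i (partial j (component psi k) - partial l (component psi m)) x =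
    partial i (partial j (component psi k)) x - partial i (partial l (component psi m)) x.
  by rewrite partialD// partialN.
rewrite !pB (partialC i1 i0 (spsi i2)) (partialC i2 i0 (spsi i1)) (partialC i2 i1 (spsi i0)).
repeat (match goal with |- context [partial ?i ?f ?y] =>
  generalize (partial i f y) => ? end).
rewrite -[RHS]/(0 : R); ring.
Qed.

(** Test fields with a single nonzero component reduce this to the scalar fundamental lemma. *)
Lemma vtest_ips_eq0 g : L2 Omega g ->
  (forall psi, vtest Omega psi -> ip Omega g psi = 0) -> ip Omega g g = 0.
Proof.
move=> Lg g0; apply: ip_ae0 => //.
have gi i : {ae leb d, forall x, Omega x -> component g i x = 0}.
  apply: (@fundamental_lemma _ _ Omega mO Omega (component g i)) => // phi tphi.
  pose psi : vfield R d := fun x => \row_j (if j == i then phi x else 0).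
  have psiE j : component psi j = if j == i then phi else 0.
    by apply/funext => x; rewrite /component mxE; case: eqP.
  have tpsi : vtest Omega psi.
    by move=> j; rewrite psiE; case: ifP => // _; exact: test0.
  have := g0 psi tpsi; rewrite ip_sum//; last exact: vtest_L2.
  rewrite (bigD1 i)//= psiE eqxx big1 ?addr0// => j /negbTE ji.
  by rewrite psiE ji (semi_inner0r (semi_inner_L2s mO)).
have : {ae leb d, forall x, forall i, Omega x -> component g i x = 0}.
  by apply: ae_countable; exact: gi.
by apply: filterS => x gx Ox; apply/rowP => i; rewrite mxE; exact: gx.
Qed.

Lemma weak_curl_unique u g h : L2 Omega g -> L2 Omega h ->
  weak_curl Omega u g -> weak_curl Omega u h -> ip Omega (g - h) (g - h) = 0.
Proof.
move=> Lg Lh ug uh; apply: vtest_ips_eq0 => [|psi tpsi].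
  exact: (semi_innerB SI).
by rewrite (semi_innerBl SI) -?ug -?uh ?subrr//; exact: vtest_L2.
Qed.

Lemma wcurlP u : H0curl Omega u -> L2 Omega (wcurl Omega u) /\ weak_curl Omega u (wcurl Omega u).
Proof.
move=> [_ [g [Lg ug _]]]; rewrite /wcurl.
by case: xgetP => [h _ //|/(_ g)]; case.
Qed.

(* The boundary condition of v enters through its approximation by test fields. *)
Lemma H0curl_parts u v gu gv : H0curl Omega u -> H0curl Omega v ->
  L2 Omega gu -> L2 Omega gv -> weak_curl Omega u gu -> weak_curl Omega v gv ->
  ip Omega u gv = ip Omega gu v.
Proof.
move=> [Lu _] [Lv [g [Lg vg vapp]]] Lgu Lgv ugu vgv.
rewrite (semi_innerC SI u) (semi_inner_eqv SI Lgv Lg Lu); last exact: weak_curl_unique vgv vg.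
rewrite (semi_innerC SI g); apply/eqP; rewrite -subr_eq0 -normr_le0 leNgt.
apply/negP => e0; set e := `|_| in e0.
(* [C] is positive and bounds the squared norms of [u] and [gu]; with squared errors below e^2 / (4
   C), Cauchy-Schwarz makes each of the two products smaller than e / 2. *)
pose C := ip Omega u u + ip Omega gu gu + 1.
have C0 : 0 < C.
  have := semi_inner_ge0 SI u; have := semi_inner_ge0 SI gu; rewrite /C; lra.
have [psi [tpsi h1 h2]] := vapp (e ^+ 2 / (4 * C)) ltac:(by rewrite divr_gt0 ?exprn_gt0 ?mulr_gt0).
have Lpsi := vtest_L2 tpsi; have Lcpsi := vtest_L2 (vtest_curl tpsi).
have Lgc := semi_innerB SI Lg Lcpsi; have Lvp := semi_innerB SI Lv Lpsi.
have E : ip Omega u g - ip Omega gu v = ip Omega u (g - curl psi) - ip Omega gu (v - psi).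
  by rewrite !(semi_innerBr SI)// ugu//; ring.
have bnd a b c (K : R) : L2 Omega a -> L2 Omega b -> ip Omega a a <= K -> 0 < K ->
    ip Omega b b < e ^+ 2 / (4 * K) -> c = ip Omega a b -> `|c| < e / 2.
  move=> La Lb aK K0 hb ->.
  rewrite -(@ltr_pXn2r _ 2)// ?nnegrE ?divr_ge0 ?(ltW e0)// real_normK ?num_real//.
  apply: le_lt_trans (Cauchy_Schwarz SI La Lb) _.
  apply: le_lt_trans (_ : K * ip Omega b b < _).
    by apply: ler_wpM2r => //; exact: semi_inner_ge0 SI _.
  move: hb; rewrite ltr_pdivlMr ?mulr_gt0// => hb.
  by rewrite expr_div_n ltr_pdivlMr; [apply: le_lt_trans hb; rewrite le_eqVlt; apply/orP; left; apply/eqP; ring|lra].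
have uC : ip Omega u u <= C by have := semi_inner_ge0 SI gu; rewrite /C; lra.
have guC : ip Omega gu gu <= C by have := semi_inner_ge0 SI u; rewrite /C; lra.
have b1 := bnd _ _ _ _ Lu Lgc uC C0 h2 erefl.
have b2 := bnd _ _ _ _ Lgu Lvp guC C0 h1 erefl.
have : e < e / 2 + e / 2.
  by rewrite {1}/e E; apply: le_lt_trans (ler_normB _ _) _; exact: ltrD.
by rewrite -splitr ltxx.
Qed.

(** The gradient of a test function is a test field with zero curl, by the symmetry of second
    derivatives. *)
Lemma weak_curl0 u v : H0curl Omega u -> L2 Omega v -> weak_curl Omega u v ->
  weak_div Omega v (fun=> 0).
Proof.
move=> _ Lv uv phi tphi; rewrite -uv; last exact: vtest_grad.
rewrite curl_grad; last by case: tphi.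
rewrite [RHS](_ : _ = 0); last first.
  by rewrite (semi_inner0l (semi_inner_L2s mO)) ?oppr0//; exact: test_L2s tphi.
rewrite /ip /integrate /Rintegral integral0_eq// => x _; congr EFin.
by rewrite /dot big1// => i _; rewrite mxE mulr0.
Qed.

(** If test fields approximate [u] in the curl norm, then their curls are divergence-free test
    fields that approximate the weak curl; so a zero tangential trace of [u] yields a zero normal
    trace of its curl. *)
Lemma wcurl_H0div u : H0curl Omega u -> H0div Omega (wcurl Omega u).
Proof.
move=> Hu; have [Lw uw] := wcurlP Hu; split=> //; exists (fun=> 0); split.
- exact: (L2s_0 mO).
- exact: weak_curl0 uw.
move=> e e0; have [_ [g [Lg ug gapp]]] := Hu; have [psi [tpsi _ h]] := gapp e e0.
exists (curl psi); split; first exact: vtest_curl.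
  rewrite (semi_inner_eqv_dist SI Lw Lg) //; first by apply: vtest_L2; exact: vtest_curl.
  exact: weak_curl_unique uw ug.
rewrite divergence_curl; last by move=> i; case: (tpsi i).
rewrite subr0 (semi_inner0l (semi_inner_L2s mO))//; exact: (L2s_0 mO).
Qed.

End weak_curl.

(** * Closures of test fields in graph norms *)

Section graph_space.
Context {R : realType} {V W : lmodType R} {DV : V -> Prop} {DW : W -> Prop}.
Context {ipV : V -> V -> R} {ipW : W -> W -> R}.
Hypotheses (HV : semi_inner DV ipV) (HW : semi_inner DW ipW).
Variables (weak : V -> W -> Prop) (tst : V -> Prop) (L : V -> W).
Hypotheses (weakD : forall u v g h, DV u -> DV v -> DW g -> DW h ->
    weak u g -> weak v h -> weak (u + v) (g + h))
  (weakZ : forall a u g, DV u -> DW g -> weak u g -> weak (a *: u) (a *: g))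
  (weak0 : weak 0 0)
  (tst0 : tst 0) (tstD : forall u v, tst u -> tst v -> tst (u + v))
  (tstZ : forall a u, tst u -> tst (a *: u))
  (tstV : forall u, tst u -> DV u) (tstW : forall u, tst u -> DW (L u))
  (LD : forall u v, tst u -> tst v -> L (u + v) = L u + L v)
  (LZ : forall a u, tst u -> L (a *: u) = a *: L u).

(* The common shape of H10, H0div and H0curl. *)
Definition graph_closure (u : V) : Prop :=
  DV u /\ exists g, [/\ DW g, weak u g &
    forall e, 0 < e -> exists phi, [/\ tst phi, ipV (u - phi) (u - phi) < e &
      ipW (g - L phi) (g - L phi) < e]].

Lemma graph_closure_subspace : subspace DV graph_closure.
Proof.
have L0 : L 0 = 0 by rewrite -(scale0r (0 : V)) LZ// scale0r.
split.
- by move=> u [].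
- split; first exact: semi_inner0 HV; exists 0; split=> //.
    exact: semi_inner0 HW.
  move=> e e0; exists 0; split=> //; rewrite ?L0 !subrr.
    by rewrite (semi_inner0l HV)//; exact: semi_inner0 HV.
  by rewrite (semi_inner0l HW)//; exact: semi_inner0 HW.
- move=> u v [Du [g [Dg ug gapp]]] [Dv [h [Dh vh happ]]].
  split; first exact: (semi_innerD HV).
  exists (g + h); split; [exact: (semi_innerD HW)|exact: weakD|].
  (* The factor 2 of the squared triangle inequality turns two errors below e / 4 into one below
     e. *)
  move=> e e0; have e4 : 0 < e / 4 by rewrite divr_gt0.
  have [phi [tphi h1 h2]] := gapp _ e4; have [psi [tpsi h3 h4]] := happ _ e4.
  have [Dphi Dpsi] := (tstV tphi, tstV tpsi); have [Wphi Wpsi] := (tstW tphi, tstW tpsi).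
  exists (phi + psi); split; first exact: tstD.
    rewrite opprD addrACA; apply: le_lt_trans (semi_inner_triangle HV _ _) _;
      [exact: (semi_innerB HV)|exact: (semi_innerB HV)|lra].
  rewrite LD// opprD addrACA; apply: le_lt_trans (semi_inner_triangle HW _ _) _;
    [exact: (semi_innerB HW)|exact: (semi_innerB HW)|lra].
- move=> a u [Du [g [Dg ug gapp]]]; split; first exact: (semi_innerZ HV).
  exists (a *: g); split; [exact: (semi_innerZ HW)|exact: weakZ|].
  (* Adding 1 to [a ^+ 2] covers the case [a = 0]. *)
  move=> e e0; have a1 : 0 < a ^+ 2 + 1 by have := sqr_ge0 a; lra.
  have ea : 0 < e / (a ^+ 2 + 1) by rewrite divr_gt0.
  have [phi [tphi h1 h2]] := gapp _ ea; exists (a *: phi); split; first exact: tstZ.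
    rewrite -scalerBr; have Dup := semi_innerB HV Du (tstV tphi).
    rewrite (semi_innerZl HV)//; last exact: (semi_innerZ HV).
    rewrite (semi_innerZr HV)// mulrA -expr2; move: h1; rewrite ltr_pdivlMr// mulrC.
    by apply: le_lt_trans; apply: ler_wpM2r; [exact: semi_inner_ge0 HV _|lra].
  rewrite LZ// -scalerBr; have Dgp := semi_innerB HW Dg (tstW tphi).
  rewrite (semi_innerZl HW)//; last exact: (semi_innerZ HW).
  rewrite (semi_innerZr HW)// mulrA -expr2; move: h2; rewrite ltr_pdivlMr// mulrC.
  by apply: le_lt_trans; apply: ler_wpM2r; [exact: semi_inner_ge0 HW _|lra].
Qed.

End graph_space.

Section graph_instances.
Context {R : realType} {d : nat} (Omega : set 'rV[R]_d).
Hypotheses (oO : open Omega) (bO : bounded_set Omega).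

Let mO : measurable Omega. Proof. exact: open_measurable_rV. Qed.
Let SI := semi_inner_L2 mO.
Let SS := semi_inner_L2s mO.

Lemma testZ (a : R) (f : sfield R d) : test Omega f -> test Omega (a *: f).
Proof.
move=> [sf [K [cK KO f0]]]; split; first exact: smoothZ.
by exists K; split=> // x nK; rewrite -[LHS]/(a * f x) f0// mulr0.
Qed.

Lemma test_diff (f : sfield R d) : test Omega f -> diff_everywhere f.
Proof. by case=> sf _; exact: smooth_diff. Qed.

Lemma vtest0 : vtest Omega (0 : vfield R d).
Proof. by move=> i; rewrite component0; exact: test0. Qed.

Lemma vtestD (u v : vfield R d) : vtest Omega u -> vtest Omega v -> vtest Omega (u + v).
Proof. by move=> tu tv i; rewrite componentD; exact: testD. Qed.

Lemma vtestZ (a : R) (u : vfield R d) : vtest Omega u -> vtest Omega (a *: u).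
Proof. by move=> tu i; rewrite componentZ; exact: testZ. Qed.

Lemma gradD (f g : sfield R d) : test Omega f -> test Omega g ->
  grad (f + g) = grad f + grad g.
Proof.
move=> tf tg; apply/funext => x; apply/rowP => i.
by rewrite !mxE partialD//; exact: test_diff.
Qed.

Lemma gradZ (a : R) (f : sfield R d) : test Omega f -> grad (a *: f) = a *: grad f.
Proof.
move=> tf; apply/funext => x; apply/rowP => i.
by rewrite !mxE partialZ//; exact: test_diff.
Qed.

Lemma partial_componentD (u v : vfield R d) i j : vtest Omega u -> vtest Omega v ->
  partial i (component (u + v) j) = partial i (component u j) + partial i (component v j).
Proof. by move=> tu tv; rewrite componentD partialD//; exact: test_diff. Qed.

Lemma partial_componentZ (a : R) (u : vfield R d) i j : vtest Omega u ->
  partial i (component (a *: u) j) = a *: partial i (component u j).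
Proof. by move=> tu; rewrite componentZ partialZ//; exact: test_diff. Qed.

Lemma divergenceD (u v : vfield R d) : vtest Omega u -> vtest Omega v ->
  divergence (u + v) = divergence u + divergence v.
Proof.
move=> tu tv; apply/funext => x; rewrite /divergence -[RHS]/(_ + _) -big_split.
by apply: eq_bigr => i _; rewrite partial_componentD.
Qed.

Lemma divergenceZ (a : R) (u : vfield R d) : vtest Omega u ->
  divergence (a *: u) = a *: divergence u.
Proof.
move=> tu; apply/funext => x; rewrite /divergence -[RHS]/(a * _) mulr_sumr.
by apply: eq_bigr => i _; rewrite partial_componentZ.
Qed.

Lemma curlD (u v : vfield R d) : vtest Omega u -> vtest Omega v ->
  curl (u + v) = curl u + curl v.
Proof.
move=> tu tv; apply/funext => x; apply: rV3P;
  rewrite -[(curl u + curl v) x]/(curl u x + curl v x) !mxE /=;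
  rewrite !partial_componentD//;
  rewrite -![(_ + _ : sfield R d) x]/(_ x + _ x);
  repeat (match goal with |- context [partial ?i ?f ?y] =>
    generalize (partial i f y) => ? end); ring.
Qed.

Lemma curlZ (a : R) (u : vfield R d) : vtest Omega u -> curl (a *: u) = a *: curl u.
Proof.
move=> tu; apply/funext => x; apply: rV3P;
  rewrite -[(a *: curl u) x]/(a *: curl u x) !mxE /=;
  rewrite !partial_componentZ//;
  rewrite -![(_ *: _ : sfield R d) x]/(_ * _ x);
  repeat (match goal with |- context [partial ?i ?f ?y] =>
    generalize (partial i f y) => ? end); ring.
Qed.

Lemma H10_subspace : subspace (L2s Omega) (H10 Omega).
Proof.
apply: (@graph_closure_subspace _ _ _ _ _ _ _ SS SI (weak_grad Omega) (test Omega) grad).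
- move=> f f' g g' Lf Lf' Lg Lg' fg fg' phi i tphi.
  have Lp := test_L2s mO bO (test_partial i tphi); have Lphi := test_L2s mO bO tphi.
  by rewrite componentD !ipsDl// fg// fg'// opprD.
- move=> a f g Lf Lg fg phi i tphi.
  have Lp := test_L2s mO bO (test_partial i tphi); have Lphi := test_L2s mO bO tphi.
  by rewrite componentZ !ipsZl// fg// mulrN.
- move=> phi i tphi; rewrite component0 !(semi_inner0l SS) ?oppr0//.
    exact: test_L2s mO bO _ _ tphi.
  exact: test_L2s mO bO _ _ (test_partial i tphi).
- exact: test0.
- exact: testD.
- exact: testZ.
- by move=> f tf; exact: test_L2s mO bO _ _ tf.
- by move=> f tf; apply: vtest_L2 => //; exact: vtest_grad.
- exact: gradD.
- exact: gradZ.
Qed.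

Lemma H0div_subspace : subspace (L2 Omega) (H0div Omega).
Proof.
apply: (@graph_closure_subspace _ _ _ _ _ _ _ SI SS (weak_div Omega) (vtest Omega) divergence).
- move=> u u' g g' Lu Lu' Lg Lg' ug ug' phi tphi.
  have Lp := vtest_L2 oO bO (vtest_grad tphi); have Lphi := test_L2s mO bO tphi.
  by rewrite ipsDl// (semi_innerDl SI)// ug// ug'// opprD.
- move=> a u g Lu Lg ug phi tphi.
  have Lp := vtest_L2 oO bO (vtest_grad tphi); have Lphi := test_L2s mO bO tphi.
  by rewrite ipsZl// (semi_innerZl SI)// ug// mulrN.
- move=> phi tphi; rewrite (semi_inner0l SI) ?(semi_inner0l SS) ?oppr0//.
    exact: test_L2s mO bO _ _ tphi.
  exact: vtest_L2 oO bO _ (vtest_grad tphi).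
- exact: vtest0.
- exact: vtestD.
- exact: vtestZ.
- by move=> f tf; exact: vtest_L2.
- move=> u tu; rewrite /divergence (_ : (fun x => _) = \sum_i partial i (component u i)).
    have pL i : L2s Omega (partial i (component u i)).
      exact: test_L2s mO bO _ _ (test_partial i (tu i)).
    by apply: (big_ind (L2s Omega)) => //; [exact: (L2s_0 mO)|move=> f g; exact: (L2sD mO)].
  by apply/funext => x; rewrite fct_sumE.
- exact: divergenceD.
- exact: divergenceZ.
Qed.

Lemma H0curl_subspace : subspace (L2 Omega) (H0curl Omega).
Proof.
apply: (@graph_closure_subspace _ _ _ _ _ _ _ SI SI (weak_curl Omega) (vtest Omega) curl).
- move=> u u' g g' Lu Lu' Lg Lg' ug ug' psi tpsi.
  have Lp := vtest_L2 oO bO (vtest_curl tpsi); have Lpsi := vtest_L2 oO bO tpsi.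
  by rewrite !(semi_innerDl SI)// ug// ug'.
- move=> a u g Lu Lg ug psi tpsi.
  have Lp := vtest_L2 oO bO (vtest_curl tpsi); have Lpsi := vtest_L2 oO bO tpsi.
  by rewrite !(semi_innerZl SI)// ug.
- move=> psi tpsi; rewrite !(semi_inner0l SI)//; first exact: vtest_L2.
  exact: vtest_L2 oO bO _ (vtest_curl tpsi).
- exact: vtest0.
- exact: vtestD.
- exact: vtestZ.
- by move=> f tf; exact: vtest_L2.
- by move=> u tu; apply: vtest_L2 => //; exact: vtest_curl.
- exact: curlD.
- exact: curlZ.
Qed.

End graph_instances.

(** * The finite element spaces *)

Section piecewise.
Context {R : realType} {d : nat} (M : mesh R d).

Lemma agreeD (V : nmodType) (A : set 'rV[R]_d) (u v p q : 'rV[R]_d -> V) :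
  agree A u p -> agree A v q -> agree A (u + v) (fun x => p x + q x).
Proof.
move=> up vq; apply: filterS2 up vq => x ux vx Ax.
by rewrite -[LHS]/(u x + v x) ux// vx.
Qed.

Lemma agreeZ (V : lmodType R) (A : set 'rV[R]_d) (a : R) (u p : 'rV[R]_d -> V) :
  agree A u p -> agree A (a *: u) (fun x => a *: p x).
Proof. by apply: filterS => x ux Ax; rewrite -[LHS]/(a *: u x) ux. Qed.

Lemma agree_component (A : set 'rV[R]_d) (u p : vfield R d) i :
  agree A u p -> agree A (component u i) (component p i).
Proof. by apply: filterS => x ux Ax; rewrite /component ux. Qed.

Lemma vpoly_le0 r : vpoly_le r (0 : vfield R d).
Proof. by move=> i; rewrite component0; exact: poly_le0. Qed.

Lemma vpoly_leZ r (a : R) (p : vfield R d) : vpoly_le r p -> vpoly_le r (fun x => a *: p x).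
Proof.
move=> pp i; rewrite (_ : component _ i = a *: component p i); first exact: poly_leZ.
by apply/funext => x; rewrite /component mxE.
Qed.

Lemma planar0 : planar (0 : vfield R d).
Proof. by move=> i x _; rewrite mxE. Qed.

Lemma planarD (p q : vfield R d) : planar p -> planar q -> planar (fun x => p x + q x).
Proof. by move=> pp pq i x di; rewrite mxE pp// pq// addr0. Qed.

Lemma planarZ (a : R) (p : vfield R d) : planar p -> planar (fun x => a *: p x).
Proof. by move=> pp i x di; rewrite mxE pp// mulr0. Qed.

(* More fields than coefficients: some nontrivial combination vanishes. *)
Lemma piecewise_dependence (J : finType) (r : nat) :
  exists N, forall v : 'I_N.+1 -> J -> sfield R d,
  (forall i j (k : 'I_(ncell M)), exists2 p, poly_le r p & agree (cell k) (v i j) p) ->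
  exists c : 'I_N.+1 -> R, (exists i, c i != 0) /\
    {ae leb d, forall x, forall jk : J * 'I_(ncell M), cell jk.2 x ->
      \sum_i c i * v i jk.1 x = 0}.
Proof.
(* The coefficients are indexed by component, cell and exponent. One field more than there are
   coefficients gives a matrix with more rows than columns, hence a nonzero vector in its left
   kernel. *)
pose I := (J * 'I_(ncell M) * {ffun 'I_d -> 'I_r.+1})%type.
exists #|{: I}| => v pv.
have /choice[C CP] : forall t : 'I_#|{: I}|.+1 * J * 'I_(ncell M),
    exists c : {ffun 'I_d -> 'I_r.+1} -> R, agree (cell t.2) (v t.1.1 t.1.2)
      (fun x => \sum_(a : {ffun 'I_d -> 'I_r.+1} | (\sum_(l < d) a l <= r)%N)
        c a * \prod_(l < d) x 0 l ^+ a l).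
  move=> [[i j] k]; have [p [c pE] vp] := pv i j k; exists c.
  by apply: filterS vp => x vx Ax; rewrite vx// pE.
pose A := \matrix_(i < #|{: I}|.+1, l < #|{: I}|)
  (let t := enum_val l in C (i, t.1.1, t.1.2) t.2).
have [y [y0 yA]] : exists y : 'rV[R]_(#|{: I}|.+1), y != 0 /\ y *m A = 0.
  have kA : kermx A != 0.
    rewrite kermx_eq0 /row_free neq_ltn; apply/orP; left.
    by rewrite ltnS; exact: rank_leq_col.
  have /rowV0Pn[y yk y0] := kA.
  by exists y; split=> //; apply/eqP; rewrite -sub_kermx.
exists (fun i => y 0 i); split.
  by move: y0; rewrite -(inj_eq (@trmx_inj _ _ _)) => /eqP y0; apply: contrapT => /forallNP h;
    apply: y0; apply/matrixP => i j; rewrite !mxE; apply/eqP/negPn/negP; rewrite (ord1 j);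
    exact: h.
have : {ae leb d, forall x, forall t : 'I_#|{: I}|.+1 * J * 'I_(ncell M), cell t.2 x ->
    v t.1.1 t.1.2 x = \sum_(a : {ffun 'I_d -> 'I_r.+1} | (\sum_(l < d) a l <= r)%N)
        C t a * \prod_(l < d) x 0 l ^+ a l}.
  by apply: ae_countable; exact: CP.
apply: filterS => x vx [j k] /= kx.
under eq_bigr do rewrite (vx (_, j, k) kx) mulr_sumr.
rewrite exchange_big big1// => a _.
under eq_bigr do rewrite mulrA.
rewrite -mulr_suml (_ : \sum_i _ = 0) ?mul0r//.
have /matrixP/(_ 0 (enum_rank (j, k, a))) := yA.
rewrite [LHS]mxE [RHS]mxE => yA0; rewrite -[RHS]yA0; apply: eq_bigr => i _.
by rewrite mxE enum_rankK.
Qed.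

End piecewise.

(** * Linearity and finite dimension of the element spaces *)

Section element_spaces.
Context {R : realType} {d : nat} (Omega : set 'rV[R]_d) (M : mesh R d).
Hypotheses (oO : open Omega) (bO : bounded_set Omega).
Hypothesis OM : Omega `<=` \bigcup_(k : 'I_(ncell M)) cell k.

Let mO : measurable Omega. Proof. exact: open_measurable_rV. Qed.
Let SI := semi_inner_L2 mO.
Let SS := semi_inner_L2s mO.

Lemma dim_le_vfield (S : vfield R d -> Prop) (m : nat) :
  (forall u, S u -> L2 Omega u) ->
  (forall u i (k : 'I_(ncell M)), S u ->
    exists2 p, poly_le m p & agree (cell k) (component u i) p) ->
  exists N, dim_le (ip Omega) S N.
Proof.
move=> SL Sp; have [N dep] := @piecewise_dependence R d M 'I_3 m.
exists N => v Sv; have [|c [c0 cv]] := dep (fun i j => component (v i) j).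
  by move=> i j k; exact: Sp.
exists c; split=> //=; apply: ip_ae0 => //.
  by apply: (semi_inner_sum SI) => i; exact/SL/Sv.
apply: filterS cv => x cx Ox; have [k _ kx] := OM Ox.
apply/rowP => j; rewrite fct_sumE summxE mxE -[RHS](cx (j, k) kx).
by apply: eq_bigr => i _; rewrite mxE.
Qed.

Lemma dim_le_sfield (S : sfield R d -> Prop) (m : nat) :
  (forall f, S f -> L2s Omega f) ->
  (forall f (k : 'I_(ncell M)), S f ->
    exists2 p, poly_le m p & agree (cell k) f p) ->
  exists N, dim_le (ips Omega) S N.
Proof.
move=> SL Sp; have [N dep] := @piecewise_dependence R d M unit m.
exists N => v Sv; have [|c [c0 cv]] := dep (fun i _ => v i).
  by move=> i j k; exact: Sp.
exists c; split=> //=.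
have Lw : L2s Omega (\sum_i c i *: v i).
  by apply: (semi_inner_sum SS) => i; exact/SL/Sv.
rewrite (@ips_ae _ _ _ mO _ 0)//; [exact: (semi_inner0l SS)|exact: L2s_0|].
apply: filterS cv => x cx Ox; have [k _ kx] := OM Ox.
by rewrite fct_sumE -[RHS](cx (tt, k) kx).
Qed.

Lemma Ugrad_subspace r : subspace (L2 Omega) (Ugrad Omega M r).
Proof.
have SH := H10_subspace oO bO; split.
- by move=> u [Hu _] i; case: (Hu i).
- split=> [i|k]; first by rewrite component0; exact: subspace0 SH.
  by exists 0; split; [exact: vpoly_le0|exact: planar0|exact: aeW].
- move=> u v [Hu pu] [Hv pv]; split=> [i|k].
    by rewrite componentD; exact: (subspaceD SH).
  have [p [pp plp up]] := pu k; have [q [pq plq vq]] := pv k.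
  exists (fun x => p x + q x); split; [exact: vpoly_leD|exact: planarD|exact: agreeD].
- move=> a u [Hu pu]; split=> [i|k].
    by rewrite componentZ; exact: (subspaceZ SH).
  have [p [pp plp up]] := pu k.
  by exists (fun x => a *: p x); split; [exact: vpoly_leZ|exact: planarZ|exact: agreeZ].
Qed.

Lemma Udiv_subspace r : subspace (L2 Omega) (Udiv Omega M r).
Proof.
have SH := H0div_subspace oO bO; split.
- by move=> u [[]].
- split=> [|k]; first exact: subspace0 SH.
  exists 0, 0; split; [exact: vpoly_le0|exact: planar0|exact: poly_le0|].
  by apply: aeW => x _; rewrite scale0r addr0.
- move=> u v [Hu pu] [Hv pv]; split=> [|k]; first exact: (subspaceD SH).
  have [p [q [pp plp pq up]]] := pu k; have [p' [q' [pp' plp' pq' vp']]] := pv k.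
  exists (fun x => p x + p' x), (q + q'); split;
    [exact: vpoly_leD|exact: planarD|exact: poly_leD|].
  apply: filterS (agreeD up vp') => x h kx; rewrite h//.
  by rewrite -[(q + q') x]/(q x + q' x) scalerDl addrACA.
- move=> a u [Hu pu]; split=> [|k]; first exact: (subspaceZ SH).
  have [p [q [pp plp pq up]]] := pu k.
  exists (fun x => a *: p x), (a *: q); split;
    [exact: vpoly_leZ|exact: planarZ|exact: poly_leZ|].
  apply: filterS (agreeZ a up) => x h kx; rewrite h//.
  by rewrite scalerDr scalerA.
Qed.

Lemma Fdg_subspace s : subspace (L2s Omega) (Fdg Omega M s).
Proof.
split.
- by move=> f [].
- by split=> [|k]; [exact: (L2s_0 mO)|exists 0; [exact: poly_le0|exact: aeW]].
- move=> f g [Lf pf] [Lg pg]; split=> [|k]; first exact: (L2sD mO).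
  have [p pp fp] := pf k; have [q pq gq] := pg k.
  by exists (p + q); [exact: poly_leD|exact: agreeD].
- move=> a f [Lf pf]; split=> [|k]; first exact: (L2sZ mO).
  have [p pp fp] := pf k.
  by exists (a *: p); [exact: poly_leZ|exact: (agreeZ (V := R))].
Qed.

Lemma crossDr (x y z : 'rV[R]_3) : cross x (y + z) = cross x y + cross x z.
Proof. by apply: rV3P; rewrite !mxE /=; ring. Qed.

Lemma crossZr (a : R) (x y : 'rV[R]_3) : cross x (a *: y) = a *: cross x y.
Proof. by apply: rV3P; rewrite !mxE /=; ring. Qed.

Lemma nedelecD r (p q : vfield R d) : nedelec r p -> nedelec r q ->
  nedelec r (fun x => p x + q x).
Proof.
rewrite /nedelec; case: ifP => _.
  move=> [p1 [q1 [g1 [P1 P2 P3 P4 P5]]]] [p2 [q2 [g2 [Q1 Q2 Q3 Q4 Q5]]]].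
  exists (fun x => p1 x + p2 x), (q1 + q2), (g1 + g2); split;
    [exact: vpoly_leD|exact: planarD|exact: poly_leD|exact: poly_leD|].
  move=> x; rewrite P5 Q5 -[(q1 + q2) x]/(q1 x + q2 x) -[(g1 + g2) x]/(g1 x + g2 x).
  by rewrite !scalerDl addrACA [X in X + _]addrACA.
move=> [p1 [q1 [P1 P2 P3]]] [p2 [q2 [Q1 Q2 Q3]]].
exists (fun x => p1 x + p2 x), (fun x => q1 x + q2 x); split;
  [exact: vpoly_leD|exact: vpoly_leD|].
by move=> x; rewrite P3 Q3 crossDr addrACA.
Qed.

Lemma nedelecZ r (a : R) (p : vfield R d) : nedelec r p -> nedelec r (fun x => a *: p x).
Proof.
rewrite /nedelec; case: ifP => _.
  move=> [p1 [q1 [g1 [P1 P2 P3 P4 P5]]]].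
  exists (fun x => a *: p1 x), (a *: q1), (a *: g1); split;
    [exact: vpoly_leZ|exact: planarZ|exact: poly_leZ|exact: poly_leZ|].
  by move=> x; rewrite P5 !scalerDr !scalerA.
move=> [p1 [q1 [P1 P2 P3]]].
exists (fun x => a *: p1 x), (fun x => a *: q1 x); split;
  [exact: vpoly_leZ|exact: vpoly_leZ|].
by move=> x; rewrite P3 crossZr scalerDr.
Qed.

Lemma nedelec0 r : nedelec r (0 : vfield R d).
Proof.
rewrite /nedelec; case: ifP => _.
  exists 0, 0, 0; split; [exact: vpoly_le0|exact: planar0|exact: poly_le0|exact: poly_le0|].
  by move=> x; rewrite !scale0r !addr0.
exists 0, 0; split; [exact: vpoly_le0|exact: vpoly_le0|].
move=> x; rewrite -[RHS]/(0 + cross (emb x) 0) -[X in cross _ X](scale0r 0).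
by rewrite crossZr scale0r addr0.
Qed.

Lemma poly_le_embM r i (f : sfield R d) : poly_le r f ->
  poly_le r.+1 (fun x => emb x 0 i * f x).
Proof.
move=> pf; have [id|di] := ltnP i d.
  rewrite (_ : (fun x => _) = fun x : 'rV[R]_d => x 0 (Ordinal id) * f x).
    exact: poly_le_coordM.
  by apply/funext => x; rewrite mxE insubT.
rewrite (_ : (fun x => _) = 0); first exact: poly_le0.
by apply/funext => x; rewrite mxE insubF ?mul0r//; apply/negbTE; rewrite -leqNgt.
Qed.

Lemma nedelec_vpoly r (p : vfield R d) : nedelec r p -> vpoly_le r.+1 p.
Proof.
rewrite /nedelec; case: ifP => _.
  move=> [p1 [q1 [g1 [P1 P2 P3 P4 P5]]]].
  have e0 := poly_le_embM i0 P3; have e1 := poly_le_embM i1 P3.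
  have P1' i := poly_le_trans (leqnSn r) (P1 i).
  have E (z : 'rV[R]_3) (q g a b c : R) : let y := z + q *: vec3 a b c + g *: vec3 0 0 1 in
      [/\ y 0 i0 = z 0 i0 + q * a, y 0 i1 = z 0 i1 + q * b & y 0 i2 = z 0 i2 + q * c + g].
    by split; rewrite !mxE /= ?mulr0 ?mulr1 ?addr0.
  apply: I3_ind.
  - rewrite (_ : component p i0 = component p1 i0 + (fun x => emb x 0 i1 * q1 x)).
      exact: poly_leD.
    apply/funext => x; rewrite -[RHS]/(p1 x 0 i0 + emb x 0 i1 * q1 x) /component P5.
    by have [-> _ _] := E (p1 x) (q1 x) (g1 x) (emb x 0 i1) (- emb x 0 i0) 0; rewrite mulrC.
  - rewrite (_ : component p i1 = component p1 i1 - (fun x => emb x 0 i0 * q1 x)).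
      exact: poly_leB.
    apply/funext => x; rewrite -[RHS]/(p1 x 0 i1 - emb x 0 i0 * q1 x) /component P5.
    by have [_ -> _] := E (p1 x) (q1 x) (g1 x) (emb x 0 i1) (- emb x 0 i0) 0; rewrite mulrN mulrC.
  - rewrite (_ : component p i2 = component p1 i2 + g1).
      exact: poly_leD.
    apply/funext => x; rewrite -[RHS]/(p1 x 0 i2 + g1 x) /component P5.
    have [_ _ ->] := E (p1 x) (q1 x) (g1 x) (emb x 0 i1) (- emb x 0 i0) 0.
    by rewrite mulr0 addr0.
move=> [p1 [q1 [P1 P2 P3]]].
have e i j := poly_le_embM i (P2 j).
have P1' i := poly_le_trans (leqnSn r) (P1 i).
apply: I3_ind.
- rewrite (_ : component p i0 = component p1 i0 +
    ((fun x => emb x 0 i1 * q1 x 0 i2) - (fun x => emb x 0 i2 * q1 x 0 i1))).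
    by apply: poly_leD => //; apply: poly_leB; exact: e.
  by apply/funext => x; rewrite /component P3 mxE; congr (_ + _); rewrite mxE.
- rewrite (_ : component p i1 = component p1 i1 +
    ((fun x => emb x 0 i2 * q1 x 0 i0) - (fun x => emb x 0 i0 * q1 x 0 i2))).
    by apply: poly_leD => //; apply: poly_leB; exact: e.
  by apply/funext => x; rewrite /component P3 mxE; congr (_ + _); rewrite mxE.
- rewrite (_ : component p i2 = component p1 i2 +
    ((fun x => emb x 0 i0 * q1 x 0 i1) - (fun x => emb x 0 i1 * q1 x 0 i0))).
    by apply: poly_leD => //; apply: poly_leB; exact: e.
  by apply/funext => x; rewrite /component P3 mxE; congr (_ + _); rewrite mxE.
Qed.

Lemma Ucurl_subspace r : subspace (L2 Omega) (Ucurl Omega M r).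
Proof.
have SH := H0curl_subspace oO bO; split.
- by move=> u [[]].
- split=> [|k]; first exact: subspace0 SH.
  by exists 0; [exact: nedelec0|exact: aeW].
- move=> u v [Hu pu] [Hv pv]; split=> [|k]; first exact: (subspaceD SH).
  have [p np up] := pu k; have [q nq vq] := pv k.
  by exists (fun x => p x + q x); [exact: nedelecD|exact: agreeD].
- move=> a u [Hu pu]; split=> [|k]; first exact: (subspaceZ SH).
  have [p np up] := pu k.
  by exists (fun x => a *: p x); [exact: nedelecZ|exact: agreeZ].
Qed.

Lemma Ugrad_dim r : exists N, dim_le (ip Omega) (Ugrad Omega M r) N.
Proof.
apply: (@dim_le_vfield _ r.+1); first exact: subspace_sub (Ugrad_subspace r).
move=> u i k [_ /(_ k)[p [pp _ up]]].
by exists (component p i); [exact: pp|exact: agree_component].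
Qed.

Lemma Udiv_dim r : exists N, dim_le (ip Omega) (Udiv Omega M r) N.
Proof.
apply: (@dim_le_vfield _ r.+1); first exact: subspace_sub (Udiv_subspace r).
move=> u i k [_ /(_ k)[p [q [pp _ pq up]]]].
exists (component p i + (fun x => emb x 0 i * q x)).
  apply: poly_leD; first exact: poly_le_trans (leqnSn r) (pp i).
  exact: poly_le_embM.
apply: filterS (agree_component i up) => x ux kx; rewrite ux//.
by rewrite /component mxE; congr (_ + _); rewrite mxE mulrC.
Qed.

Lemma Fdg_dim s : exists N, dim_le (ips Omega) (Fdg Omega M s) N.
Proof.
apply: (@dim_le_sfield _ s); first exact: subspace_sub (Fdg_subspace s).
by move=> f k [_ /(_ k)].
Qed.

Lemma Fdg_cst s (c : R) : Fdg Omega M s (fun=> c).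
Proof.
split; first by apply: L2s_cst => //; exact: leb_bounded_lt_pinfty.
by move=> k; exists (fun=> c); [exact: poly_le_cst|exact: aeW].
Qed.

Lemma emb_high (x : 'rV[R]_d) (i : 'I_3) : (d <= i)%N -> emb x 0 i = 0.
Proof. by move=> di; rewrite mxE insubF//; apply/negbTE; rewrite -leqNgt. Qed.

(** Planarity is inherited from the local polynomials, hence holds only almost everywhere. *)
Lemma Udiv_planar r u : Udiv Omega M r u ->
  {ae leb d, forall x, Omega x -> forall i : 'I_3, (d <= i)%N -> u x 0 i = 0}.
Proof.
move=> [_ pu]; have : {ae leb d, forall x, forall k : 'I_(ncell M), cell k x ->
    forall i : 'I_3, (d <= i)%N -> u x 0 i = 0}.
  apply: (@ae_countable _ _ _ _ 'I_(ncell M)) => k.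
  have [p [q [_ plp _ up]]] := pu k; apply: filterS up => x ux kx i di.
  by rewrite ux// mxE plp// mxE emb_high// mulr0 addr0.
by apply: filterS => x h Ox; have [k _ kx] := OM Ox; exact: h k kx.
Qed.

End element_spaces.

(** * Selecting components of a field *)

Section mask.
Context {R : realType} {d : nat} (Omega : set 'rV[R]_d).
Hypothesis mO : measurable Omega.
Variable b : 'I_3 -> bool.
Implicit Types u v : vfield R d.

Definition mask u : vfield R d := fun x => \row_i (if b i then u x 0 i else 0).

Lemma component_mask u i : component (mask u) i = if b i then component u i else 0.
Proof. by apply/funext => x; rewrite /component mxE; case: (b i). Qed.

Lemma maskB u v : mask (u - v) = mask u - mask v.
Proof.
apply/funext => x; rewrite -[RHS]/(mask u x - mask v x).
by apply/rowP => i; rewrite !mxE; case: (b i); rewrite ?subrr.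
Qed.

Lemma mask_L2 u : L2 Omega u -> L2 Omega (mask u).
Proof. by move=> Lu i; rewrite component_mask; case: (b i) => //; exact: L2s_0. Qed.

Lemma mask_ip u v : ip Omega (mask u) v = ip Omega u (mask v).
Proof.
rewrite /ip /integrate; apply: eq_Rintegral => x _; apply: eq_bigr => i _.
by rewrite !mxE; case: (b i); rewrite ?mulr0 ?mul0r.
Qed.

Lemma mask_le u : L2 Omega u -> ip Omega (mask u) (mask u) <= ip Omega u u.
Proof.
move=> Lu; have Lm := mask_L2 Lu; rewrite !ip_sum//; apply: ler_sum => i _.
rewrite component_mask; case: (b i) => //.
by rewrite (semi_inner0l (semi_inner_L2s mO)) ?ips_ge0//; exact: L2s_0.
Qed.

Lemma vtest_mask u : vtest Omega u -> vtest Omega (mask u).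
Proof. by move=> tu i; rewrite component_mask; case: (b i) => //; exact: test0. Qed.

End mask.

(** * The weak curl on a cell *)

Section smooth_weak_curl.
Context {R : realType} {d : nat} (Omega : set 'rV[R]_d).
Hypotheses (oO : open Omega) (bO : bounded_set Omega).

Let mO : measurable Omega. Proof. exact: open_measurable_rV. Qed.
Let SI := semi_inner_L2 mO.
Let SS := semi_inner_L2s mO.

Lemma smooth_L2s (f : sfield R d) : smooth f -> L2s Omega f.
Proof. by move=> sf; apply: continuous_L2s => //; apply: diff_continuous; exact: smooth_diff. Qed.

Lemma smooth_component_curl (p : vfield R d) i : (forall i, smooth (component p i)) ->
  smooth (component (curl p) i).
Proof.
move=> sp; have s j k : smooth (partial j (component p k)) by exact: smooth_partial.
have [e0 e1 e2] := component_curl p.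
by move: i; apply: I3_ind; rewrite ?e0 ?e1 ?e2; apply: smoothD => //; exact: smoothN.
Qed.

Lemma smooth_weak_curl (p : vfield R d) : (forall i, smooth (component p i)) ->
  weak_curl Omega p (curl p).
Proof.
move=> sp psi tpsi.
have Lp i : L2s Omega (component p i) by exact: smooth_L2s.
have Lcp i : L2s Omega (component (curl p) i).
  exact/smooth_L2s/smooth_component_curl.
have Lt i : L2s Omega (component psi i) by exact: test_L2s mO bO _ _ (tpsi i).
have Ldt i j : L2s Omega (partial i (component psi j)).
  exact: test_L2s mO bO _ _ (test_partial i (tpsi j)).
have Ldp i j : L2s Omega (partial i (component p j)).
  exact/smooth_L2s/smooth_partial.
have Lct i : L2s Omega (component (curl psi) i) by exact: vtest_L2 oO bO _ (vtest_curl tpsi) i.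
have P i j k : ips Omega (component p i) (partial j (component psi k)) =
    - ips Omega (partial j (component p i)) (component psi k).
  apply: ips_partial => //; first exact: smooth_diff.
  by apply: diff_continuous; apply: smooth_diff; exact: smooth_partial.
rewrite !ip_sum// !sum_I3.
have [-> -> ->] := component_curl psi; have [-> -> ->] := component_curl p.
rewrite !(semi_innerBr SS)// !(semi_innerBl SS)// !P.
repeat (match goal with |- context [ips Omega ?f ?g] =>
    generalize (ips Omega f g) => ? end); ring.
Qed.

Lemma ip_ae_support (O : set 'rV[R]_d) (u v w : vfield R d) :
  L2 Omega u -> L2 Omega v -> L2 Omega w ->
  {ae leb d, forall x, O x -> u x = v x} -> (forall x, ~ O x -> w x = 0) ->
  ip Omega u w = ip Omega v w.
Proof.
move=> Lu Lv Lw uv w0; rewrite !ip_sum//; apply: eq_bigr => i _.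
rewrite /ips /integrate /Rintegral; congr fine; apply: ae_eq_integral => //.
- exact: measurable_int (L2s_mul mO (Lu i) (Lw i)).
- exact: measurable_int (L2s_mul mO (Lv i) (Lw i)).
- apply: filterS uv => x uvx _; have [Ox|nOx] := pselect (O x).
    by rewrite /component uvx.
  by rewrite /component w0// !mxE !mulr0.
Qed.

(** A test field supported in the interior of the cell sees only the smooth field [p], whose weak
    and classical curls coincide. The fundamental lemma gives equality in the interior, and the
    boundary is negligible. *)
Lemma wcurl_cell (M : mesh R d) (k : 'I_(ncell M)) (u p : vfield R d) :
  Defs.nondegenerate k -> interior (cell k) `<=` Omega -> H0curl Omega u ->
  (forall i, smooth (component p i)) -> agree (cell k) u p ->
  agree (cell k) (wcurl Omega u) (curl p).
Proof.
move=> ndk kO Hu sp up; have [Lw uw] := wcurlP Hu; have [Lu _] := Hu.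
set O := interior (cell k) in kO; have oI : open O by exact: open_interior.
have scp i := smooth_component_curl i sp.
have Lp : L2 Omega p by move=> i; exact: smooth_L2s.
have Lcp : L2 Omega (curl p) by move=> i; exact: smooth_L2s.
have upO : {ae leb d, forall x, O x -> u x = p x}.
  by apply: filterS up => x ux /interior_subset.
have wi i : {ae leb d, forall x, O x -> component (wcurl Omega u - curl p) i x = 0}.
  have Lwp := semi_innerB SI Lw Lcp.
  apply: (@fundamental_lemma _ _ Omega mO O _ kO (Lwp i)) => // phi tphi.
  pose psi : vfield R d := fun x => \row_j (if j == i then phi x else 0).
  have psiE j : component psi j = if j == i then phi else 0.
    by apply/funext => x; rewrite /component mxE; case: eqP.
  have tpsiO : vtest O psi.
    by move=> j; rewrite psiE; case: ifP => // _; exact: test0.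
  have tpsi : vtest Omega psi by move=> j; exact: test_sub kO (tpsiO j).
  have Lpsi := vtest_L2 oO bO tpsi.
  have : ip Omega (wcurl Omega u - curl p) psi = 0.
    rewrite (semi_innerBl SI)// -uw// -smooth_weak_curl//.
    rewrite (@ip_ae_support O u p)//; first by rewrite subrr.
      exact: vtest_L2 oO bO _ (vtest_curl tpsi).
    move=> x nO; apply/rowP => j; rewrite [RHS]mxE.
    exact: (test_out (vtest_curl tpsiO j) nO).
  rewrite ip_sum// (bigD1 i)//= psiE eqxx big1 ?addr0// => j /negbTE ji.
  by rewrite psiE ji (semi_inner0r SS).
have : {ae leb d, forall x, forall i, O x -> component (wcurl Omega u - curl p) i x = 0}.
  by apply: ae_countable; exact: wi.
apply: filterS2 (ae_cell_interior ndk) => x kx wx xk.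
apply/rowP => i; have := wx i (kx xk); rewrite componentB.
by rewrite -[X in X = 0]/(wcurl Omega u x 0 i - curl p x 0 i) => /eqP; rewrite subr_eq0 => /eqP.
Qed.

End smooth_weak_curl.

Lemma curl_nedelec_dim3 (R : realType) (d r : nat) (p : vfield R d) : d = 3%N ->
  nedelec r p -> exists P Q, [/\ vpoly_le r P, planar P, poly_le r Q &
    forall x, curl p x = P x + Q x *: emb x].
Proof.
move=> d3; subst d => -[p1 [q1 [P1 P2 P3]]].
have [P [Q [PP PQ PE]]] := curl_nedelec3 P1 P2.
exists P, Q; split=> //.
  by move=> i x; rewrite leqNgt ltn_ord.
move=> x; rewrite emb3 -PE; congr (curl _ x); apply/funext => y.
by rewrite P3 emb3.
Qed.

(** * Orthogonal and planar parts under the curl *)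

Section orthogonal_part.
Context {R : realType} {n : nat} (Omega : set 'rV[R]_n.+1) (M : mesh R n.+1).
Hypotheses (hd : n.+1 = 2%N \/ n.+1 = 3%N).
Hypotheses (oO : open Omega) (bO : bounded_set Omega).
Hypothesis OM : Omega `<=` \bigcup_(k : 'I_(ncell M)) cell k.
Hypothesis kO : forall k : 'I_(ncell M), interior (cell k) `<=` Omega.
Hypothesis ndM : forall k : 'I_(ncell M), Defs.nondegenerate k.
Implicit Types u v w psi : vfield R n.+1.

Let mO : measurable Omega. Proof. exact: open_measurable_rV. Qed.
Let SI := semi_inner_L2 mO.

(* For d = 2 these are the projections onto the fields orthogonal to the plane
   and onto the planar fields, which curl exchanges; for d = 3 both are the
   identity. *)
Definition orth : vfield R n.+1 -> vfield R n.+1 :=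
  mask (fun i => (n.+1 != 2%N) || (i == i2)).
Definition plan : vfield R n.+1 -> vfield R n.+1 := mask (fun i => (i < n.+1)%N).

Lemma mask_id (b : 'I_3 -> bool) u : (forall i, b i) -> mask b u = u.
Proof. by move=> bT; apply/funext => x; apply/rowP => i; rewrite mxE bT. Qed.

Lemma curl_orth_plan psi : (forall i, smooth (component psi i)) ->
  curl (orth psi) = plan (curl psi) /\ orth (curl psi) = curl (plan psi).
Proof.
move=> spsi; case: hd => nE; last first.
  have oE u : orth u = u by apply: mask_id => i; rewrite nE.
  have pE u : plan u = u by apply: mask_id => i; rewrite nE ltn_ord.
  by rewrite !oE !pE.
have nb : (n.+1 != 2%N) = false by rewrite nE.
have [l0 l1 l2] : [/\ (i0 < n.+1)%N = true, (i1 < n.+1)%N = true & (i2 < n.+1)%N = false].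
  by rewrite nE.
have p2 f : partial i2 f = 0 :> sfield R n.+1 by apply: partial_high; rewrite nE.
have p0 i : partial i 0 = 0 :> sfield R n.+1 by exact: partial_cst.
have [c0 c1 c2] : [/\ component (orth psi) i0 = 0, component (orth psi) i1 = 0 &
    component (orth psi) i2 = component psi i2].
  by rewrite /orth !component_mask nb.
have [d0 d1 d2] : [/\ component (plan psi) i0 = component psi i0,
    component (plan psi) i1 = component psi i1 & component (plan psi) i2 = 0].
  by rewrite /plan !component_mask l0 l1 l2.
have [e0 e1 e2] := component_curl psi.
have [f0 f1 f2] := component_curl (orth psi).
have [g0 g1 g2] := component_curl (plan psi).
rewrite c0 c1 c2 !p2 !p0 in f0 f1 f2; rewrite d0 d1 d2 !p2 !p0 in g0 g1 g2.
rewrite !p2 in e0 e1.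
have compP u v : (forall i, component u i = component v i) -> u = v.
  move=> uv; apply/funext => x; apply/rowP => i.
  by have /(congr1 (fun h => h x)) := uv i.
split; apply: compP; apply: I3_ind;
  rewrite ?f0 ?f1 ?f2 ?g0 ?g1 ?g2 /orth /plan component_mask ?nb ?l0 ?l1 ?l2 /=
    ?e0 ?e1 ?e2 ?subr0 ?sub0r ?subrr ?oppr0//.
Qed.

Lemma vtest_smooth psi : vtest Omega psi -> forall i, smooth (component psi i).
Proof. by move=> tpsi i; case: (tpsi i). Qed.

Lemma weak_curl_orth u g : L2 Omega u -> L2 Omega g -> weak_curl Omega u g ->
  weak_curl Omega (orth u) (plan g).
Proof.
move=> Lu Lg ug psi tpsi; rewrite /orth /plan !mask_ip -/(orth _) -/(plan _).
rewrite (curl_orth_plan (vtest_smooth tpsi)).2.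
by apply: ug; exact: vtest_mask.
Qed.

Lemma H0curl_orth u : H0curl Omega u -> H0curl Omega (orth u).
Proof.
move=> [Lu [g [Lg ug gapp]]]; split; first exact: (mask_L2 mO).
exists (plan g); split; [exact: (mask_L2 mO)|exact: weak_curl_orth|].
move=> e e0; have [psi [tpsi h1 h2]] := gapp e e0.
have Lpsi := vtest_L2 oO bO tpsi; have Lcpsi := vtest_L2 oO bO (vtest_curl tpsi).
exists (orth psi); split; first exact: vtest_mask.
  rewrite /orth -maskB; apply: le_lt_trans h1; apply: (mask_le mO).
  exact: (semi_innerB SI).
rewrite (curl_orth_plan (vtest_smooth tpsi)).1 /plan -maskB.
apply: le_lt_trans h2; apply: (mask_le mO); exact: (semi_innerB SI).
Qed.

(** For d = 2 only the component g of degree at most [r.+1] survives in the orthogonal part, and its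
    curl (d_2 g, - d_1 g, 0) is planar of degree at most [r]. For d = 3 the formula for the curl of
    x cross q applies. *)
Lemma nedelec_orth r (p : vfield R n.+1) : nedelec r p ->
  nedelec r (orth p) /\ exists P Q, [/\ vpoly_le r P, planar P, poly_le r Q &
    forall x, curl (orth p) x = P x + Q x *: emb x].
Proof.
case: hd => nE.
  have n2 : (n.+1 == 2%N) = true by rewrite nE.
  rewrite /nedelec n2 => -[p1 [q1 [g1 [P1 P2 P3 P4 P5]]]].
  have op x : orth p x = g1 x *: vec3 0 0 1.
    have nb : (n.+1 != 2%N) = false by rewrite nE.
    apply: rV3P; rewrite [LHS]mxE nb /= !mxE /= ?mulr0//.
    by rewrite P5 !mxE /= P2 ?nE// !mulr0 !add0r.
  split.
    exists 0, 0, g1; split=> //; [exact: vpoly_le0|exact: planar0|exact: poly_le0|].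
    move=> x; rewrite op.
    rewrite -[RHS]/(0 + 0 *: vec3 (emb x 0 i1) (- emb x 0 i0) 0 + g1 x *: vec3 0 0 1).
    by rewrite scale0r !add0r.
  have [c0 c1 c2] : [/\ component (orth p) i0 = 0, component (orth p) i1 = 0 &
      component (orth p) i2 = g1].
    by split; apply/funext => x; rewrite /component op !mxE /= ?mulr0 ?mulr1.
  have p2 f : partial i2 f = 0 :> sfield R n.+1 by apply: partial_high; rewrite nE.
  have p0 i : partial i 0 = 0 :> sfield R n.+1 by exact: partial_cst.
  exists (fun x => vec3 (partial i1 g1 x) (- partial i0 g1 x) 0), 0; split.
  - apply: (@vpoly_leP _ n.+1 r (partial i1 g1) (- partial i0 g1) 0).
    + exact: (poly_le_partial i1 P4).
    + exact/poly_leN/(poly_le_partial i0 P4).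
    + exact: poly_le0.
  - move=> i x di; have i2le : (2 <= i)%N by move: di; rewrite [X in (X <= _)%N]nE.
    by rewrite mxE; move: i i2le {di} => [[|[|[|]]]].
  - exact: poly_le0.
  - move=> x; have zx : (0 : sfield R n.+1) x = 0 :> R by [].
    by rewrite scale0r addr0 /curl c0 c1 c2 !p2 !p0 !zx subr0 sub0r subrr.
have oE u : orth u = u by apply: mask_id => i; rewrite nE.
by rewrite oE => np; split=> //; exact: curl_nedelec_dim3 np.
Qed.

Lemma Ucurl_orth r u : Ucurl Omega M r u -> Ucurl Omega M r (orth u).
Proof.
move=> [Hu pu]; split=> [|k]; first exact: H0curl_orth.
have [p np up] := pu k; exists (orth p); first exact: (nedelec_orth np).1.
apply: filterS up => x ux kx; apply/rowP => i; rewrite !mxE.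
by case: ifP => // _; rewrite ux.
Qed.

(** The curl of [u] itself would not do for d = 2: its third component is the scalar curl of the
    planar part, whereas fields of [Udiv] are planar. *)
Lemma Udiv_wcurl_orth r u : Ucurl Omega M r u -> Udiv Omega M r (wcurl Omega (orth u)).
Proof.
move=> Uu; have [Ho _] := Ucurl_orth Uu; split=> [|k]; first exact: wcurl_H0div.
have [Hu pu] := Uu; have [p np up] := pu k.
have [no [P [Q [PP plP PQ PE]]]] := nedelec_orth np.
exists P, Q; split=> //.
have uo : agree (cell k) (orth u) (orth p).
  apply: filterS up => x ux kx; apply/rowP => i; rewrite !mxE.
  by case: ifP => // _; rewrite ux.
have sp i : smooth (component (orth p) i) by exact: poly_le_smooth (nedelec_vpoly no i).
have := wcurl_cell oO bO (ndM k) (kO (k := k)) Ho sp uo.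
by apply: filterS => x wx kx; rewrite wx.
Qed.

(** A planar [C] sees only the planar part of the curl, and that is the curl of the orthogonal part.
    Tested equations can thus be rewritten with curls that lie in [Udiv]. *)
Lemma ip_wcurl_orth C u : L2 Omega C ->
  {ae leb n.+1, forall x, Omega x -> forall i : 'I_3, (n.+1 <= i)%N -> C x 0 i = 0} ->
  H0curl Omega u -> ip Omega C (wcurl Omega u) = ip Omega C (wcurl Omega (orth u)).
Proof.
move=> LC C0 Hu; have [Lw uw] := wcurlP Hu; have [Lu _] := Hu.
have [Lwo uwo] := wcurlP (H0curl_orth Hu).
have Lpw : L2 Omega (plan (wcurl Omega u)) by exact: (mask_L2 mO).
have LpC : L2 Omega (plan C) by exact: (mask_L2 mO).
rewrite [RHS](semi_innerC SI) (semi_inner_eqv SI Lwo Lpw LC); last first.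
  by apply: (weak_curl_unique oO bO) uwo _ => //; exact: weak_curl_orth.
rewrite /plan mask_ip -/(plan C) [RHS](semi_innerC SI).
apply/esym/(semi_inner_eqv SI) => //; apply: ip_ae => //.
apply: filterS C0 => x Cx Ox; apply/rowP => i; rewrite mxE.
by case: ltnP => // /(Cx Ox).
Qed.

End orthogonal_part.

(** * Conservation laws *)

Section cross_products.
Context {R : realType} {d : nat} (Omega : set 'rV[R]_d).

(** A product of three square-integrable functions may fail to be integrable, so the sign rule is
    obtained by exchanging the positive and negative parts; if one of them is infinite, both sides
    are 0 by the convention for [fine]. *)
Lemma integrateN (f : sfield R d) :
  integrate Omega (fun x => - f x) = - integrate Omega f.
Proof.
rewrite /integrate /Rintegral (_ : (fun x => (- f x)%:E) = (\- (EFin \o f))%E)//.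
rewrite [in LHS]integralE (funeposN (EFin \o f)) (funenegN (EFin \o f)) [in RHS]integralE.
set a := integral _ _ (funeneg _); set b := integral _ _ (funepos _).
have a0 : (0 <= a)%E by exact: integral_ge0.
have b0 : (0 <= b)%E by exact: integral_ge0.
move: a b a0 b0 => [a| |] [b| |] //= _ _; first by rewrite opprB.
all: by rewrite oppr0.
Qed.

(** The triple product changes sign when two factors are exchanged; this turns the work of the
    magnetic force into a product of [J] with the electric field. *)
Lemma ip_crossf_swap (u v w : vfield R d) :
  ip Omega (crossf u w) v = - ip Omega (crossf v w) u.
Proof.
rewrite /ip -integrateN /integrate; apply: eq_Rintegral => x _.
by rewrite /dot !sum_I3 /crossf /cross !mxE /=; ring.
Qed.

Lemma ip_crossf_self (u v : vfield R d) : ip Omega (crossf u v) v = 0.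
Proof.
rewrite /ip /integrate /Rintegral integral0_eq// => x _; congr EFin.
by rewrite /dot sum_I3 /crossf /cross !mxE /=; ring.
Qed.

Lemma form_a_same (w u : vfield R d) : open Omega -> L2 Omega w ->
  form_a Omega w u u = 0.
Proof.
move=> oO Lw; rewrite /form_a /bracket subrr.
by rewrite (semi_inner0r (semi_inner_L2 (open_measurable_rV oO)))// oppr0.
Qed.

End cross_products.

(** * Discrete projection and discrete curl *)

Section projections.
Context {R : realType} {d : nat} (Omega : set 'rV[R]_d) (M : mesh R d).
Hypotheses (oO : open Omega) (bO : bounded_set Omega).
Hypothesis OM : Omega `<=` \bigcup_(k : 'I_(ncell M)) cell k.
Variable r : nat.

Let mO : measurable Omega. Proof. exact: open_measurable_rV. Qed.
Let SI := semi_inner_L2 mO.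

Lemma pi_divP u : L2 Omega u -> Udiv Omega M r (pi_div Omega M r u) /\
  forall v, Udiv Omega M r v -> ip Omega (pi_div Omega M r u) v = ip Omega u v.
Proof.
move=> Lu; rewrite /pi_div; case: xgetP => [p _ //|/(_ _)/= none].
have SD := Udiv_subspace M oO bO r; have [N dN] := Udiv_dim oO bO OM r.
have [m [e be]] := orthobasis_exists SI SD dN.
case: (none (proj (ip Omega) e u)); split; first exact: (proj_sub SD be.1).
by move=> v Uv; exact: (proj_orthogonal SI SD be).
Qed.

(** The candidate [c] shows that the choice in [curl_h] is not the default; testing the defining
    equation with the difference shows that the chosen field is [c] up to a null field. *)
Lemma curl_hP u c : Ucurl Omega M r c ->
  (forall v, Ucurl Omega M r v -> ip Omega c v = ip Omega u (wcurl Omega v)) ->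
  L2 Omega (curl_h Omega M r u) /\
  forall w, L2 Omega w -> ip Omega (curl_h Omega M r u) w = ip Omega c w.
Proof.
move=> Uc cE; have SC := Ucurl_subspace M oO bO r.
have Lc := subspace_sub SC Uc.
have [Uh hE] : Ucurl Omega M r (curl_h Omega M r u) /\
    forall v, Ucurl Omega M r v ->
    ip Omega (curl_h Omega M r u) v = ip Omega u (wcurl Omega v).
  by rewrite /curl_h; case: xgetP => [h _ //|/(_ c)]; case.
have Lh := subspace_sub SC Uh; split=> // w Lw.
apply: (semi_inner_eqv SI) => //; have Uhc := subspaceB SC Uh Uc.
by rewrite (semi_innerBl SI) ?hE ?cE ?subrr//; exact: subspace_sub SC _ Uhc.
Qed.

End projections.

Section time_limits.
Context {R : realType} (T : R).
Implicit Types (f g : R -> R) (t l : R).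

Lemma tderivB f g t a b : tderiv T f t a -> tderiv T g t b ->
  tderiv T (fun h => f h - g h) t (a - b).
Proof.
move=> fa gb; rewrite /tderiv; apply: cvg_trans (cvgB fa gb).
apply: near_eq_cvg; near=> h; rewrite /= -mulrBl.
rewrite -[LHS]/((f h - f t - (g h - g t)) / (h - t)).
by congr (_ / _); rewrite opprD opprK addrACA opprD opprK.
Unshelve. all: by end_near. Qed.

Section segment.
Context {V : lmodType R} {D : V -> Prop} {ip : V -> V -> R}.
Hypothesis H : semi_inner D ip.
Variables (x : R -> V) (t : R).
Hypotheses (tT : 0 <= t <= T) (Dx : forall h : R, 0 <= h <= T -> D (x h)).

Lemma cvg_segment (xi : R -> R) : (forall h, 0 <= xi h <= 1) ->
  ip (x h - x t) (x h - x t) @[h --> within_time T t] --> (0 : R) ->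
  ip (x t + xi h *: (x h - x t) - x t) (x t + xi h *: (x h - x t) - x t)
    @[h --> within_time T t] --> (0 : R).
Proof.
move=> xi1 xc; apply: (@squeeze_cvgr _ _ _ _ (fun=> 0) (fun h => ip (x h - x t) (x h - x t))) => //.
  near=> h; rewrite (semi_inner_ge0 H)/=.
  have [hT _] : 0 <= h <= T /\ h - t != 0 by near: h; exact: near_within_time.
  have Dd := semi_innerB H (Dx hT) (Dx tT); have Dz := semi_innerZ H (xi h) Dd.
  rewrite addrC addKr (semi_innerZl H)// (semi_innerZr H)// mulrA.
  have /andP[x0 x1] := xi1 h.
  by rewrite ler_piMl ?(semi_inner_ge0 H)// mulr_ile1.
exact: cvg_cst.
Unshelve. all: by end_near. Qed.

End segment.

Context {d : nat} (Omega : set 'rV[R]_d) (M : mesh R d) (r s : nat).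

Lemma state_cont_cvg (G : vfield R d -> sfield R d -> vfield R d -> R)
    (u : vfield R d) (rho : sfield R d) (B : vfield R d)
    (u' : R -> vfield R d) (rho' : R -> sfield R d) (B' : R -> vfield R d) t :
  state_cont Omega M r s G -> state Omega M r s u rho B ->
  (forall h : R, 0 <= h <= T -> state Omega M r s (u' h) (rho' h) (B' h)) ->
  ip Omega (u' h - u) (u' h - u) @[h --> within_time T t] --> (0 : R) ->
  ips Omega (rho' h - rho) (rho' h - rho) @[h --> within_time T t] --> (0 : R) ->
  ip Omega (B' h - B) (B' h - B) @[h --> within_time T t] --> (0 : R) ->
  G (u' h) (rho' h) (B' h) @[h --> within_time T t] --> G u rho B.
Proof.
move=> Gc st st' uc rhoc Bc; apply/cvgrPdistC_lt => e e0.
have [eta eta0 etaP] := Gc u rho B st e e0.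
have sc : ip Omega (u' h - u) (u' h - u) + ips Omega (rho' h - rho) (rho' h - rho)
    + ip Omega (B' h - B) (B' h - B) @[h --> within_time T t] --> (0 : R).
  rewrite -[X in _ --> X](addr0 (0 : R)) -[X in _ --> X + _](addr0 (0 : R)).
  by apply: cvgD => //; exact: cvgD.
have small := cvgr_lt (0 : R) sc _ eta0.
near=> h; have [hT _] : 0 <= h <= T /\ h - t != 0 by near: h; exact: near_within_time.
apply: etaP; first exact: st'.
by near: h; exact: small.
Unshelve. all: by end_near. Qed.

End time_limits.

(** * Time derivative of the helicity *)

Section helicity.
Context {R : realType} {d : nat} (Omega : set 'rV[R]_d) (M : mesh R d).
Hypotheses (oO : open Omega) (bO : bounded_set Omega).
Hypothesis OM : Omega `<=` \bigcup_(k : 'I_(ncell M)) cell k.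
Variables (r : nat) (T : R).

Let mO : measurable Omega. Proof. exact: open_measurable_rV. Qed.
Let SI := semi_inner_L2 mO.

(** The increments of [B] lie in this subspace. Choosing a vector potential for each vector of a
    basis gives potentials that depend linearly on the increment. *)
Let curls (b : vfield R d) : Prop := Udiv Omega M r b /\
  exists2 a, H0curl Omega a & weak_curl Omega a b.

Let curls_subspace : subspace (L2 Omega) curls.
Proof.
have SD := Udiv_subspace M oO bO r; have SH := H0curl_subspace oO bO.
split.
- by move=> b [Ub _]; exact: subspace_sub SD _ Ub.
- split; first exact: subspace0 SD.
  exists 0; first exact: subspace0 SH.
  move=> psi tpsi; have Lpsi := vtest_L2 oO bO tpsi.
  have Lcpsi := vtest_L2 oO bO (vtest_curl tpsi).
  by rewrite !(semi_inner0l SI).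
- move=> b c [Ub [a Ha ab]] [Uc [a' Ha' ac]]; split; first exact: (subspaceD SD).
  exists (a + a'); first exact: (subspaceD SH).
  have [La La'] := (subspace_sub SH Ha, subspace_sub SH Ha').
  have [Lb Lc] := (subspace_sub SD Ub, subspace_sub SD Uc).
  move=> psi tpsi; have Lpsi := vtest_L2 oO bO tpsi.
  have Lcpsi := vtest_L2 oO bO (vtest_curl tpsi).
  by rewrite !(semi_innerDl SI)// ab// ac.
- move=> c b [Ub [a Ha ab]]; split; first exact: (subspaceZ SD).
  exists (c *: a); first exact: (subspaceZ SH).
  have [La Lb] := (subspace_sub SH Ha, subspace_sub SD Ub).
  move=> psi tpsi; have Lpsi := vtest_L2 oO bO tpsi.
  have Lcpsi := vtest_L2 oO bO (vtest_curl tpsi).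
  by rewrite !(semi_innerZl SI)// ab.
Qed.

Variables (A B : R -> vfield R d) (t : R) (b : vfield R d).
Hypothesis tT : 0 <= t <= T.
Hypothesis hB : forall h : R, 0 <= h <= T -> Udiv Omega M r (B h).
Hypothesis hA : forall h : R, 0 <= h <= T ->
  H0curl Omega (A h) /\ weak_curl Omega (A h) (B h).
Hypothesis dB : ip_tderiv T (L2 Omega) (ip Omega) B t b.

(* No regularity of A in time is needed: by symmetry of the curl the increment
   is 2 <A(t), B(h) - B(t)> + <A(h) - A(t), B(h) - B(t)>, and the last term is
   quadratic because a vector potential of B(h) - B(t) may be chosen in a fixed
   finite-dimensional space. *)
Lemma tderiv_helicity :
  tderiv T (fun h => ip Omega (A h) (B h)) t (2 * ip Omega (A t) b).
Proof.
have SD := Udiv_subspace M oO bO r; have SH := H0curl_subspace oO bO.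
have LA (h : R) : 0 <= h <= T -> L2 Omega (A h).
  by move=> /hA[Ha _]; exact: subspace_sub SH _ Ha.
have LB (h : R) : 0 <= h <= T -> L2 Omega (B h).
  by move=> /hB; exact: subspace_sub SD _.
have Wc (h : R) : 0 <= h <= T -> curls (B h).
  by move=> hT; split; [exact: hB|exists (A h); case: (hA hT)].
have [N dN] := Udiv_dim oO bO OM r.
have dNc : dim_le (ip Omega) curls N.
  by move=> v Sv; apply: dN => i; case: (Sv i).
have [m [e be]] := orthobasis_exists SI curls_subspace dNc.
have [a aP] : exists a : 'I_m -> vfield R d,
    forall i, H0curl Omega (a i) /\ weak_curl Omega (a i) (e i).
  have /choice[a aP] : forall i, exists a, H0curl Omega a /\ weak_curl Omega a (e i).
    by move=> i; case: (be.1.1 i) => _ [a Ha ae]; exists a.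
  by exists a.
have La i : L2 Omega (a i) by exact: subspace_sub SH _ (aP i).1.
have Le i : L2 Omega (e i) by exact: subspace_sub curls_subspace _ (be.1.1 i).
have [Lb qb] := dB.
have Bc : ip_cvg (ip := ip Omega) (F := within_time T t) B (B t).
  exact: (ip_tderiv_cvg SI tT LB dB).
pose q h := (h - t)^-1 *: (B h - B t).
suff : 2 * ip Omega (q h) (A t)
    + \sum_i ip Omega (q h) (e i) * (ip Omega (B h) (a i) - ip Omega (B t) (a i))
    @[h --> within_time T t] --> 2 * ip Omega (A t) b + \sum_i ip Omega b (e i) * 0.
  rewrite [X in _ + X]big1 ?addr0; last by move=> i _; rewrite mulr0.
  apply: cvg_trans; apply: near_eq_cvg; near=> h.
  have [hT ht] : 0 <= h <= T /\ h - t != 0 by near: h; exact: near_within_time.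
  have [LAh LAt LBh LBt] := And4 (LA _ hT) (LA _ tT) (LB _ hT) (LB _ tT).
  have [[HAh ABh] [HAt ABt]] := (hA hT, hA tT).
  have LQ := semi_innerB SI LBh LBt.
  have WQ : curls (B h - B t) by apply: (subspaceB curls_subspace); exact: Wc.
  have sym : ip Omega (A h) (B t) = ip Omega (B h) (A t).
    exact: (H0curl_parts oO bO HAh HAt LBh LBt ABh ABt).
  pose a' := \sum_i ip Omega (B h - B t) (e i) *: a i.
  have Ha' : H0curl Omega a' by apply: (subspace_sum SH) => i; case: (aP i).
  have Wa' : weak_curl Omega a' (proj (ip Omega) e (B h - B t)).
    move=> psi tpsi; have Lpsi := vtest_L2 oO bO tpsi.
    have Lcpsi := vtest_L2 oO bO (vtest_curl tpsi).
    rewrite /a' /proj !(semi_inner_suml SI)//; apply: eq_bigr => i _.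
    by rewrite (aP i).2.
  have HD : H0curl Omega (A h - A t) by exact: (subspaceB SH).
  have LD := subspace_sub SH HD.
  have WD : weak_curl Omega (A h - A t) (B h - B t).
    move=> psi tpsi; have Lpsi := vtest_L2 oO bO tpsi.
    have Lcpsi := vtest_L2 oO bO (vtest_curl tpsi).
    by rewrite !(semi_innerBl SI)// ABh// ABt.
  have Lp := proj_in curls_subspace be.1 (B h - B t).
  (* The curl of [a'] is the increment of [B] up to a null field; the symmetry of the curl moves it
     from [a'] onto [A h - A t], so that only increments of [B] remain. *)
  have rem : ip Omega (A h - A t) (B h - B t) = \sum_i ip Omega (B h - B t) (e i) *
      ip Omega (B h - B t) (a i).
    rewrite (semi_innerC SI) -(proj_id SI curls_subspace be WQ LD) (semi_innerC SI).
    rewrite (H0curl_parts oO bO HD Ha' LQ Lp WD Wa') (semi_innerC SI).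
    by rewrite (semi_inner_suml SI)//; apply: eq_bigr => i _; rewrite (semi_innerC SI (a i)).
  have incr : ip Omega (A h) (B h) - ip Omega (A t) (B t) =
      2 * ip Omega (B h - B t) (A t) + ip Omega (A h - A t) (B h - B t).
    rewrite (semi_innerBr SI)// !(semi_innerBl SI)// sym (semi_innerC SI (A t) (B h)).
    by rewrite (semi_innerC SI (B t) (A t)); ring.
  rewrite /= -[RHS]/((ip Omega (A h) (B h) - ip Omega (A t) (B t)) / (h - t)).
  rewrite incr rem [RHS]mulrDl /q (semi_innerZl SI)//; congr (_ + _).
    by rewrite mulrCA [RHS]mulrC.
  rewrite mulr_suml; apply: eq_bigr => i _.
  by rewrite (semi_innerZl SI)// (semi_innerBl SI _ _ (La i))//; ring.
have nq : \forall h \near within_time T t, L2 Omega (q h).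
  exact: (near_quotient SI tT LB).
have nB : \forall h \near within_time T t, L2 Omega (B h).
  exact: (near_path t LB).
apply: cvgD.
  apply: cvgM; first exact: cvg_cst.
  rewrite (semi_innerC SI _ b); apply: (ip_cvgl SI) => //; exact: LA.
apply: cvg_sumr => i _; apply: cvgM; first exact: (ip_cvgl SI).
rewrite -(subrr (ip Omega (B t) (a i))); apply: cvgB; last exact: cvg_cst.
by apply: (ip_cvgl SI) => //; exact: LB.
Unshelve. all: by end_near. Qed.

End helicity.

(** * Time derivative of the Lagrangian *)

Section lagrangian_derivative.
Context {R : realType} {d : nat} (Omega : set 'rV[R]_d) (M : mesh R d).
Hypotheses (oO : open Omega) (bO : bounded_set Omega).
Hypothesis OM : Omega `<=` \bigcup_(k : 'I_(ncell M)) cell k.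
Variables (r s : nat) (T : R).
Hypothesis T0 : 0 < T.

Let mO : measurable Omega. Proof. exact: open_measurable_rV. Qed.
Let SI := semi_inner_L2 mO.
Let SS := semi_inner_L2s mO.

(** The increment telescopes through mixed states: [u] moves with [rho] and [B] at time [h], [rho]
    with [u] at time [t] and [B] at time [h], and [B] with both others at time [t]. Continuity of
    the functional derivatives brings their values at the mixed states to those at time [t]. *)
Lemma tderiv_lagrangian
    (l : vfield R d -> sfield R d -> vfield R d -> R)
    (lu : vfield R d -> sfield R d -> vfield R d -> vfield R d)
    (lrho : vfield R d -> sfield R d -> vfield R d -> sfield R d)
    (lB : vfield R d -> sfield R d -> vfield R d -> vfield R d)
    (u B : R -> vfield R d) (rho : R -> sfield R d) (t : R)
    (du dB : vfield R d) (drho : sfield R d) :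
  lagrangian Omega M r s l lu lrho lB -> 0 <= t <= T ->
  (forall h : R, 0 <= h <= T -> state Omega M r s (u h) (rho h) (B h)) ->
  ip_tderiv T (L2 Omega) (ip Omega) u t du ->
  ip_tderiv T (L2s Omega) (ips Omega) rho t drho ->
  ip_tderiv T (L2 Omega) (ip Omega) B t dB ->
  tderiv T (fun h => l (u h) (rho h) (B h)) t
    (ip Omega (lu (u t) (rho t) (B t)) du + ips Omega (lrho (u t) (rho t) (B t)) drho
     + ip Omega (lB (u t) (rho t) (B t)) dB).
Proof.
move=> [lL lud lrhod lBd [luc lrhoc lBc]] tT st du_ drho_ dB_.
have SG := Ugrad_subspace M oO bO r; have SF := Fdg_subspace M oO s.
have SD := Udiv_subspace M oO bO r.
have [NG dG] := Ugrad_dim oO bO OM r; have [mG [eG bG]] := orthobasis_exists SI SG dG.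
have [NF dF] := Fdg_dim oO OM s; have [mF [eF bF]] := orthobasis_exists SS SF dF.
have [ND dD] := Udiv_dim oO bO OM r; have [mD [eD bD]] := orthobasis_exists SI SD dD.
have Uu (h : R) : 0 <= h <= T -> Ugrad Omega M r (u h) by move=> /st[].
have Ur (h : R) : 0 <= h <= T -> Fdg Omega M s (rho h) by move=> /st[].
have UB (h : R) : 0 <= h <= T -> Udiv Omega M r (B h) by move=> /st[].
have Lu (h : R) : 0 <= h <= T -> L2 Omega (u h) by move=> /Uu; exact: subspace_sub SG _.
have Lr (h : R) : 0 <= h <= T -> L2s Omega (rho h) by move=> /Ur; exact: subspace_sub SF _.
have LB (h : R) : 0 <= h <= T -> L2 Omega (B h) by move=> /UB; exact: subspace_sub SD _.
have uc := ip_tderiv_cvg SI tT Lu du_; have rc := ip_tderiv_cvg SS tT Lr drho_.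
have Bc := ip_tderiv_cvg SI tT LB dB_; have stt := st t tT.
have zu : ip Omega (u t - u t) (u t - u t) @[_ --> within_time T t] --> (0 : R).
  by rewrite subrr (semi_inner0l SI); [exact: cvg_cst|exact: L2_0].
have zr : ips Omega (rho t - rho t) (rho t - rho t) @[_ --> within_time T t] --> (0 : R).
  by rewrite subrr (semi_inner0l SS); [exact: cvg_cst|exact: L2s_0].
have segu xi (h : R) : 0 <= h <= T -> Ugrad Omega M r (u t + xi *: (u h - u t)).
  move=> hT; apply: (subspaceD SG); first exact: Uu.
  by apply: (subspaceZ SG); apply: (subspaceB SG); exact: Uu.
have segr xi (h : R) : 0 <= h <= T -> Fdg Omega M s (rho t + xi *: (rho h - rho t)).
  move=> hT; apply: (subspaceD SF); first exact: Ur.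
  by apply: (subspaceZ SF); apply: (subspaceB SF); exact: Ur.
have segB xi (h : R) : 0 <= h <= T -> Udiv Omega M r (B t + xi *: (B h - B t)).
  move=> hT; apply: (subspaceD SD); first exact: UB.
  by apply: (subspaceZ SD); apply: (subspaceB SD); exact: UB.
have inc_u : (l (u h) (rho h) (B h) - l (u t) (rho h) (B h)) / (h - t)
    @[h --> within_time T t] --> ip Omega (lu (u t) (rho t) (B t)) du.
  apply: (chain_rule_increment SI SG bG T0 tT Uu du_ (L := fun h v => l v (rho h) (B h))
    (g := fun h v => lu v (rho h) (B h))).
  - by move=> h v hT Uv; have [|[]] := lL v (rho h) (B h); first by split; [|exact: Ur|exact: UB].
  - by have [[]] := lL _ _ _ stt.
  - by move=> h v dv hT Uv Udv; apply: lud => //; split; [|exact: Ur|exact: UB].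
  - move=> xi dv xi1 Udv; apply: (state_cont_cvg (luc dv Udv) stt _ _ rc Bc).
      by move=> h hT; split; [exact: segu|exact: Ur|exact: UB].
    exact: (cvg_segment SI tT Lu xi1 uc).
have inc_r : (l (u t) (rho h) (B h) - l (u t) (rho t) (B h)) / (h - t)
    @[h --> within_time T t] --> ips Omega (lrho (u t) (rho t) (B t)) drho.
  apply: (chain_rule_increment SS SF bF T0 tT Ur drho_ (L := fun h v => l (u t) v (B h))
    (g := fun h v => lrho (u t) v (B h))).
  - by move=> h v hT Uv; have [|//] := lL (u t) v (B h); split; [exact: Uu|..|exact: UB].
  - by have [] := lL _ _ _ stt.
  - by move=> h v dv hT Uv Udv; apply: lrhod => //; split; [exact: Uu|..|exact: UB].
  - move=> xi dv xi1 Udv; apply: (state_cont_cvg (lrhoc dv Udv) stt _ zu _ Bc).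
      by move=> h hT; split; [exact: Uu|exact: segr|exact: UB].
    exact: (cvg_segment SS tT Lr xi1 rc).
have inc_B : (l (u t) (rho t) (B h) - l (u t) (rho t) (B t)) / (h - t)
    @[h --> within_time T t] --> ip Omega (lB (u t) (rho t) (B t)) dB.
  apply: (chain_rule_increment SI SD bD T0 tT UB dB_ (L := fun h v => l (u t) (rho t) v)
    (g := fun h v => lB (u t) (rho t) v)).
  - by move=> h v hT Uv; have [|_ _ []//] := lL (u t) (rho t) v; split; [exact: Uu|exact: Ur|].
  - by have [_ _ []] := lL _ _ _ stt.
  - by move=> h v dv hT Uv Udv; apply: lBd => //; split; [exact: Uu|exact: Ur|].
  - move=> xi dv xi1 Udv; apply: (state_cont_cvg (lBc dv Udv) stt _ zu zr).
      by move=> h hT; split; [exact: Uu|exact: Ur|exact: segB].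
    exact: (cvg_segment SI tT LB xi1 Bc).
suff : (l (u h) (rho h) (B h) - l (u t) (rho h) (B h)) / (h - t)
    + (l (u t) (rho h) (B h) - l (u t) (rho t) (B h)) / (h - t)
    + (l (u t) (rho t) (B h) - l (u t) (rho t) (B t)) / (h - t)
    @[h --> within_time T t] --> ip Omega (lu (u t) (rho t) (B t)) du
    + ips Omega (lrho (u t) (rho t) (B t)) drho + ip Omega (lB (u t) (rho t) (B t)) dB.
  apply: cvg_trans; apply: near_eq_cvg; near=> h.
  rewrite /= -!mulrDl -[RHS]/((l (u h) (rho h) (B h) - l (u t) (rho t) (B t)) / (h - t)).
  by congr (_ / _); ring.
by apply: cvgD => //; exact: cvgD.
Unshelve. all: by end_near. Qed.

End lagrangian_derivative.

(* The space dimension d is n.+1. *)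
Theorem proposition3p3 (R : realType) (n : nat)
    (hd : n.+1 = 2%N \/ n.+1 = 3%N)
    (Omega : set 'rV[R]_n.+1) (hOmega : bounded_domain Omega)
    (M : mesh R n.+1) (hM : triangulation M Omega)
    (r s : nat) (mu lambda nu : R)
    (hmu : 0 < mu) (hlambda : 0 <= 2 * mu + 3 * lambda) (hnu : 0 < nu)
    (l : vfield R n.+1 -> sfield R n.+1 -> vfield R n.+1 -> R)
    (lu : vfield R n.+1 -> sfield R n.+1 -> vfield R n.+1 -> vfield R n.+1)
    (lrho : vfield R n.+1 -> sfield R n.+1 -> vfield R n.+1 -> sfield R n.+1)
    (lB : vfield R n.+1 -> sfield R n.+1 -> vfield R n.+1 -> vfield R n.+1)
    (hl : lagrangian Omega M r s l lu lrho lB)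
    (T : R) (hT : 0 < T)
    (u w B J H U E alpha j : R -> vfield R n.+1)
    (rho theta : R -> sfield R n.+1)
    (hu : forall t, 0 <= t <= T -> Ugrad Omega M r (u t))
    (hw : forall t, 0 <= t <= T -> Ugrad Omega M r (w t))
    (hB : forall t, 0 <= t <= T -> Udiv Omega M r (B t))
    (hrho : forall t, 0 <= t <= T -> Fdg Omega M s (rho t))
    (htheta : forall t, 0 <= t <= T -> Fdg Omega M s (theta t))
    (hJ : forall t, 0 <= t <= T -> Ucurl Omega M r (J t))
    (hH : forall t, 0 <= t <= T -> Ucurl Omega M r (H t))
    (hU : forall t, 0 <= t <= T -> Ucurl Omega M r (U t))
    (hE : forall t, 0 <= t <= T -> Ucurl Omega M r (E t))
    (halpha : forall t, 0 <= t <= T -> Ucurl Omega M r (alpha t))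
    (hj : forall t, 0 <= t <= T -> Ucurl Omega M r (j t))
    (dt_u dt_B dt_lu : R -> vfield R n.+1) (dt_rho : R -> sfield R n.+1)
    (hdt_u : forall t, 0 <= t <= T -> L2_tderiv T Omega u t (dt_u t))
    (hdt_rho : forall t, 0 <= t <= T -> L2s_tderiv T Omega rho t (dt_rho t))
    (hdt_B : forall t, 0 <= t <= T -> L2_tderiv T Omega B t (dt_B t))
    (hdt_lu : forall t, 0 <= t <= T ->
      L2_tderiv T Omega (fun t => lu (u t) (rho t) (B t)) t (dt_lu t))
    (eq_u : forall t v, 0 <= t <= T -> Ugrad Omega M r v ->
      ip Omega (dt_lu t) v + form_a Omega (w t) (u t) v
      + form_b M (theta t) (rho t) v + ip Omega (alpha t) v
      = form_d Omega mu lambda (u t) v)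
    (eq_rho : forall t sigma, 0 <= t <= T -> Fdg Omega M s sigma ->
      ips Omega (dt_rho t) sigma + form_b M sigma (rho t) (u t) = 0)
    (eq_B : forall t C, 0 <= t <= T -> Udiv Omega M r C ->
      ip Omega (dt_B t) C + ip Omega (wcurl Omega (E t)) C
      = - nu * ip Omega (wcurl Omega (j t)) C)
    (eq_w : forall t z, 0 <= t <= T -> Ugrad Omega M r z ->
      ip Omega (w t) z = ip Omega (lu (u t) (rho t) (B t)) z)
    (eq_theta : forall t tau, 0 <= t <= T -> Fdg Omega M s tau ->
      ips Omega (theta t) tau = ips Omega (lrho (u t) (rho t) (B t)) tau)
    (eq_J : forall t K, 0 <= t <= T -> Ucurl Omega M r K ->
      ip Omega (J t) K
      = - ip Omega (lB (u t) (rho t) (B t)) (wcurl Omega K))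
    (eq_H : forall t G, 0 <= t <= T -> Ucurl Omega M r G ->
      ip Omega (H t) G = ip Omega (B t) G)
    (eq_U : forall t V, 0 <= t <= T -> Ucurl Omega M r V ->
      ip Omega (U t) V = ip Omega (u t) V)
    (eq_E : forall t F, 0 <= t <= T -> Ucurl Omega M r F ->
      ip Omega (E t) F = - ip Omega (crossf (U t) (H t)) F)
    (eq_alpha : forall t beta, 0 <= t <= T -> Ucurl Omega M r beta ->
      ip Omega (alpha t) beta = - ip Omega (crossf (J t) (H t)) beta)
    (eq_j : forall t k, 0 <= t <= T -> Ucurl Omega M r k ->
      ip Omega (j t) k = ip Omega (B t) (wcurl Omega k))
    (hB0 : weak_div Omega (B 0) (fun=> 0)) :
  [/\ forall t, 0 <= t <= T -> weak_div Omega (B t) (fun=> 0),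
      forall t, 0 <= t <= T ->
        tderiv T (fun t => integrate Omega (rho t)) t 0,
      forall t, 0 <= t <= T ->
        tderiv T (fun t => ip Omega (lu (u t) (rho t) (B t)) (u t)
                           - l (u t) (rho t) (B t)) t
          (form_d Omega mu lambda (u t) (u t)
           - form_e Omega M r nu (B t)
               (pi_div Omega M r (lB (u t) (rho t) (B t)))) &
      forall A : R -> vfield R n.+1,
        (forall t, 0 <= t <= T ->
           H0curl Omega (A t) /\ weak_curl Omega (A t) (B t)) ->
        forall t, 0 <= t <= T ->
          tderiv T (fun t => ip Omega (A t) (B t)) t
            (2 * form_e Omega M r nu (B t) (pi_div Omega M r (A t)))].
Proof.
have [oO _ _ bO] := hOmega.
have [ndM _ OE _ _] := hM.
have OM : Omega `<=` \bigcup_(k : 'I_(ncell M)) cell k.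
  by rewrite OE; exact: interior_subset.
have kO (k : 'I_(ncell M)) : interior (cell k) `<=` Omega.
  by rewrite OE; apply: interiorS => x kx; exists k.
have mO : measurable Omega by exact: open_measurable_rV.
have SI := semi_inner_L2 mO; have SS := semi_inner_L2s mO.
have SG := Ugrad_subspace M oO bO r; have SD := Udiv_subspace M oO bO r.
have SF := Fdg_subspace M oO s; have SC := Ucurl_subspace M oO bO r.
have [ND dD] := Udiv_dim oO bO OM r; have [mD [eD bD]] := orthobasis_exists SI SD dD.
have [NF dF] := Fdg_dim oO OM s; have [mF [eF bF]] := orthobasis_exists SS SF dF.
have Lgrad v : Ugrad Omega M r v -> L2 Omega v by exact: subspace_sub SG _.
have Ldiv v : Udiv Omega M r v -> L2 Omega v by exact: subspace_sub SD _.
have Lcurl v : Ucurl Omega M r v -> L2 Omega v by exact: subspace_sub SC _.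
have ipC := semi_innerC SI.
have Do v : Ucurl Omega M r v -> Udiv Omega M r (wcurl Omega (orth v)).
  exact: (Udiv_wcurl_orth hd oO bO kO ndM).
have Uo v : Ucurl Omega M r v -> Ucurl Omega M r (orth v).
  exact: (Ucurl_orth hd oO bO).
have divo C v : Udiv Omega M r C -> Ucurl Omega M r v ->
    ip Omega C (wcurl Omega v) = ip Omega C (wcurl Omega (orth v)).
  move=> DC [Hv _]; apply: (ip_wcurl_orth hd oO bO) => //; first exact: Ldiv.
  by have := Udiv_planar OM DC.
have st t : 0 <= t <= T -> state Omega M r s (u t) (rho t) (B t).
  by move=> tT; split; [exact: hu|exact: hrho|exact: hB].
(* dB/dt and both curls lie in U_h^div, so the tested equation holds strongly. *)
have dB t v : 0 <= t <= T -> L2 Omega v -> ip Omega (dt_B t) v =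
    - ip Omega (wcurl Omega (orth (E t))) v
    - nu * ip Omega (wcurl Omega (orth (j t))) v.
  move=> tT Lv; have [LdB _] := hdt_B _ tT.
  have DE := Do _ (hE _ tT); have Dj := Do _ (hj _ tT).
  (* [dt_B t] is only an L^2 limit; its projection belongs to [Udiv] and has the same products. *)
  set b := proj (ip Omega) eD (dt_B t).
  have Db : Udiv Omega M r b by exact: (proj_sub SD bD.1).
  pose z := b + wcurl Omega (orth (E t)) + nu *: wcurl Omega (orth (j t)).
  have Dz : Udiv Omega M r z.
    by apply: (subspaceD SD); [exact: (subspaceD SD)|exact: (subspaceZ SD)].
  have [Lz Lb LE Lj] := And4 (Ldiv _ Dz) (Ldiv _ Db) (Ldiv _ DE) (Ldiv _ Dj).
  have LEj : L2 Omega (b + wcurl Omega (orth (E t))) by exact: (semi_innerD SI).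
  have Lnj : L2 Omega (nu *: wcurl Omega (orth (j t))) by exact: (semi_innerZ SI).
  have zE x : L2 Omega x -> ip Omega z x = ip Omega (dt_B t) x
      + ip Omega (wcurl Omega (orth (E t))) x + nu * ip Omega (wcurl Omega (orth (j t))) x.
    move=> Lx; rewrite /z (semi_innerDl SI)// (semi_innerDl SI)// (semi_innerZl SI)//.
    by rewrite /b (derivative_ip SI SD bD hT tT hB (hdt_B _ tT)).
  (* The residual [z] lies in [Udiv], so it is an admissible test field for its own equation. *)
  have zz : ip Omega z z = 0.
    rewrite zE// (ipC (wcurl _ (orth (E t)))) -(divo _ _ Dz (hE _ tT)).
    rewrite (ipC (wcurl _ (orth (j t)))) -(divo _ _ Dz (hj _ tT)) !(ipC z).
    by rewrite eq_B//; ring.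
  have := semi_inner_null SI Lz Lv zz.
  by rewrite zE// -addrA => /eqP; rewrite addr_eq0 opprD => /eqP.
(* Used in the helicity balance for d = 2, where it takes the place of the argument with U cross
   H. *)
have orth_planar v C : L2 Omega C ->
    {ae leb n.+1, forall x, Omega x -> forall i : 'I_3, (n.+1 <= i)%N -> C x 0 i = 0} ->
    L2 Omega v -> n.+1 = 2%N -> ip Omega C (orth v) = 0.
  move=> LC C0 Lv n2; rewrite -[LHS]mask_ip -/(orth C).
  have LoC : L2 Omega (orth C) by exact: (mask_L2 mO).
  apply: (semi_inner_null SI) => //; apply: ip_ae0 => //.
  apply: filterS C0 => x Cx Ox; apply/rowP => i; rewrite !mxE n2 /=.
  by case: eqP => // ->; apply: Cx; rewrite // n2.
have divB t : 0 <= t <= T -> weak_div Omega (B t) (fun=> 0).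
  move=> tT phi tphi.
  have LG : L2 Omega (grad phi) by exact: (vtest_L2 oO bO (vtest_grad tphi)).
  have LB h : 0 <= h <= T -> L2 Omega (B h) by move=> /hB; exact: Ldiv.
  (* Curls are orthogonal to gradients of test functions, so the product of [B] with [grad phi] has
     zero derivative in time. *)
  have wd v : Ucurl Omega M r v -> ip Omega (wcurl Omega (orth v)) (grad phi) = 0.
    move=> Uv; have [Hv _] := Uo _ Uv; have [Lw vw] := wcurlP Hv.
    by rewrite (weak_curl0 oO bO Hv Lw vw tphi) (semi_inner0l SS) ?oppr0//;
      exact: (test_L2s mO bO tphi).
  have cst : forall h, 0 <= h <= T -> tderiv T (fun x => ip Omega (B x) (grad phi)) h 0.
    move=> h hhT.
    have := tderiv_ip_cst SI hhT LB LG (hdt_B _ hhT).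
    by rewrite dB// !wd ?mulr0 ?subr0 ?oppr0//; [exact: hj|exact: hE].
  by rewrite (tderiv0_cst cst tT) hB0.
split=> //.
- move=> t tT; have L1 : L2s Omega (fun=> 1) by case: (Fdg_cst M oO bO s 1).
  have Lr h : 0 <= h <= T -> L2s Omega (rho h) by move=> /hrho[].
  have := tderiv_ip_cst SS tT Lr L1 (hdt_rho _ tT).
  have -> : ips Omega (dt_rho t) (fun=> 1) = 0.
    have := eq_rho _ _ tT (Fdg_cst M oO bO s 1).
    by rewrite form_b_cst// addr0.
  congr (tderiv T _ t 0); apply/funext => h; rewrite /ips; congr (integrate Omega _).
  by apply/funext => x; rewrite mulr1.
- move=> t tT; have [[Llu _] Llrho [LlB plB]] := let: And5 h _ _ _ _ := hl in h _ _ _ (st _ tT).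
  set Lu := lu _ _ _ in Llu *; set LB := lB _ _ _ in LlB plB *; set Lr := lrho _ _ _ in Llrho *.
  have Llu' h : 0 <= h <= T -> L2 Omega (lu (u h) (rho h) (B h)).
    by move=> hhT; case: hl => + _ _ _ _ => /(_ _ _ _ (st _ hhT))[[]].
  have Luh h : 0 <= h <= T -> L2 Omega (u h) by move=> /hu; exact: Lgrad.
  have d1 := tderiv_ip SI tT Llu' Luh (hdt_lu _ tT) (hdt_u _ tT).
  have d2 := tderiv_lagrangian oO bO OM hT hl tT st (hdt_u _ tT) (hdt_rho _ tT) (hdt_B _ tT).
  have [[LdB _] [Ldrho _]] := (hdt_B _ tT, hdt_rho _ tT).
  have lBo v : Ucurl Omega M r v ->
      ip Omega LB (wcurl Omega (orth v)) = - ip Omega (J t) v.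
    move=> Uv; rewrite (eq_J _ _ tT Uv) opprK; apply/esym/(ip_wcurl_orth hd oO bO) => //.
      by apply: aeW => x _ i; exact: plB.
    by case: Uv.
  (* The equation for [theta] holds against [Fdg] only, so [dt_rho t] is exchanged for its
     projection and back. *)
  have erho : ips Omega Lr (dt_rho t) = - form_b M (theta t) (rho t) (u t).
    have Fp := proj_sub SF bF.1 (dt_rho t).
    rewrite (semi_innerC SS) -(derivative_ip SS SF bF hT tT hrho (hdt_rho _ tT))//.
    rewrite (semi_innerC SS) -(eq_theta _ _ tT Fp) (semi_innerC SS).
    have Lth : L2s Omega (theta t) by case: (htheta _ tT).
    rewrite (derivative_ip SS SF bF hT tT hrho (hdt_rho _ tT))//.
    by apply/eqP; rewrite -addr_eq0; apply/eqP/eq_rho => //; exact: htheta.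
  have eB : ip Omega LB (dt_B t) = ip Omega (J t) (E t) + nu * ip Omega (J t) (j t).
    have [UE Uj] := (hE _ tT, hj _ tT).
    by rewrite ipC dB// !(ipC _ LB) !lBo// opprK mulrN opprK.
  have eal : ip Omega (alpha t) (u t) = - ip Omega (J t) (E t).
    rewrite ipC -(eq_U _ _ tT (halpha _ tT)) ipC (eq_alpha _ _ tT (hU _ tT)).
    by rewrite ip_crossf_swap opprK (ipC (J t)) (eq_E _ _ tT (hJ _ tT)) opprK.
  (* By the equation for [J], the discrete curl of the projected [LB] is [- J t]; that of [B t] is
     [j t]. *)
  have ee : form_e Omega M r nu (B t) (pi_div Omega M r LB) = nu * ip Omega (J t) (j t).
    have [Dp pE] := pi_divP oO bO OM r LlB.
    have [LJ Lj] := (Lcurl _ (hJ _ tT), Lcurl _ (hj _ tT)).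
    have [Lc1 cE1] := curl_hP oO bO (hj _ tT) (fun v => eq_j t v tT).
    have [Lc2 cE2] : L2 Omega (curl_h Omega M r (pi_div Omega M r LB)) /\
        forall w, L2 Omega w ->
        ip Omega (curl_h Omega M r (pi_div Omega M r LB)) w = ip Omega (- J t) w.
      apply: (curl_hP oO bO); first exact/(subspaceN SC)/hJ.
      move=> v Uv; have Dv := Do _ Uv; rewrite divo// pE// lBo//.
      by rewrite (semi_innerNl SI)//; exact: Lcurl.
    by rewrite /form_e cE1// ipC cE2// (semi_innerNl SI)// mulrNN.
  have := eq_u _ _ tT (hu _ tT); rewrite form_a_same//; last exact/Lgrad/hw.
  rewrite addr0 eal => eu.
  (* The product of [Lu] with [dt_u t] occurs in both derivatives and cancels, the energy being a
     Legendre transform in [u]. *)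
  have := tderivB d1 d2; rewrite -/Lu -/Lr -/LB erho eB ee -eu.
  by congr (tderiv T _ t _); ring.
- move=> A hA t tT; have [HA AB] := hA _ tT.
  have LA : L2 Omega (A t) by case: HA.
  have LBt := Ldiv _ (hB _ tT).
  have [Dp pE] := pi_divP oO bO OM r LA.
  have UH := hH _ tT.
  have Aw v : Ucurl Omega M r v ->
      ip Omega (A t) (wcurl Omega (orth v)) = ip Omega (H t) (orth v).
    move=> Uv; rewrite (eq_H _ _ tT (Uo _ Uv)).
    have [Hv _] := Uo _ Uv; have [Lw vw] := wcurlP Hv.
    exact: (H0curl_parts oO bO HA Hv).
  have AE : ip Omega (A t) (wcurl Omega (orth (E t))) = 0.
    rewrite Aw; last exact: hE.
    have UE := hE _ tT; have LE := Lcurl _ UE.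
    (* For d = 2 the orthogonal part of [E t] has zero product with the planar [B t]; for d = 3
       [orth] is the identity, and U cross H is orthogonal to [H t]. *)
    case: (hd) => nE.
      rewrite (eq_H _ _ tT (Uo _ UE)); apply: orth_planar => //.
      by have := Udiv_planar OM (hB _ tT).
    have -> : orth (E t) = E t by apply: mask_id => i; rewrite nE.
    by rewrite ipC (eq_E _ _ tT UH) ip_crossf_self oppr0.
  have [Lc1 cE1] := curl_hP oO bO (hj _ tT) (fun v => eq_j t v tT).
  (* Since the curl of [A t] is [B t], whose projection is [H t], the discrete curl of the projected
     potential is the orthogonal part of [H t]. *)
  have [Lc2 cE2] : L2 Omega (curl_h Omega M r (pi_div Omega M r (A t))) /\
      forall w, L2 Omega w ->
      ip Omega (curl_h Omega M r (pi_div Omega M r (A t))) w = ip Omega (orth (H t)) w.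
    apply: (curl_hP oO bO); first exact: Uo.
    move=> v Uv; have Dv := Do _ Uv; rewrite divo// pE// Aw//.
    by rewrite /orth mask_ip.
  have Aj : ip Omega (A t) (wcurl Omega (orth (j t))) =
      ip Omega (orth (H t)) (j t).
    by rewrite Aw ?/orth ?mask_ip//; exact: hj.
  have := tderiv_helicity oO bO OM tT hB hA (hdt_B _ tT).
  have Lj := Lcurl _ (hj _ tT).
  rewrite ipC dB// !(ipC _ (A t)) AE Aj /form_e cE1// (ipC (j t)) cE2//.
  by rewrite oppr0 sub0r mulNr.
Qed.
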